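(* Let $\boldsymbol{A}\in\mathcal{DM}_{\rm loc}(\Omega)$, let $\lambda:\Omega\to[0,1]$ be a Borel function and let $u\in BV^{\boldsymbol{A},\lambda}_{\rm loc}(\Omega)$ be such that $$\lambda u^+,\ (1-\lambda)u^-\in L^1_{\rm loc}(\Omega,|\boldsymbol{A}|)\cap L^1_{\rm loc}(\Omega,|\mathrm{div}\boldsymbol{A}|)$$ and $$|\boldsymbol{A}|(N_t)+|\mathrm{div}\boldsymbol{A}|(N_t)=0\quad\text{for }\mathscr{L}^1\text{-a.e. }t\in\mathbb{R},$$ where $N_t:=\{u^-\le t<u^+\}\setminus\{u>t\}^{1/2}$. Then $$\int_\Omega\varphi\,d(\boldsymbol{A},Du)_\lambda=\int_{-\infty}^{+\infty}\langle(\boldsymbol{A},D\chi_{\{u>t\}})_\lambda,\varphi\rangle\,dt\qquad\forall\varphi\in C^1_c(\Omega)$$ in the sense of distributions. In particular, $$|(\boldsymbol{A},Du)_\lambda|\le\int_{-\infty}^{+\infty}|(\boldsymbol{A},D\chi_{\{u>t\}})_\lambda|\,dt$$ in the sense of measures, whenever the right-hand side is well posed.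
   Context: $\Omega\subset\mathbb{R}^N$ is a nonempty open set; $\mathscr{L}^N$ is Lebesgue measure. $\mathcal{M}_{\rm loc}(\Omega)$ is the space of locally finite (signed) Radon measures on $\Omega$, $\mathcal{M}_{\rm loc}(\Omega;\mathbb{R}^N)$ the vector-valued version; $|\mu|$ is the total variation. $\mathscr{B}(\Omega)$ is the set of Borel functions $u:\Omega\to\mathbb{R}$ modulo $\mathscr{L}^N$-a.e. equality. Density: $D(E;x):=\lim_{r\to0^+}\mathscr{L}^N(E\cap B_r(x))/\mathscr{L}^N(B_r(x))$ when it exists; $\{u>t\}^{1/2}$ is the set of points where $\{u>t\}$ has density $1/2$. For $u\in\mathscr{B}(\Omega)$, for every $x\in\Omega$, $$u^-(x):=\sup\{t\in\overline{\mathbb{R}}:D(\{u<t\};x)=0\},\quad u^+(x):=\inf\{t\in\overline{\mathbb{R}}:D(\{u>t\};x)=0\},$$ $Z_u:=\{u^+=+\infty,\ u^-=-\infty\}$. For a Borel $\lambda:\Omega\to[0,1]$ set $u^\lambda:=(1-\lambda)u^-+\lambda u^+$ on $\Omega\setminus Z_u$ (with $0\cdot(\pm\infty)=0$), and on $Z_u$: $u^\lambda:=+\infty,\,0,\,-\infty$ according to $\lambda>\frac12$, $\lambda=\frac12$, $\lambda<\frac12$. $\mathcal{DM}_{\rm loc}(\Omega)$ is the set of $\boldsymbol{A}\in\mathcal{M}_{\rm loc}(\Omega;\mathbb{R}^N)$ with distributional divergence $\mathrm{div}\boldsymbol{A}\in\mathcal{M}_{\rm loc}(\Omega)$. $X^{\boldsymbol{A},\lambda}_{\rm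 loc}(\Omega):=\{u\in\mathscr{B}(\Omega):u^\lambda\in L^1_{\rm loc}(\Omega,|\boldsymbol{A}|)\cap L^1_{\rm loc}(\Omega,|\mathrm{div}\boldsymbol{A}|)\}$. For $u\in X^{\boldsymbol{A},\lambda}_{\rm loc}(\Omega)$ the $\lambda$-pairing is the distribution $$\langle(\boldsymbol{A},Du)_\lambda,\varphi\rangle:=-\int_\Omega u^\lambda\varphi\,d\,\mathrm{div}\boldsymbol{A}-\int_\Omega u^\lambda\nabla\varphi\cdot d\boldsymbol{A},$$ $\varphi\in C_c^\infty(\Omega)$, extended to $\varphi\in C^1_c(\Omega)$ by the same formula (it is always defined for characteristic functions of Borel sets). $BV^{\boldsymbol{A},\lambda}_{\rm loc}(\Omega):=\{u\in X^{\boldsymbol{A},\lambda}_{\rm loc}(\Omega):(\boldsymbol{A},Du)_\lambda\in\mathcal{M}_{\rm loc}(\Omega)\}$. The right-hand side of the last inequality is well posed when $(\boldsymbol{A},D\chi_{\{u>t\}})_\lambda$ is a Radon measure for $\mathscr{L}^1$-a.e. $t$ and $B\mapsto\int_{-\infty}^{+\infty}|(\boldsymbol{A},D\chi_{\{u>t\}})_\lambda|(B)\,dt$ is well defined as a measure.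
   Formalization: In the final inequality, ''well posed'' also requires the right-hand side to be a locally finite measure (finite on compact subsets of Ω); for right-hand sides that are not locally finite the inequality can fail on Borel sets. *)

(* Defs.v *)
From HB Require Import structures.
From mathcomp Require Import all_boot all_order all_algebra.
From mathcomp Require Import all_classical all_reals all_analysis.
From mathcomp Require Import measurable_realfun.
Set Implicit Arguments.
Unset Strict Implicit.
Unset Printing Implicit Defensive.
Import Order.TTheory GRing.Theory Num.Theory.
Import numFieldNormedType.Exports.
Local Open Scope classical_set_scope.
Local Open Scope ring_scope.
Local Open Scope ereal_scope.

#[warning="-redundant-canonical-projection"]
HB.instance Definition _ (R : realType) (n : nat) :=
  Measurable.copy 'rV[R]_n (g_sigma_algebraType (@open 'rV[R]_n)).

(* The library norm and balls of 'rV[R]_n are those of the sup norm. *)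
Definition enorm (R : realType) (n : nat) (v : 'rV[R]_n) : R :=
  Num.sqrt (\sum_(i < n) (v ord0 i) ^+ 2)%R.

Definition eball (R : realType) (n : nat) (x : 'rV[R]_n) (r : R) :
  set 'rV[R]_n := [set y | (enorm (y - x) < r)%R].

(* n-dimensional Lebesgue measure as the n-fold product of the one-dimensional
   one, computed by sections; meaningful on Borel sets only. *)
Fixpoint lebN (R : realType) (n : nat) : set 'rV[R]_n -> \bar R :=
  match n with
  | 0 => fun E => \d_(0%R : 'rV[R]_0) E
  | n'.+1 => fun E => \int[@lebesgue_measure R]_s
      lebN [set y : 'rV[R]_n' | E (row_mx (const_mx s : 'rV[R]_1) y)]
  end.

Definition has_density (R : realType) (n : nat) (E : set 'rV[R]_n)
    (x : 'rV[R]_n) (d : R) : Prop :=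
  (fine (lebN (E `&` eball x r)) / fine (lebN (eball x r)))%R
    @[r --> (0%R : R)^'+] --> d.

Section approximate_limits.
Context (R : realType) (n : nat) (Omega : set 'rV[R]_n) (u : 'rV[R]_n -> R).
Implicit Type x : 'rV[R]_n.

Definition approx_inf x : \bar R :=
  ereal_sup [set t : \bar R |
    has_density [set y | Omega y /\ (u y)%:E < t] x 0%R].

Definition approx_sup x : \bar R :=
  ereal_inf [set t : \bar R |
    has_density [set y | Omega y /\ t < (u y)%:E] x 0%R].

Definition superlevel (t : R) : set 'rV[R]_n :=
  [set y | Omega y /\ (t < u y)%R].

(* u^lambda; the first branch is the set Z_u *)
Definition lambda_repr (lam : 'rV[R]_n -> R) x : \bar R :=
  if (approx_sup x == +oo) && (approx_inf x == -oo) then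
    if (2^-1 < lam x)%R then +oo else
    if lam x == 2^-1%R then 0 else -oo
  else (1 - lam x)%:E * approx_inf x + (lam x)%:E * approx_sup x.

Definition exceptional_set (t : R) : set 'rV[R]_n :=
  [set x | [/\ Omega x, approx_inf x <= t%:E, t%:E < approx_sup x &
               ~ has_density (superlevel t) x 2^-1%R]].

End approximate_limits.

Section test_functions.
Context (R : realType) (n : nat).
Implicit Type phi : 'rV[R]_n -> R.

Definition partial_deriv (i : 'I_n) phi : 'rV[R]_n -> R :=
  'D_(delta_mx ord0 i) phi.

Fixpoint Ck (k : nat) phi : Prop :=
  match k with
  | 0 => continuous phi
  | k'.+1 => continuous phi /\
      forall i : 'I_n, (forall x, derivable phi x (delta_mx ord0 i)) /\
                       Ck k' (partial_deriv i phi)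
  end.

Definition compactly_in (Omega E : set 'rV[R]_n) : Prop :=
  exists K : set 'rV[R]_n, [/\ compact K, K `<=` Omega & E `<=` K].

(* Functions of C_c(Omega) are extended by 0 to the whole space. *)
Definition Ckc (Omega : set 'rV[R]_n) (k : nat) phi : Prop :=
  Ck k phi /\ compactly_in Omega [set x | phi x != 0%R].

Definition Cinftyc (Omega : set 'rV[R]_n) phi : Prop :=
  forall k, Ckc Omega k phi.

End test_functions.

Section radon_measures.
Context (R : realType) (n : nat) (Omega : set 'rV[R]_n).

(* A locally finite signed or vector Radon measure on Omega is a set function,
   of which only the values on Borel sets contained in a compact subset of
   Omega matter, that is countably additive inside each such compact set. *)
Definition radon (V : normedModType R) (mu : set 'rV[R]_n -> V) : Prop :=
  mu set0 = 0%R /\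
  forall (K : set 'rV[R]_n) (F : nat -> set 'rV[R]_n),
    compact K -> K `<=` Omega ->
    (forall i, measurable (F i)) -> (forall i, F i `<=` K) ->
    trivIset setT F ->
    series (fun i => mu (F i)) @ \oo --> mu (\bigcup_i F i).

Definition variation_wrt (V : Type) (nrm : V -> R) (mu : set 'rV[R]_n -> V)
    (B : set 'rV[R]_n) : \bar R :=
  ereal_sup [set s | exists F : nat -> set 'rV[R]_n,
    [/\ forall i, measurable (F i), forall i, compactly_in Omega (F i),
        trivIset setT F, \bigcup_i F i `<=` B &
        s = \sum_(0 <= i <oo) (nrm (mu (F i)))%:E]].

Definition radon_variation (mu : set 'rV[R]_n -> R) : set 'rV[R]_n -> \bar R :=
  variation_wrt (fun r : R => `|r|%R) mu.

Definition vradon_variation (m : nat) (A : set 'rV[R]_n -> 'rV[R]_m) :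
  set 'rV[R]_n -> \bar R := variation_wrt (@enorm R m) A.

(* Jordan decomposition mu = upper_var mu - lower_var mu *)
Definition upper_var (mu : set 'rV[R]_n -> R) (B : set 'rV[R]_n) : \bar R :=
  ereal_sup [set (mu E)%:E | E in
    [set E | [/\ measurable E, compactly_in Omega E & E `<=` B]]].

Definition lower_var (mu : set 'rV[R]_n -> R) : set 'rV[R]_n -> \bar R :=
  upper_var (fun E => (- mu E)%R).

Definition sintegral_radon (mu : set 'rV[R]_n -> R) (f : 'rV[R]_n -> \bar R) :
    \bar R :=
  \int[upper_var mu]_(x in Omega) f x - \int[lower_var mu]_(x in Omega) f x.

Definition radon_component (m : nat) (A : set 'rV[R]_n -> 'rV[R]_m) (i : 'I_m) :
  set 'rV[R]_n -> R := fun E => A E ord0 i.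

Definition vintegral_radon (m : nat) (A : set 'rV[R]_n -> 'rV[R]_m)
    (f : 'I_m -> 'rV[R]_n -> \bar R) : \bar R :=
  \sum_(i < m) sintegral_radon (radon_component A i) (f i).

Definition L1loc (nu : set 'rV[R]_n -> \bar R) (f : 'rV[R]_n -> \bar R) :
  Prop :=
  forall K : set 'rV[R]_n, compact K -> K `<=` Omega -> nu.-integrable K f.

End radon_measures.

Section pairing.
Context (R : realType) (n : nat) (Omega : set 'rV[R]_n).
Context (A : set 'rV[R]_n -> 'rV[R]_n) (divA : set 'rV[R]_n -> R).
Context (lam : 'rV[R]_n -> R).
Implicit Types (u phi : 'rV[R]_n -> R) (mu : set 'rV[R]_n -> R).

(* A belongs to DM_loc(Omega) and its distributional divergence is divA *)
Definition DMloc : Prop :=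
  [/\ radon Omega A, radon Omega divA &
      forall phi, Cinftyc Omega phi ->
        vintegral_radon Omega A (fun i x => (partial_deriv i phi x)%:E) =
        - sintegral_radon Omega divA (fun x => (phi x)%:E)].

Definition L1loc2 (f : 'rV[R]_n -> \bar R) : Prop :=
  L1loc Omega (vradon_variation Omega A) f /\ L1loc Omega (radon_variation Omega divA) f.

Definition Xloc u : Prop :=
  measurable_fun Omega u /\ L1loc2 (lambda_repr Omega u lam).

Definition pairing u phi : \bar R :=
  - sintegral_radon Omega divA (fun x => lambda_repr Omega u lam x * (phi x)%:E)
  - vintegral_radon Omega A
      (fun i x => lambda_repr Omega u lam x * (partial_deriv i phi x)%:E).

(* the distribution (A, Du)_lambda is the Radon measure mu *)
Definition pairing_measure u mu : Prop :=
  radon Omega mu /\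
  forall phi, Cinftyc Omega phi ->
    sintegral_radon Omega mu (fun x => (phi x)%:E) = pairing u phi.

(* u belongs to BV^{A,lambda}_loc(Omega) and (A, Du)_lambda = mu *)
Definition BVloc u mu : Prop := Xloc u /\ pairing_measure u mu.

End pairing.

(* Measurability with respect to the completed Lebesgue sigma-algebra of R. *)
Definition ae_measurable (R : realType) (g : R -> \bar R) : Prop :=
  exists2 h : measurableTypeR R -> \bar R, measurable_fun setT h &
    {ae @lebesgue_measure R, forall t, g t = h t}.

(* nu t is (A, D chi_{u > t})_lambda for almost every t, and
   B |-> \int |nu t|(B) dt is a (locally finite) measure on Omega. *)
Definition coarea_well_posed (R : realType) (n : nat) (Omega : set 'rV[R]_n)
    (A : set 'rV[R]_n -> 'rV[R]_n) (divA : set 'rV[R]_n -> R)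
    (lam u : 'rV[R]_n -> R) (nu : R -> set 'rV[R]_n -> R) : Prop :=
  [/\ {ae @lebesgue_measure R, forall t,
        pairing_measure Omega A divA lam \1_(superlevel Omega u t) (nu t)},
      forall B : set 'rV[R]_n, measurable B -> B `<=` Omega ->
        ae_measurable (fun t => radon_variation Omega (nu t) B) &
      forall K : set 'rV[R]_n, compact K -> K `<=` Omega ->
        \int[@lebesgue_measure R]_t radon_variation Omega (nu t) K < +oo].

(* Main.v *)
(* For x in Omega and t different from u^+(x) and u^-(x), the representative of
   {u > t} at x is (1 - lam) 1[t < u^-] + lam 1[t < u^+]; this only needs that
   Lebesgue measure is monotone and that balls have positive finite measure.
   Since a = \int (1[t < a] - 1[t < 0]) dt for real a, Fubini's theorem on a
   compact set, applied to the Jordan parts of div A and of the components of A,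
   writes the pairing of u with phi as an integral over t of the pairings of
   {u > t} with phi; the part coming from 1[t < 0] vanishes because div A is the
   divergence of A. For fixed x at most two values of t are exceptional, so for
   all but countably many t the exceptional x form a null set.

   Smooth test functions are dense in C^1_c for the C^1 norm, with supports in a
   fixed compact set: replace phi by sum_z phi(h z) prod_i eta(x_i / h - z_i) for
   a smooth hat function eta.

   For the inequality, smooth Urysohn functions decreasing to the indicator of a
   compact set C give |mu(C)| <= \int |nu_t|(C) dt, and inner regularity of the
   Jordan parts of mu extends this to Borel sets. *)
Require Import Defs.
From HB Require Import structures.
From mathcomp Require Import all_boot all_order all_algebra.
From mathcomp Require Import all_classical all_reals all_analysis.
From mathcomp Require Import measurable_realfun.
From mathcomp Require Import ring lra.
Set Implicit Arguments.
Unset Strict Implicit.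
Unset Printing Implicit Defensive.
Import Order.TTheory GRing.Theory Num.Theory.
Import numFieldNormedType.Exports.
Local Open Scope classical_set_scope.
Local Open Scope ring_scope.

(** * Smooth hat functions *)

(** The divergence of [A] and the measure [mu] are specified against smooth test functions, while
    the formula is claimed for C^1 ones. A quasi-interpolant is used rather than a mollifier because
    it is a finite sum of products of functions of one variable: its smoothness and its derivatives
    come from one-dimensional calculus, with no integration over R^n. The main obstacle is
    measurability. Neither u^+ and u^- nor the representatives of {u > t} are known to be
    measurable, separately in x or jointly in (x, t). Integrals are therefore compared, off
    measurable null sets, with integrals of explicit measurable functions, and Fubini is applied to
    the latter. The variation of [A] is kept as a set function that dominates the Jordan parts of
    the components of [A]. Measure structures are attached only to Jordan parts of scalar Radon
    measures, where countable additivity follows from that of the measure inside compact sets. *)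

Section smooth_functions_of_one_variable.
Context {R : realType}.
Implicit Types f g : R -> R.

Lemma is_derive_continuous f g :
  (forall x : R, is_derive x 1 f (g x)) -> continuous f.
Proof.
by move=> fg x; apply/differentiable_continuous/derivable1_diffP;
  exact: @ex_derive _ _ _ _ _ _ _ (fg x).
Qed.

Lemma is_derive_MVT f g (a b : R) : (forall x : R, is_derive x 1 f (g x)) ->
  a < b -> exists2 c, a < c < b & f b - f a = g c * (b - a).
Proof.
move=> fg ab; have cf : {within `[a, b], continuous f}.
  by apply: continuous_subspaceT; exact: is_derive_continuous fg.
have [c cab ->] := MVT ab (fun x _ => fg x) cf.
by exists c => //; move: cab; rewrite in_itv.
Qed.

Lemma is_derive_affine f (a b x df : R) : is_derive (a * x + b) 1 f df ->
  is_derive x 1 (fun y => f (a * y + b)) (a * df).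
Proof.
move=> hf; rewrite mulrC.
apply: (@is_derive1_comp _ f (fun y => a * y + b)) => //.
have -> : (fun y => a * y + b) = (a *: id + cst b)%R by apply/funext.
apply: is_derive_eq.
by rewrite addr0 /GRing.scale/= mulr1.
Qed.

(** The derivative is an existential witness, so the closure properties follow by induction from the
    derivation rules. *)
Fixpoint diffk (k : nat) f : Prop :=
  match k with
  | 0 => continuous f
  | k'.+1 => exists g, (forall x : R, is_derive x 1 f (g x)) /\ diffk k' g
  end.

Definition smooth f := forall k, diffk k f.

Lemma diffkW k f : diffk k.+1 f -> diffk k f.
Proof.
elim: k f => [|k IH] f [g [fg]] => [_|kg]; first exact: is_derive_continuous fg.
by exists g; split => //; exact: IH.
Qed.

Lemma diffkD k f g : diffk k f -> diffk k g -> diffk k (f \+ g).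
Proof.
elim: k f g => [|k IH] f g /=.
  by move=> cf cg x; apply: continuousD; [exact: cf|exact: cg].
move=> [f' [ff' kf']] [g' [gg' kg']]; exists (f' \+ g'); split; last exact: IH.
by move=> x; apply: is_deriveD.
Qed.

Lemma diffkM k f g : diffk k f -> diffk k g -> diffk k (f \* g).
Proof.
elim: k f g => [|k IH] f g /=.
  by move=> cf cg x; apply: continuousM; [exact: cf|exact: cg].
move=> kf kg; have [f0 g0] := (diffkW kf, diffkW kg).
move: kf kg => [f' [ff' kf']] [g' [gg' kg']].
exists ((f \* g') \+ (g \* f')); split; last by apply: diffkD; exact: IH.
by move=> x; apply: is_deriveM.
Qed.

Lemma diffk_cst k (c : R) : diffk k (cst c).
Proof.
elim: k c => [c x|k IH c]; first exact: cvg_cst.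
by exists (cst 0); split => // x; exact: is_derive_cst.
Qed.

Lemma diffk_affine k f (a b : R) : diffk k f -> diffk k (fun x => f (a * x + b)).
Proof.
elim: k f => [|k IH] f /=.
  move=> cf x; apply: (@continuous_comp _ _ _ (fun x => a * x + b) f); last exact: cf.
  by apply: cvgD; [apply: cvgM; [exact: cvg_cst|exact: cvg_id]|exact: cvg_cst].
move=> [f' [ff' kf']].
exists (cst a \* (fun x => f' (a * x + b))); split.
  by move=> x; apply: is_derive_affine; exact: ff'.
by apply: diffkM; [exact: diffk_cst|exact: IH].
Qed.

(** For [p = 1] this is the classical flat function exp(-1/x). Carrying a polynomial in 1/x makes
    the family stable under differentiation. *)
Definition flat_exp (p : {poly R}) (x : R) : R :=
  if 0 < x then p.[x^-1] * expR (- x^-1) else 0.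

Lemma exprn_le_fact_expR n (y : R) : 0 <= y -> y ^+ n <= n`!%:R * expR y.
Proof.
move=> y0; case: n => [|n].
  by rewrite expr0 fact0 mul1r; have := expR_ge1Dx y; lra.
have n0 : (0 : R) < (n.+1)`!%:R by rewrite ltr0n fact_gt0.
rewrite -ler_pdivrMl// mulrC.
by apply: le_trans (expR_ge1Dxn n y0); rewrite lerDr.
Qed.

(** With y = 1/x, each monomial satisfies y^i exp(-y) <= i!, which gives the constant. *)
Lemma flat_exp_bounded p : exists C : R, forall x, `|flat_exp p x| <= C.
Proof.
exists (\sum_(i < size p) `|p`_i| * (i`!)%:R) => x.
rewrite /flat_exp; case: ifPn => [x0|_]; last first.
  by rewrite normr0 sumr_ge0// => i _; rewrite mulr_ge0.
rewrite normrM (ger0_norm (expR_ge0 _)) expRN ler_pdivrMr ?expR_gt0//.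
rewrite horner_coef (le_trans (ler_norm_sum _ _ _))// mulr_suml ler_sum// => i _.
have V0 : 0 <= x^-1 by rewrite invr_ge0 ltW.
rewrite normrM -mulrA ler_wpM2l// (ger0_norm (exprn_ge0 _ V0)).
exact: exprn_le_fact_expR.
Qed.

Lemma flat_expXM p x : flat_exp p x = x * flat_exp ('X * p) x.
Proof.
rewrite /flat_exp; case: ifPn => [x0|_]; last by rewrite mulr0.
by rewrite hornerM hornerX !mulrA mulfV ?gt_eqF// mul1r.
Qed.

(** Away from 0 this is the product rule. At 0, pulling two factors x out with [flat_expXM] leaves a
    bounded function, so the difference quotient is at most C|h|. *)
Lemma flat_exp_derive p (x : R) :
  is_derive x 1 (flat_exp p) (flat_exp ('X ^+ 2 * (p - p^`())) x).
Proof.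
have [x0|x0|->] := ltrgtP x 0.
- rewrite {2}/flat_exp ltNge (ltW x0)/=.
  apply: (@near_eq_is_derive _ _ _ (cst 0)) => //.
  near=> y; rewrite /flat_exp ltNge ltW//.
  by near: y; exact: lt_nbhsl.
- rewrite {2}/flat_exp x0.
  apply: (@near_eq_is_derive _ _ _
    (fun y => (horner p \o GRing.inv) y * (expR \o (fun z => - z^-1)) y)).
    near=> y; rewrite /flat_exp ifT//=.
    by near: y; exact: lt_nbhsr.
  have dV : is_derive x 1 (fun y : R => y^-1) (- x ^- 2).
    have x0' : @id R x != 0 by rewrite gt_eqF.
    have := @is_deriveV R id x 1 1 x0' (is_derive_id _ _).
    by rewrite /GRing.scale/= mulr1.
  have dp : is_derive x 1 (horner p \o GRing.inv) (p^`().[x^-1] * - x ^- 2).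
    by apply: is_derive1_comp => //; exact: is_derive_poly.
  have de : is_derive x 1 (expR \o (fun z => - z^-1)) (expR (- x^-1) * - - x ^- 2).
    exact: is_derive1_comp.
  apply: (@is_derive_eq _ _ _ _ _ _ _ _ (is_deriveM dp de)).
  rewrite hornerM hornerXn hornerD hornerN /GRing.scale/= exprVn; ring.
- rewrite {2}/flat_exp ltxx.
  have [C hC] := flat_exp_bounded ('X * ('X * p)).
  have C0 : 0 <= C by apply: le_trans (hC 0).
  suff h0 : h^-1 *: ((flat_exp p \o shift 0) (h *: 1) - flat_exp p 0) @[h --> 0^'] --> (0 : R).
    by apply: DeriveDef; [apply/cvg_ex; exists 0|exact: cvg_lim].
  apply: (@cvg_to_0_linear _ _ C 1) => // h /andP[h0 _].
  rewrite /= addr0 /GRing.scale/= mulr1 [X in _ - X]/flat_exp ltxx subr0.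
  by rewrite flat_expXM flat_expXM mulKf -?normr_gt0// normrM mulrC ler_wpM2r.
Unshelve. all: by end_near. Qed.

End smooth_functions_of_one_variable.

Section smooth_hat.
Context {R : realType}.
Implicit Types f g : R -> R.

Lemma ge0_derive_homo f g : (forall x : R, is_derive x 1 f (g x)) ->
  (forall x, 0 <= g x) -> {homo f : x y / x <= y}.
Proof.
move=> fg g0 x y; rewrite le_eqVlt => /predU1P[->//|xy].
have [c _ e] := is_derive_MVT fg xy.
by rewrite -subr_ge0 e mulr_ge0// subr_ge0 ltW.
Qed.

Lemma smooth_flat_exp (p : {poly R}) : smooth (flat_exp p).
Proof.
move=> k; elim: k p => [|k IH] p.
  exact: is_derive_continuous (flat_exp_derive p).
by exists (flat_exp ('X ^+ 2 * (p - p^`()))); split => //; exact: flat_exp_derive.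
Qed.

Lemma smooth_primitive f g : (forall x : R, is_derive x 1 f (g x)) ->
  smooth g -> smooth f.
Proof.
move=> fg sg [|k]; first exact: is_derive_continuous fg.
by exists g; split => //; exact: sg.
Qed.

(** As [f] vanishes on the negative half-line it is integrable on every half-line ]-oo, y], and the
    primitive based at -oo vanishes there too. *)
Lemma primitive_exists f : continuous f -> (forall x, x <= 0 -> f x = 0) ->
  exists F : R -> R, (forall x : R, is_derive x 1 F (f x)) /\
                     (forall x, x <= 0 -> F x = 0).
Proof.
move=> cf f0; pose F x := (\int[@lebesgue_measure R]_(t in [set` `]-oo, x]]) f t)%R.
exists F; split => [x|x x0]; last first.
  rewrite /F (@eq_Rintegral _ _ _ _ _ (cst 0)) ?Rintegral_cst//= ?mul0r//.
  by move=> y; rewrite inE/= in_itv/= => yx; rewrite f0// (le_trans yx).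
have intf y : (@lebesgue_measure R).-integrable [set` `]-oo, y]] (EFin \o f).
  have mf : measurable_fun [set: R] f by exact: continuous_measurable_fun.
  apply/integrableP; split.
    by apply/measurable_EFinP; exact: measurable_funS mf.
  have : (@lebesgue_measure R).-integrable `[0, y] (EFin \o f).
    apply: continuous_compact_integrable; first exact: segment_compact.
    exact: continuous_subspaceT.
  move=> /integrableP[_]; rewrite integral_mkcond => h.
  rewrite integral_mkcond; apply: le_lt_trans h; rewrite le_eqVlt; apply/orP; left.
  apply/eqP; apply: eq_integral => z _; rewrite !patchE !mem_setE !in_itv/=.
  case: (ltP z 0) => // z0; rewrite f0 ?(ltW z0)//= normr0.
  by case: ifP.
have [dF F'] := @continuous_FTC1 R f (BInfty _ true) x (x + 1)
  ltac:(by rewrite ltrDl) (intf _) (ltNyr x) (cf x).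
by apply: (DeriveDef dF); rewrite -derive1E; exact: F'.
Qed.

(** The product of exp(-1/x) and exp(-1/(1-x)) is a bump on ]0, 1[. [T] is its primitive, normalised
    to end at 1, and [P] is a primitive of [T]: a smoothed step and a smoothed ramp. *)
Lemma smooth_ramp : exists P T : R -> R,
  [/\ smooth P, forall x : R, is_derive x 1 P (T x), {homo T : x y / x <= y},
      forall x, x <= 0 -> T x = 0 /\ P x = 0 & forall x, 1 <= x -> T x = 1].
Proof.
pose b := (fun x => flat_exp 1%R x) \* (fun x => flat_exp (1%R : {poly R}) (-1 * x + 1)).
have sb : smooth b.
  move=> k; apply: diffkM; first exact: smooth_flat_exp.
  by apply: diffk_affine; exact: smooth_flat_exp.
have e0 x : x <= 0 -> flat_exp (1 : {poly R}) x = 0.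
  by rewrite /flat_exp leNgt => /negbTE ->.
have e1 (x : R) : 0 < x -> 0 < flat_exp (1 : {poly R}) x.
  by rewrite /flat_exp => ->; rewrite hornerC mul1r expR_gt0.
have eg x : 0 <= flat_exp (1 : {poly R}) x.
  by have [/e0 ->|/e1/ltW] := leP x 0.
have b0 x : 0 <= b x by rewrite mulr_ge0.
have [P0 [dP0 P00]] : exists F : R -> R, (forall x : R, is_derive x 1 F (b x)) /\
                     (forall x, x <= 0 -> F x = 0).
  apply: primitive_exists; first exact: (sb 0%N).
  by move=> x x0; rewrite /b/= e0// mul0r.
have c0 : 0 < P0 1.
  have [c /andP[c0 c1] e] := is_derive_MVT dP0 ltr01.
  have -> : P0 1 = P0 1 - P0 0 by rewrite (P00 0)// subr0.
  rewrite e subr0 mulr1 /b/=; apply: mulr_gt0; apply: e1; first by [].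
  lra.
pose T x := (P0 1)^-1 * P0 x.
have dT x : is_derive (x : R) 1 T ((P0 1)^-1 * b x) by exact: is_deriveZ.
have sT : smooth T.
  by apply: smooth_primitive dT _ => k; apply: (@diffkM _ _ (cst _)) => //; exact: diffk_cst.
have T0 x : x <= 0 -> T x = 0 by move=> x0; rewrite /T (P00 x)// mulr0.
have [P [dP PP0]] := primitive_exists (sT 0%N) T0.
exists P, T; split => //.
- exact: smooth_primitive sT.
- by apply: ge0_derive_homo dT _ => x; rewrite mulr_ge0// invr_ge0 ltW.
- by move=> x x0; split; [exact: T0|exact: PP0].
- move=> x; have T1 : T 1 = 1 by rewrite /T mulVf// gt_eqF.
  rewrite le_eqVlt => /predU1P[<-//|x1].
  have [c /andP[c1 cx] e] := is_derive_MVT dT x1.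
  rewrite -[RHS]T1; apply/eqP; rewrite -subr_eq0 e /b/= (@e0 (-1 * c + 1)) ?mulr0 ?mul0r//.
  lra.
Qed.

(* Both families of integer shifts are partitions of unity, and [eta'] is a
   difference of shifts of [theta]: summing by parts, the derivative of an
   [eta]-average is a [theta]-average of difference quotients. *)
Record hat (eta theta : R -> R) : Prop := Hat {
  hat_smooth : smooth eta ;
  hat_derive : forall s : R, is_derive s 1 eta (theta s - theta (s - 1)) ;
  hat_ge0 : forall s, 0 <= eta s ;
  hat_theta_ge0 : forall s, 0 <= theta s ;
  hat_eq0 : forall s, (s <= 0) || (3 <= s) -> eta s = 0 ;
  hat_theta_eq0 : forall s, (s <= 0) || (3 <= s) -> theta s = 0 ;
  hat_sum : forall (m : nat) s, 2 <= s <= m%:R ->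
    \sum_(j < m) eta (s - j%:R) = 1 ;
  hat_theta_sum : forall (m : nat) s, 2 <= s <= m%:R ->
    \sum_(j < m) theta (s - j%:R) = 1
}.

(** [eta] is the second difference of the ramp [P] and [theta] the first difference of the step [T],
    a smoothed version of B-splines. Past 1 the function [P] has slope 1, so [S] climbs from 0 to 1
    over [0, 2]; both sums of shifts telescope. *)
Lemma hat_exists : exists eta theta, hat eta theta.
Proof.
have [P [T [sP dP hT T0 T1]]] := smooth_ramp.
have shift f (g : R -> R) (c : R) : (forall x : R, is_derive x 1 f (g x)) ->
    forall x : R, is_derive x 1 (fun y => f (y - c)) (g (x - c)).
  move=> fg x; have := @is_derive_affine _ f 1 (- c) x (g (x - c)).
  rewrite !mul1r; under eq_fun do rewrite mul1r.
  by apply; exact: fg.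
have sshift c : smooth (fun x => P (x - c)).
  move=> k; have := @diffk_affine _ k P 1 (- c) (sP k).
  by under eq_fun do rewrite mul1r.
pose S s := P s - P (s - 1).
pose eta s := S s - S (s - 1).
pose theta s := T s - T (s - 1).
have dS (s : R) : is_derive s 1 S (theta s).
  by apply: is_deriveB; exact: shift.
have sS : smooth S.
  move=> k; have -> : S = P \+ (cst (-1) \* (fun x => P (x - 1))).
    by apply/funext => x; rewrite /S/= mulN1r.
  apply: diffkD => //; apply: diffkM; [exact: diffk_cst|exact: sshift].
have seta : smooth eta.
  move=> k; have -> : eta = S \+ (cst (-1) \* (fun x => S (1 * x + -1))).
    by apply/funext => x; rewrite /eta/= mulN1r mul1r.
  apply: diffkD => //; apply: diffkM; [exact: diffk_cst|exact: diffk_affine].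
have th0 s : 0 <= theta s by rewrite subr_ge0; apply: hT; rewrite gerBl.
have S0 s : s <= 0 -> S s = 0.
  by move=> s0; rewrite /S (T0 _ s0).2 (T0 (s - 1) _).2 ?subrr//; lra.
have th2 s : 2 <= s -> theta s = 0.
  by move=> s2; rewrite /theta !T1 ?subrr//; lra.
have cst_after f g a : (forall s : R, is_derive s 1 f (g s)) ->
    (forall s, a <= s -> g s = 0) -> forall s, a <= s -> f s = f a.
  move=> fg g0 s; rewrite le_eqVlt => /predU1P[->//|as'].
  have [c /andP[ac _] e] := is_derive_MVT fg as'.
  by apply/eqP; rewrite -subr_eq0 e g0 ?mul0r// ltW.
have P21 : P 2 - P 1 = 1.
  have dPi (s : R) : is_derive s 1 (P \- id) (T s - 1) by exact: is_deriveB.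
  have e : P 2 - 2 = P 1 - 1.
    apply: (cst_after _ _ 1 dPi); last by lra.
    by move=> s s1; rewrite T1// subrr.
  lra.
have S2 s : 2 <= s -> S s = 1.
  move=> s2; rewrite (cst_after _ _ 2 dS th2)// /S.
  by rewrite (_ : 2 - 1 = 1 :> R); [exact: P21|ring].
exists eta, theta; split => //.
- by move=> s; apply: is_deriveB; exact: shift.
- by move=> s; rewrite subr_ge0; apply: (ge0_derive_homo dS) => //; rewrite gerBl.
- move=> s /orP[s0|s3]; rewrite /eta.
    by rewrite !S0 ?subrr//; lra.
  by rewrite !S2 ?subrr//; lra.
- move=> s /orP[s0|s3]; last by rewrite th2//; lra.
  by rewrite /theta (T0 s _).1// (T0 (s - 1) _).1 ?subrr//; lra.
- move=> m s /andP[s2 sm].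
  have -> : \sum_(j < m) eta (s - j%:R) = S s - S (s - m%:R).
    elim: m {sm} => [|m IH]; first by rewrite big_ord0 subr0 subrr.
    rewrite big_ord_recr/= IH /eta -natr1.
    rewrite (_ : s - m%:R - 1 = s - (m%:R + 1)); last by ring.
    by ring.
  by rewrite S2// S0 ?subr0// subr_le0.
- move=> m s /andP[s2 sm].
  have -> : \sum_(j < m) theta (s - j%:R) = T s - T (s - m%:R).
    elim: m {sm} => [|m IH]; first by rewrite big_ord0 subr0 subrr.
    rewrite big_ord_recr/= IH /theta -natr1.
    rewrite (_ : s - m%:R - 1 = s - (m%:R + 1)); last by ring.
    by ring.
  by rewrite T1 ?(T0 (s - m%:R) _).1 ?subr0// ?subr_le0//; lra.
Qed.

End smooth_hat.

(** * Smooth approximation of test functions *)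

Section sup_norm.
Context {R : realType} {n : nat}.
Implicit Types (x y : 'rV[R]_n) (C K Omega : set 'rV[R]_n).

Lemma rv_norm_le x (e : R) : 0 <= e ->
  (forall i, `|x ord0 i| <= e) -> `|x| <= e.
Proof.
move=> e0 h; rewrite /Num.Def.normr/= mx_normrE; apply/bigmax_leP; split => //.
by move=> [i j] _ /=; rewrite ord1.
Qed.

Lemma rv_coord_le x i : `|x ord0 i| <= `|x|.
Proof.
rewrite [leRHS]/Num.Def.normr/= mx_normrE.
exact: (@le_bigmax _ _ _ 0 (fun ij : 'I_1 * 'I_n => `|x ij.1 ij.2|) (ord0, i)).
Qed.

Definition thick C (d : R) : set 'rV[R]_n :=
  [set x | exists2 c, C c & `|x - c| <= d].

Lemma sub_thick C d : 0 <= d -> C `<=` thick C d.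
Proof. by move=> d0 x Cx; exists x => //; rewrite subrr normr0. Qed.

Lemma thickS C d d' : d <= d' -> thick C d `<=` thick C d'.
Proof. by move=> dd' x [c Cc xc]; exists c => //; exact: le_trans dd'. Qed.

Lemma thick_compact C (d : R) : 0 < d -> compact C -> compact (thick C d).
Proof.
move=> d0 cC.
have cB : compact (closed_ball (0 : 'rV[R]_n) d).
  apply: bounded_closed_compact; last exact: closed_ball_closed.
  exists d; split; first exact: num_real.
  move=> M dM x; rewrite closed_ballE// /closed_ball_/= sub0r normrN => xd.
  exact: le_trans (ltW dM).
have -> : thick C d = (fun z : 'rV[R]_n * 'rV[R]_n => z.1 + z.2) @`
    (C `*` closed_ball (0 : 'rV[R]_n) d).
  apply/seteqP; split => x /=.
    move=> [c Cc xc]; exists (c, x - c); last by rewrite /= addrC subrK.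
    by split => //=; rewrite closed_ballE// /closed_ball_/= sub0r normrN.
  move=> [[c b] [/= Cc]]; rewrite closed_ballE// /closed_ball_/= sub0r normrN => bd <-.
  by exists c => //; rewrite addrAC subrr add0r.
apply: continuous_compact; last exact: compact_setX.
by apply: continuous_subspaceT => z; exact: add_continuous.
Qed.

(** The near-covering form of compactness turns radii that depend on the point into one radius for
    all of [C]. *)
Lemma compact_thick_sub C Omega : compact C -> open Omega -> C `<=` Omega ->
  exists2 d : R, 0 < d & thick C d `<=` Omega.
Proof.
move=> /compact_near_coveringP cC oO CO.
have := cC _ (0 : R)^'+ (fun d x => forall y, `|y - x| <= d -> Omega y) _.
move=> /(_ _ _)[|d d0 dP].
  move=> x Cx; have /nbhs_ballP[e /= e0 xe] : nbhs x Omega.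
    by apply: open_nbhs_nbhs; split => //; exact: CO.
  near=> y d => z /= zy; apply: xe; rewrite -ball_normE/=.
  rewrite -(subrK y x) -addrA (le_lt_trans (ler_normD _ _))// (splitr e) ltrD//.
    near: y; apply/nbhs_ballP; exists (e / 2); rewrite /= ?divr_gt0// => y.
    by rewrite -ball_normE.
  rewrite distrC (le_lt_trans zy)//.
  by near: d; apply: nbhs_right_lt; rewrite divr_gt0.
exists (d / 2); first by rewrite divr_gt0.
have := dP (d / 2); rewrite /ball_/= sub0r normrN ger0_norm ?divr_ge0 ?(ltW d0)//.
rewrite ltr_pdivrMr// ltr_pMr// divr_gt0// => /(_ _ _)H x [c Cc xc].
by apply: (H _ _ c Cc) => //; lra.
Unshelve. all: by end_near. Qed.

(** Compactness is applied to the 1-neighbourhood of [C]; if x lies outside it and y is within 1 of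
    x, [phi] vanishes at both. *)
Lemma unif_continuous (phi : 'rV[R]_n -> R) C : compact C ->
  continuous phi -> (forall x, ~ C x -> phi x = 0) -> forall e : R, 0 < e ->
  exists2 d : R, 0 < d & forall x y, `|y - x| <= d -> `|phi y - phi x| <= e.
Proof.
move=> cC cphi phi0 e e0.
have /compact_near_coveringP cT := thick_compact ltr01 cC.
have := cT _ (0 : R)^'+ (fun d x => forall y, `|y - x| <= d -> `|phi y - phi x| <= e) _.
move=> /(_ _ _)[|d d0 dP].
  move=> x _.
  have /cvgrPdist_lt/(_ (e / 2)) := cphi x; rewrite divr_gt0// => /(_ isT).
  move=> /nbhs_ballP[r /= r0 xr].
  near=> y d => z /= zy.
  have xy : `|x - y| < r / 2.
    near: y; apply/nbhs_ballP; exists (r / 2); rewrite /= ?divr_gt0// => y.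
    by rewrite -ball_normE.
  have yb : `|phi x - phi y| < e / 2.
    apply: xr; rewrite -ball_normE/=; apply: lt_trans xy _.
    by rewrite ltr_pdivrMr// ltr_pMr// ltr1n.
  have zb : `|phi x - phi z| < e / 2.
    apply: xr; rewrite -ball_normE/=.
    rewrite -(subrK y x) -addrA (le_lt_trans (ler_normD _ _))// (splitr r) ltrD//.
    rewrite distrC (le_lt_trans zy)//.
    by near: d; apply: nbhs_right_lt; rewrite divr_gt0.
  rewrite -(subrK (phi x) (phi z)) -addrA (le_trans (ler_normD _ _))// (splitr e).
  by rewrite lerD// ltW// distrC.
exists (Num.min 1 (d / 2)); first by rewrite lt_min ltr01 divr_gt0.
move=> x y; rewrite le_min => /andP[xy1 xyd].
have [Tx|Tx] := pselect (thick C 1 x).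
  apply: (dP (d / 2)) => //.
    rewrite /ball_/= sub0r normrN ger0_norm ?divr_ge0 ?(ltW d0)//.
    by rewrite ltr_pdivrMr// ltr_pMr// ltr1n.
  by rewrite divr_gt0.
rewrite (phi0 x) ?(phi0 y) ?subrr ?normr0 ?(ltW e0)//.
- by move=> Cy; apply: Tx; exists y => //; rewrite distrC.
- by move=> Cx; apply: Tx; exact: sub_thick Cx.
Unshelve. all: by end_near. Qed.

End sup_norm.

Section smooth_functions_of_several_variables.
Context {R : realType} {n : nat}.
Implicit Types (phi psi : 'rV[R]_n -> R) (x v : 'rV[R]_n).

(** Directional derivatives become one-variable ones, to which the chain rule and the mean value
    theorem apply. *)
Lemma is_derive_line phi x v (t l : R) :
  is_derive t 1 (fun h : R => phi (h *: v + x)) l <->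
  is_derive (t *: v + x) v phi l.
Proof.
have e : (fun h : R => h^-1 *: (((fun h : R => phi (h *: v + x)) \o shift t) (h *: 1)
     - phi (t *: v + x))) =
   (fun h : R => h^-1 *: ((phi \o shift (t *: v + x)) (h *: v) - phi (t *: v + x))).
  apply/funext => h /=; congr (_ *: (phi _ - _)).
  rewrite (_ : h *: (1 : R) = h); last exact: mulr1.
  by rewrite scalerDl addrA.
split=> [] [d v'].
- by apply: DeriveDef; rewrite /derivable /derive -e.
- by apply: DeriveDef; rewrite /derivable /derive e.
Qed.

Lemma Ck_continuous k phi : Ck k phi -> continuous phi.
Proof. by case: k => [//|k] []. Qed.

Lemma CkS k phi : continuous phi ->
  (forall i, exists g, (forall x, is_derive x (delta_mx ord0 i) phi (g x)) /\ Ck k g) ->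
  Ck k.+1 phi.
Proof.
move=> cphi h; split => // i; have [g [dg kg]] := h i.
split; first by move=> x; case: (dg x).
suff -> : partial_deriv i phi = g by [].
by apply/funext => x; case: (dg x).
Qed.

Lemma Ck_is_derive k phi i x : Ck k.+1 phi ->
  is_derive x (delta_mx ord0 i) phi (partial_deriv i phi x).
Proof. by move=> [_ /(_ i)[d _]]; exact: DeriveDef. Qed.

Lemma CkW k phi : Ck k.+1 phi -> Ck k phi.
Proof.
elim: k phi => [|k IH] phi; first by case.
move=> [cphi h]; split=> // i; have [d1 d2] := h i; split.
  exact: d1.
exact: IH.
Qed.

Lemma Ck_cst k (c : R) : Ck k (cst c : 'rV[R]_n -> R).
Proof.
elim: k c => [c|k IH c]; first exact: cst_continuous.
apply: CkS; first exact: cst_continuous.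
by move=> i; exists (cst 0); split=> // x; exact: is_derive_cst.
Qed.

Lemma CkD k phi psi : Ck k phi -> Ck k psi -> Ck k (phi \+ psi).
Proof.
elim: k phi psi => [|k IH] phi psi kf kg.
  by move=> x; apply: (@continuousD _ _ _ phi psi); [exact: kf|exact: kg].
apply: CkS => [x|i].
  by apply: (@continuousD _ _ _ phi psi); [exact: (Ck_continuous kf)|exact: (Ck_continuous kg)].
exists (partial_deriv i phi \+ partial_deriv i psi); split.
  by move=> x; apply: is_deriveD; [exact: (Ck_is_derive i x kf)|exact: (Ck_is_derive i x kg)].
by apply: IH; [case: kf|case: kg] => _ /(_ i)[].
Qed.

Lemma CkM k phi psi : Ck k phi -> Ck k psi -> Ck k (phi \* psi).
Proof.
elim: k phi psi => [|k IH] phi psi kf kg.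
  by move=> x; apply: (@continuousM _ _ phi psi); [exact: kf|exact: kg].
apply: CkS => [x|i].
  by apply: (@continuousM _ _ phi psi); [exact: (Ck_continuous kf)|exact: (Ck_continuous kg)].
exists ((phi \* partial_deriv i psi) \+ (psi \* partial_deriv i phi)); split.
  by move=> x; apply: is_deriveM; [exact: (Ck_is_derive i x kf)|exact: (Ck_is_derive i x kg)].
apply: CkD; apply: IH; (try exact: CkW).
- by case: kg => _ /(_ i)[].
- by case: kf => _ /(_ i)[].
Qed.

Lemma Ck_sum k I (r : seq I) (F : I -> 'rV[R]_n -> R) :
  (forall i, Ck k (F i)) -> Ck k (fun x => \sum_(i <- r) F i x).
Proof.
move=> kF; elim: r => [|i r IH].
  by under eq_fun do rewrite big_nil; exact: Ck_cst.
by under eq_fun do rewrite big_cons; exact: CkD.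
Qed.

Lemma Ck_prod k I (r : seq I) (F : I -> 'rV[R]_n -> R) :
  (forall i, Ck k (F i)) -> Ck k (fun x => \prod_(i <- r) F i x).
Proof.
move=> kF; elim: r => [|i r IH].
  by under eq_fun do rewrite big_nil; exact: Ck_cst.
by under eq_fun do rewrite big_cons; exact: CkM.
Qed.

Lemma is_derive_coord (f : R -> R) (df a b : R) x (i j : 'I_n) :
  is_derive (a * x ord0 i + b) 1 f df ->
  is_derive x (delta_mx ord0 j) (fun y : 'rV[R]_n => f (a * y ord0 i + b))
    ((i == j)%:R * a * df).
Proof.
move=> hf; rewrite -[x]add0r -[in X in is_derive X](scale0r (delta_mx ord0 j)).
apply/is_derive_line.
under eq_fun do rewrite !mxE mulrDr mulrCA eqxx/= -addrA mulrC -mulrA.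
rewrite [X in X * df]mulrC.
have := @is_derive_affine _ f (a * (i == j)%:R) (a * x ord0 i + b) 0 df.
rewrite mulr0 add0r => /(_ hf).
by under eq_fun do rewrite -mulrA.
Qed.

Lemma Ck_coord k (f : R -> R) (a b : R) (i : 'I_n) : smooth f ->
  Ck k (fun y : 'rV[R]_n => f (a * y ord0 i + b)).
Proof.
have cc (g : R -> R) : continuous g -> continuous (fun y : 'rV[R]_n => g (a * y ord0 i + b)).
  move=> cg x; have ch : {for x, continuous (fun y : 'rV[R]_n => a * y ord0 i + b)}.
    apply: (@continuousD _ _ _ (fun y : 'rV[R]_n => a * y ord0 i) (cst b));
      last exact: cst_continuous.
    apply: (@continuousM _ _ (cst a) (fun y : 'rV[R]_n => y ord0 i)); first exact: cst_continuous.
    exact: coord_continuous.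
  exact: (continuous_comp ch (cg _)).
suff H : forall g, diffk k g -> Ck k (fun y : 'rV[R]_n => g (a * y ord0 i + b)).
  by move=> /(_ k)/H.
elim: k => [|k IH] g; first exact: cc.
move=> kg; apply: CkS; first by apply: cc; move: kg => [g' [/is_derive_continuous]].
move=> j; move: kg => [g' [dg kg]].
exists (cst ((i == j)%:R * a) \* (fun y : 'rV[R]_n => g' (a * y ord0 i + b))); split.
  by move=> x; apply: is_derive_coord; exact: dg.
by apply: CkM; [exact: Ck_cst|exact: IH].
Qed.

End smooth_functions_of_several_variables.

(** * Quasi-interpolation on a cubic grid *)

Section quasi_interpolation.
Context {R : realType} {n : nat} (eta theta : R -> R) (He : hat eta theta).
Context (h : R) (h0 : 0 < h) (M : nat).
Local Notation m := (M.*2).+1.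
Local Notation idx := {ffun 'I_n -> 'I_m}.
Implicit Types (x : 'rV[R]_n) (z : idx) (F : 'I_n -> R -> R).

(** Indices run from 0 to 2M and are shifted by M, so the nodes are the points of the grid of step h
    in the cube of half-side hM centred at 0. *)
Definition node z : 'rV[R]_n := \row_i (h * ((z i)%:R - M%:R)).

Definition scoord z x (i : 'I_n) : R := h^-1 * x ord0 i + (M%:R - (z i)%:R).

Definition bump F z x : R := \prod_i F i (scoord z x i).

(** What [eta] and [theta] have in common. A bump may take a different profile in each coordinate,
    because differentiation in direction i replaces the i-th [eta] by [theta]. *)
Definition hatlike (f : R -> R) : Prop :=
  [/\ forall s, 0 <= f s, forall s, (s <= 0) || (3 <= s) -> f s = 0 &
      forall (k : nat) s, 2 <= s <= k%:R -> \sum_(j < k) f (s - j%:R) = 1].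

Lemma hatlike_eta : hatlike eta.
Proof. by case: He. Qed.

Lemma hatlike_theta : hatlike theta.
Proof. by case: He. Qed.

Lemma scoordE z x i : h * scoord z x i = x ord0 i - node z ord0 i.
Proof. by rewrite /scoord mxE mulrDr mulVKf ?gt_eqF//; ring. Qed.

Lemma bump_ge0 F z x : (forall i, hatlike (F i)) -> 0 <= bump F z x.
Proof. by move=> hF; apply: prodr_ge0 => i _; have [] := hF i. Qed.

Lemma bump_local F z x : (forall i, hatlike (F i)) -> bump F z x != 0 ->
  `|node z - x| <= 3 * h.
Proof.
move=> hF /prodf_neq0 nz; apply: rv_norm_le => [|i]; first by rewrite mulr_ge0 ?ltW.
have -> : (node z - x) ord0 i = - (h * scoord z x i) by rewrite scoordE opprB !mxE.
rewrite normrN normrM (gtr0_norm h0) mulrC ler_pM2r//.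
have [_ z0 _] := hF i.
have := nz i isT; apply: contraNle => si; rewrite z0//; apply/orP.
have [s0|s0] := leP (scoord z x i) 0; [by left|right].
by rewrite gtr0_norm// in si; exact: ltW.
Qed.

(** Distributivity turns the sum over multi-indices into a product of one-dimensional sums. The
    margin 2 places x_i/h + M in the range [2, m] where these sums equal 1. *)
Lemma bump_sum F x : (forall i, hatlike (F i)) ->
  (forall i, `|x ord0 i| <= h * (M%:R - 2)) -> \sum_z bump F z x = 1.
Proof.
move=> hF hx.
have := @bigA_distr_bigA _ 0 1 *%R +%R 'I_n 'I_m
  (fun i j => F i (h^-1 * x ord0 i + (M%:R - j%:R))).
rewrite /bump => <-; rewrite big1// => i _.
have [_ _ sum1] := hF i.
rewrite -[RHS](sum1 m (h^-1 * x ord0 i + M%:R)); last first.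
  have : `|h^-1 * x ord0 i| <= M%:R - 2.
    by rewrite normrM gtr0_norm ?invr_gt0// ler_pdivrMl.
  rewrite ler_norml => /andP[h1 h2].
  rewrite (_ : m%:R = M%:R + M%:R + 1); last by rewrite -[LHS]natr1 -addnn natrD.
  apply/andP; split; lra.
by apply: eq_bigr => j _; rewrite addrA.
Qed.

(** The sum is a convex combination of values [G z], and those with nonzero weight are within [e] of
    [l]. *)
Lemma bump_average F (G : idx -> R) (l e : R) x : (forall i, hatlike (F i)) ->
  0 <= e -> (forall z, bump F z x != 0 -> `|G z - l| <= e) ->
  \sum_z bump F z x = 1 -> `|\sum_z G z * bump F z x - l| <= e.
Proof.
move=> hF e0 hG s1.
have -> : \sum_z G z * bump F z x - l = \sum_z (G z - l) * bump F z x.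
  rewrite -[X in _ - X]mulr1 -s1 mulr_sumr -sumrB.
  by apply: eq_bigr => z _; rewrite mulrBl.
rewrite (le_trans (ler_norm_sum _ _ _))// -[leRHS]mulr1 -s1 mulr_sumr.
apply: ler_sum => z _; rewrite normrM (ger0_norm (bump_ge0 _ _ hF)).
have [->|nz] := eqVneq (bump F z x) 0; first by rewrite !mulr0.
by rewrite ler_wpM2r ?hG// bump_ge0.
Qed.

(** Only the values at the nodes enter, so [g] may be an indicator function, as in
    [smooth_urysohn]. *)
Definition interp (g : 'rV[R]_n -> R) x : R :=
  \sum_z g (node z) * bump (fun _ => eta) z x.

Lemma Ck_interp k g : Ck k (interp g).
Proof.
apply: Ck_sum => z; apply: CkM; first exact: Ck_cst.
by apply: Ck_prod => i; apply: Ck_coord; case: He.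
Qed.

Definition dbump (i : 'I_n) : idx -> 'rV[R]_n -> R :=
  bump (fun j => if j == i then theta else eta).

Lemma hatlike_dbump (i j : 'I_n) : hatlike (if j == i then theta else eta).
Proof. by case: ifP => _; [exact: hatlike_theta|exact: hatlike_eta]. Qed.

Definition partial_bump (i : 'I_n) z x := \prod_(j | j != i) eta (scoord z x j).

Lemma dbumpE i z x : dbump i z x = theta (scoord z x i) * partial_bump i z x.
Proof.
rewrite /dbump /bump (bigD1 i)//= eqxx; congr (_ * _).
by apply: eq_bigr => j /negbTE ->.
Qed.

Lemma is_derive_bump i z x : is_derive x (delta_mx ord0 i) (bump (fun _ => eta) z)
  (h^-1 * (theta (scoord z x i) - theta (scoord z x i - 1)) * partial_bump i z x).
Proof.
rewrite -[x in is_derive x]add0r -[in X in is_derive X](scale0r (delta_mx ord0 i)).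
apply/is_derive_line.
have -> : (fun t : R => bump (fun _ => eta) z (t *: delta_mx ord0 i + x)) =
   (fun t => partial_bump i z x *: eta (h^-1 * t + scoord z x i)).
  apply/funext => t; rewrite /bump (bigD1 i)//= mulrC; congr (_ * eta _).
    apply: eq_bigr => j ji; congr eta.
    by rewrite /scoord !mxE eqxx (negbTE ji) mulr0 add0r.
  by rewrite /scoord !mxE !eqxx mulr1 mulrDr -addrA.
rewrite mulrC.
have d : is_derive (0 : R) 1 (fun t : R => eta (h^-1 * t + scoord z x i))
    (h^-1 * (theta (scoord z x i) - theta (scoord z x i - 1))).
  by apply: is_derive_affine; rewrite mulr0 add0r; exact: (hat_derive He).
exact: (is_deriveZ (partial_bump i z x) d).
Qed.

Lemma is_derive_sum_seq I (r : seq I) (F : I -> 'rV[R]_n -> R) (dF : I -> R) x v :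
  (forall i, is_derive x v (F i) (dF i)) ->
  is_derive x v (fun y => \sum_(i <- r) F i y) (\sum_(i <- r) dF i).
Proof.
move=> dd; elim: r => [|i r IH].
  by rewrite big_nil; under eq_fun do rewrite big_nil; exact: is_derive_cst.
by rewrite big_cons; under eq_fun do rewrite big_cons; exact: is_deriveD.
Qed.

Definition shift_idx (i : 'I_n) z : idx := [ffun j => if j == i then ordS (z j) else z j].

Lemma shift_idx_bij i : bijective (shift_idx i).
Proof.
exists (fun z : idx => [ffun j => if j == i then ord_pred (z j) else z j]) => z;
  apply/ffunP => j; rewrite !ffunE; case: eqP => // _.
- exact: ordSK.
- exact: ord_predK.
Qed.

(* Summation by parts: the cyclic shift of the i-th index is harmless because g
   vanishes at the nodes where it wraps around. *)
Lemma is_derive_interp (g : 'rV[R]_n -> R) (i : 'I_n) x :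
  (forall y : 'rV[R]_n, h * M%:R <= `|y ord0 i| -> g y = 0) ->
  is_derive x (delta_mx ord0 i) (interp g)
    (\sum_z h^-1 * (g (node z) - g (node z - h *: delta_mx ord0 i)) * dbump i z x).
Proof.
move=> g0.
suff -> : \sum_z h^-1 * (g (node z) - g (node z - h *: delta_mx ord0 i)) * dbump i z x
   = \sum_z g (node z) *
     (h^-1 * (theta (scoord z x i) - theta (scoord z x i - 1)) * partial_bump i z x).
  apply: is_derive_sum_seq => z.
  exact: (is_deriveZ _ (is_derive_bump i z x)).
under eq_bigr do rewrite dbumpE mulrBr mulrBl.
under [RHS]eq_bigr do rewrite mulrBr mulrBl mulrBr.
rewrite !sumrB; congr (_ - _).
  by apply: eq_bigr => z _; ring.
rewrite (reindex _ (onW_bij _ (shift_idx_bij i)))/=; apply: eq_bigr => z _.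
have -> : partial_bump i (shift_idx i z) x = partial_bump i z x.
  apply: eq_bigr => j /negbTE ji; congr eta.
  by rewrite /scoord ffunE ji.
have zE : shift_idx i z i = ordS (z i) by rewrite ffunE eqxx.
have [zi|zi] := ltnP (z i).+1 m.
  have zE' : (shift_idx i z i)%:R = (z i)%:R + 1 :> R.
    by rewrite zE/= modn_small// natr1.
  have -> : node (shift_idx i z) - h *: delta_mx ord0 i = node z.
    apply/rowP => j; rewrite !mxE eqxx/=.
    have [->|ji] := eqVneq j i; first by rewrite zE' ?eqxx ?mulr1; ring.
    by rewrite ffunE (negbTE ji) mulr0 subr0.
  have -> : scoord (shift_idx i z) x i = scoord z x i - 1.
    by rewrite /scoord zE'; ring.
  by ring.
have zm : z i = M.*2 :> nat.
  by apply/eqP; rewrite eqn_leq -ltnS ltn_ord.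
rewrite (g0 (node z)) ?(g0 (node _ - _)) ?mulr0 ?mul0r//.
  rewrite !mxE zE !eqxx/= zm modnn mulr1 sub0r mulrN -opprD normrN ger0_norm.
    by rewrite lerDl ltW.
  by rewrite addr_ge0 ?mulr_ge0// ltW.
rewrite mxE zm -addnn natrD addrK ger0_norm// mulr_ge0// ltW//.
Qed.

End quasi_interpolation.

Section smooth_approximation.
Context {R : realType} {n : nat}.
Implicit Types (x : 'rV[R]_n) (C K Omega : set 'rV[R]_n) (phi : 'rV[R]_n -> R).

Lemma compact_norm_bound C : compact C -> exists2 B : R, 0 <= B & forall x, C x -> `|x| <= B.
Proof.
move=> /compact_bounded[B [_ hB]]; exists (`|B| + 1); first by rewrite addr_ge0.
by move=> x Cx; apply: hB => //; rewrite (le_lt_trans (ler_norm B))// ltrDl.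
Qed.

Lemma nat_ge (r : R) : exists M : nat, r <= M%:R.
Proof. by exists (Num.truncn r).+1; apply/ltW/truncnS_gt. Qed.

Lemma delta_norm_le (s : R) i : `|s *: delta_mx ord0 i : 'rV[R]_n| <= `|s|.
Proof.
apply: rv_norm_le => // j; rewrite !mxE eqxx/= normrM.
by case: (j == i); rewrite ?normr1 ?normr0 ?mulr1// mulr0.
Qed.

(** Interpolate the indicator of the 3h-neighbourhood of [C]. Bumps reach 3h, so at a point of [C]
    only nodes of value 1 count, and a nonzero value forces distance at most 6h from [C]; hence h =
    d/6. *)
Lemma smooth_urysohn C (d : R) : compact C -> 0 < d -> exists psi,
  [/\ forall k, Ck k psi, forall x, 0 <= psi x <= 1, forall x, C x -> psi x = 1 &
      forall x, ~ thick C d x -> psi x = 0].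
Proof.
move=> cC d0; have [eta [theta He]] := @hat_exists R.
pose h := d / 6; have h0 : 0 < h by rewrite divr_gt0.
have [B B0 hB] := compact_norm_bound cC.
have [M hM] := nat_ge (h^-1 * (B + d) + 2).
have hF (i : 'I_n) : hatlike eta by exact: hatlike_eta He.
pose g x := (\1_(thick C (3 * h)) x : R).
have g01 x : 0 <= g x <= 1 by rewrite /g indicE; case: (_ \in _) => /=; lra.
have off x : ~ thick C d x -> interp eta h M g x = 0.
  move=> Cx; rewrite /interp big1// => z _.
  have [->|nz] := eqVneq (bump h (fun=> eta) z x) 0; first by rewrite mulr0.
  have zx := bump_local h0 hF nz.
  rewrite /g indicE memNset ?mul0r// => -[c Cc zc]; apply: Cx; exists c => //.
  rewrite -(subrK (node h z) x) -addrA (le_trans (ler_normD _ _))//.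
  by rewrite distrC (le_trans (lerD zx zc))// /h; lra.
have rng x : thick C d x -> \sum_z bump h (fun=> eta) (M:=M) z x = 1.
  move=> [c Cc xc]; apply: bump_sum => // i.
  rewrite (le_trans (rv_coord_le x i))// -(subrK c x) (le_trans (ler_normD _ _))//.
  rewrite (le_trans (lerD xc (hB _ Cc)))// -ler_pdivrMl//; lra.
exists (interp eta h M g); split => //.
- by move=> k; exact: (Ck_interp He).
- move=> x; have [Cx|/off ->] := pselect (thick C d x); last by rewrite lexx ler01.
  rewrite -(rng _ Cx); apply/andP; split.
    apply: sumr_ge0 => z _; rewrite mulr_ge0 ?bump_ge0//.
  apply: ler_sum => z _; rewrite ler_piMl ?bump_ge0//.
  by have /andP[] := g01 (node h z).
- move=> x Cx; apply/eqP; rewrite -subr_eq0 -normr_le0; apply: bump_average => //.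
    move=> z /(bump_local h0 hF) zx; rewrite /g indicE mem_set ?subrr ?normr0//.
    by exists x.
  by apply: rng; apply: sub_thick Cx; exact: ltW.
Qed.

Lemma partial_deriv_off C phi : closed C -> (forall x, ~ C x -> phi x = 0) ->
  forall i x, ~ C x -> partial_deriv i phi x = 0.
Proof.
move=> cC phi0 i x Cx; rewrite /partial_deriv.
rewrite (@near_eq_derive _ _ _ phi (cst 0)) ?derive_cst//.
have /open_nbhs_nbhs : open_nbhs x (~` C) by split => //; exact: closed_openC.
by apply: filterS => y; exact: phi0.
Qed.

Lemma near_unif_continuous phi C : compact C ->
  continuous phi -> (forall x, ~ C x -> phi x = 0) -> forall e : R, 0 < e ->
  \forall d \near 0^'+, forall x y, `|y - x| <= d -> `|phi y - phi x| <= e.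
Proof.
move=> cC cphi phi0 e e0; have [d d0 hd] := unif_continuous cC cphi phi0 e0.
near=> r => x y xy; apply: hd; apply: le_trans xy _.
by near: r; exact: nbhs_right_le.
Unshelve. all: by end_near. Qed.

(** [K] is a thickening of a compact set carrying [phi], chosen before [e]; this forces 4h <= d,
    since bumps reach 3h and derivatives also use nodes moved by h. Values of the interpolant are
    [eta]-averages of [phi] and its derivatives are [theta]-averages of difference quotients, so
    uniform continuity of [phi] and its partial derivatives concludes. *)
Lemma smooth_C1_approx Omega phi : open Omega -> Ckc Omega 1 phi ->
  exists K, [/\ compact K, K `<=` Omega,
    forall x, ~ K x -> phi x = 0 /\ forall i, partial_deriv i phi x = 0 &
    forall e : R, 0 < e -> exists psi,
      [/\ Cinftyc Omega psi,
          forall x, ~ K x -> psi x = 0 /\ forall i, partial_deriv i psi x = 0,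
          forall x, `|psi x - phi x| <= e &
          forall i x, `|partial_deriv i psi x - partial_deriv i phi x| <= e]].
Proof.
move=> oO [kphi [K0 [cK0 K0O sphi]]].
have phi0 x : ~ K0 x -> phi x = 0.
  by move=> nKx; apply/eqP; apply: contra_notT nKx => /sphi.
have clK0 : closed K0 by apply: compact_closed => //; exact: norm_hausdorff.
have dphi0 := partial_deriv_off clK0 phi0.
have [d d0 KO] := compact_thick_sub cK0 oO K0O.
exists (thick K0 d); split => //; first exact: thick_compact.
  move=> x nKx; have nK0x : ~ K0 x by move=> /(sub_thick (ltW d0)).
  by split => [|i]; [exact: phi0|exact: dphi0].
move=> e e0; have [eta [theta He]] := @hat_exists R.
have cphi : continuous phi := Ck_continuous kphi.
have [h [h0 hd uphi udphi]] : exists h : R, [/\ 0 < h, 4 * h <= d,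
    forall x y, `|y - x| <= 4 * h -> `|phi y - phi x| <= e &
    forall i x y, `|y - x| <= 4 * h ->
      `|partial_deriv i phi y - partial_deriv i phi x| <= e].
  have : \forall r \near (0 : R)^'+, [/\ 0 < r, r <= d,
    forall x y, `|y - x| <= r -> `|phi y - phi x| <= e &
    forall i x y, `|y - x| <= r ->
      `|partial_deriv i phi y - partial_deriv i phi x| <= e].
    have H1 := near_unif_continuous cK0 cphi phi0 e0.
    have H2 : \forall r \near (0 : R)^'+, forall i x y, `|y - x| <= r ->
      `|partial_deriv i phi y - partial_deriv i phi x| <= e.
      apply: filter_forall => i.
      apply: near_unif_continuous cK0 _ _ _ e0; last exact: dphi0.
      by case: kphi => _ /(_ i)[].
    near=> r; split.
    - by near: r; exact: nbhs_right_gt.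
    - by near: r; exact: nbhs_right_le.
    - by near: r.
    - by near: r.
  move=> /filter_ex[r [r0 rd r1 r2]]; exists (r / 4).
  have -> : 4 * (r / 4) = r by field.
  by split => //; rewrite divr_gt0.
have [B B0 hB] := compact_norm_bound cK0.
(* In units of h, the partition of unity loses 2 at the boundary of the cube and the nodes used are
   up to 4 away from the point; 7 exceeds the sum. *)
have [M hM] := nat_ge (h^-1 * B + 7).
have hMB : B <= h * (M%:R - 7) by rewrite -ler_pdivrMl//; lra.
have far x : h * (M%:R - 7) < `|x| -> phi x = 0.
  move=> xM; apply: phi0 => /hB; apply/negP; rewrite -ltNge.
  exact: le_lt_trans xM.
pose psi := interp eta h M phi.
have hF (i : 'I_n) : hatlike eta by exact: hatlike_eta He.
have hdF (i : 'I_n) := hatlike_dbump He i.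
have dpsi i x : partial_deriv i psi x =
    \sum_z h^-1 * (phi (node h z) - phi (node h z - h *: delta_mx ord0 i)) *
      dbump eta theta h (M:=M) i z x.
  have [|_ <-//] := @is_derive_interp R n eta theta He h h0 M phi i x.
  move=> y yM; apply: far; apply: lt_le_trans (rv_coord_le y i).
  by apply: lt_le_trans yM; rewrite ltr_pM2l//; lra.
have near4 (z : {ffun 'I_n -> 'I_(M.*2).+1}) x i (s : R) : `|node h z - x| <= 3 * h ->
    0 <= s <= h -> `|node h z - s *: delta_mx ord0 i - x| <= 4 * h.
  move=> zx /andP[s0 sh]; rewrite addrAC (le_trans (ler_normB _ _))//.
  rewrite (le_trans (lerD zx (delta_norm_le s i)))// ger0_norm//; lra.
have zerofar (x y : 'rV[R]_n) : `|y - x| <= 4 * h -> ~ thick K0 d x -> phi y = 0.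
  move=> yx nKx; apply: phi0 => K0y; apply: nKx; exists y => //.
  by rewrite distrC (le_trans yx).
have node4 (z : {ffun 'I_n -> 'I_(M.*2).+1}) x : `|node h z - x| <= 3 * h ->
    `|node h z - x| <= 4 * h by move/le_trans; apply; lra.
have outr (x y : 'rV[R]_n) : `|y - x| <= 4 * h -> h * (M%:R - 2) < `|x| -> phi y = 0.
  move=> yx xM; apply: far.
  have : `|x| <= `|y| + 4 * h.
    by have := ler_normD (x - y) y; rewrite subrK distrC; lra.
  lra.
(* Either the bumps form a partition of unity at x, or x is so far out that [phi] vanishes at x and
   at every node that matters. *)
have inout x : \sum_z bump h (fun=> eta) (M:=M) z x = 1 /\
   (forall i, \sum_z dbump eta theta h (M:=M) i z x = 1) \/ h * (M%:R - 2) < `|x|.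
  have [hx|] := leP `|x| (h * (M%:R - 2)); last by right.
  have hx' i : `|x ord0 i| <= h * (M%:R - 2) by apply: le_trans (rv_coord_le x i) hx.
  by left; split => [|i]; apply: bump_sum.
exists psi; split.
- move=> k; split; first exact: (Ck_interp He).
  exists (thick K0 d); split => //; first exact: thick_compact.
  move=> x /eqP psix; apply: contrapT => nKx; apply: psix.
  rewrite /psi /interp big1// => z _.
  have [->|nz] := eqVneq (bump h (fun=> eta) z x) 0; first by rewrite mulr0.
  by rewrite (zerofar x) ?mul0r//; exact/node4/(bump_local h0 hF).
- move=> x nKx; split.
    rewrite /psi /interp big1// => z _.
    have [->|nz] := eqVneq (bump h (fun=> eta) z x) 0; first by rewrite mulr0.
    by rewrite (zerofar x) ?mul0r//; exact/node4/(bump_local h0 hF).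
  move=> i; rewrite dpsi big1// => z _.
  have [->|nz] := eqVneq (dbump eta theta h i z x) 0; first by rewrite mulr0.
  have zx := bump_local h0 (hdF i) nz.
  rewrite (zerofar x) ?(zerofar x (_ - _)) ?subrr ?mulr0 ?mul0r//; last exact: node4.
  by apply: near4 => //; rewrite lexx ltW.
- move=> x; have [[s1 _]|xM] := inout x.
    apply: bump_average => //; first exact: ltW.
    by move=> z /(bump_local h0 hF) zx; apply: uphi; exact: node4.
  rewrite (outr x x) ?subrr ?normr0//; last by rewrite mulr_ge0 ?ltW.
  rewrite subr0 /psi /interp big1 ?normr0 ?ltW// => z _.
  have [->|nz] := eqVneq (bump h (fun=> eta) z x) 0; first by rewrite mulr0.
  by rewrite (outr x) ?mul0r//; exact/node4/(bump_local h0 hF).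
- move=> i x; rewrite dpsi; have [[_ s1]|xM] := inout x.
    apply: bump_average (hdF i) (ltW e0) _ (s1 i) => z /(bump_local h0 (hdF i)) zx.
    pose v : 'rV[R]_n := delta_mx ord0 i.
    have dl (t : R) : is_derive t 1 (fun s : R => phi (s *: v + (node h z - h *: v)))
      (partial_deriv i phi (t *: v + (node h z - h *: v))).
      by apply/is_derive_line; exact: (Ck_is_derive i _ kphi).
    (* By the mean value theorem the difference quotient is a partial derivative of [phi] at a point
       of the segment between the node and its translate, hence within 4h of x. *)
    have [c /andP[c0 ch]] := is_derive_MVT dl h0.
    rewrite scale0r add0r subr0 [h *: v + _]addrC subrK => ->.
    rewrite [X in _ * X]mulrC mulKf ?gt_eqF//; apply: udphi.
    have -> : c *: v + (node h z - h *: v) = node h z - (h - c) *: v.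
      by rewrite scalerBl opprB addrCA.
    by apply: near4 => //; apply/andP; split; lra.
  rewrite (partial_deriv_off clK0 phi0) ?subr0; last first.
    move=> /hB; apply/negP; rewrite -ltNge (le_lt_trans hMB)//.
    by apply: le_lt_trans xM; rewrite ler_pM2l//; lra.
  rewrite big1 ?normr0 ?ltW// => z _.
  have [->|nz] := eqVneq (dbump eta theta h i z x) 0; first by rewrite mulr0.
  have zx := bump_local h0 (hdF i) nz.
  rewrite (outr x) ?(outr x (_ - _)) ?subrr ?mulr0 ?mul0r//; last exact: node4.
  by apply: near4 => //; rewrite lexx ltW.
Unshelve. all: by end_near. Qed.

End smooth_approximation.

(** * Radon measures and their Jordan parts *)

Local Open Scope ereal_scope.

(* The library has another [compactly_in]. *)
Local Notation compactly_in := Defs.compactly_in.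

Section borel_sets.
Context {R : realType} {n : nat}.
Implicit Types (K E U Omega : set 'rV[R]_n).

Lemma open_measurable_rV U : open U -> measurable U.
Proof. by move=> oU; exact: sub_gen_smallest. Qed.

Lemma closed_measurable_rV K : closed K -> measurable K.
Proof.
move=> cK; rewrite -[K]setCK; apply: measurableC; apply: open_measurable_rV.
exact: closed_openC.
Qed.

Lemma compact_closed_rV K : compact K -> closed K.
Proof. by move=> cK; apply: compact_closed => //; exact: norm_hausdorff. Qed.

Lemma compact_measurable_rV K : compact K -> measurable K.
Proof. by move=> /compact_closed_rV; exact: closed_measurable_rV. Qed.

Lemma continuous_measurable_rV (f : 'rV[R]_n -> R) : continuous f -> measurable_fun setT f.
Proof.
move=> cf; apply: (measurability _ (RGenOpens.measurableE R)).
move=> _ [_ [a [b ->] <-]]; rewrite setTI; apply: open_measurable_rV.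
by apply: open_comp => [x _|]; [exact: cf|exact: interval_open].
Qed.

Lemma compactly_in0 Omega : compactly_in Omega set0.
Proof. by exists set0; split; [exact: compact0|exact: sub0set|exact: sub0set]. Qed.

Lemma compactly_inS Omega E E' : E `<=` E' -> compactly_in Omega E' -> compactly_in Omega E.
Proof. by move=> EE' [K [cK KO E'K]]; exists K; split => //; exact: subset_trans E'K. Qed.

Lemma compactly_inU Omega E E' : compactly_in Omega E -> compactly_in Omega E' ->
  compactly_in Omega (E `|` E').
Proof.
move=> [K [cK KO EK]] [K' [cK' K'O E'K']]; exists (K `|` K'); split.
- exact: compactU.
- by rewrite subUset.
- exact: setUSS.
Qed.

End borel_sets.

Section jordan_parts.
Context {R : realType} {n : nat} {Omega : set 'rV[R]_n}.
Implicit Types (mu : set 'rV[R]_n -> R) (B E F : set 'rV[R]_n).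

Lemma radonN mu : radon Omega mu -> radon Omega (fun E => - mu E)%R.
Proof.
move=> [mu0 muU]; split; first by rewrite mu0 oppr0.
move=> K F cK KO mF FK tF.
have -> : series (fun i => - mu (F i))%R = (- series (fun i => mu (F i)))%R.
  by apply/funext => k; rewrite /series/= fctE sumrN.
apply: cvgN; exact: muU cK KO mF FK tF.
Qed.

Lemma radonU mu E F : radon Omega mu -> measurable E -> measurable F ->
  compactly_in Omega E -> compactly_in Omega F -> E `&` F = set0 ->
  mu (E `|` F) = (mu E + mu F)%R.
Proof.
move=> [mu0 muU] mE mF cE cF EF.
have [K [cK KO EFK]] := compactly_inU cE cF.
have := muU K (bigcup2 E F) cK KO.
rewrite bigcup2E => /(_ _ _ _) h.
have {}h : series (fun i => mu (bigcup2 E F i)) @ \oo --> mu (E `|` F).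
  apply: h.
  - by move=> [|[|i]] /=.
  - by move=> [|[|i]] x; rewrite /bigcup2/= => // Ex; apply: EFK; [left|right].
  - by rewrite -trivIset_bigcup2. 
apply: (cvg_unique _ h); first exact: norm_hausdorff.
apply: (@cvg_near_cst _ _ _ _ \oo); near=> k.
have k2 : (2 <= k)%N by near: k; exact: nbhs_infty_ge.
rewrite /series/= (big_cat_nat _ k2)//= big_nat_recl//= big_nat_recl//= big_geq//.
rewrite addr0 big_nat big1 ?addr0// => i /andP[i2 _].
by rewrite /bigcup2; case: i i2 => [|[|i]].
Unshelve. all: by end_near. Qed.

Lemma radonD mu E F : radon Omega mu -> measurable E -> measurable F ->
  compactly_in Omega F -> E `<=` F -> (mu (F `\` E) = mu F - mu E)%R.
Proof.
move=> hmu mE mF cF EF.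
have := @radonU mu E (F `\` E) hmu mE (measurableD mF mE).
rewrite setDUK// => -> //; first by rewrite addrC addKr.
- exact: compactly_inS cF.
- by apply: compactly_inS cF; exact: subDsetl.
- by rewrite setDIK.
Qed.

(** The proof that [mu] is Radon is an argument so that a measure structure can be attached to the
    name. *)
Definition radon_upper mu of radon Omega mu : set 'rV[R]_n -> \bar R :=
  upper_var Omega mu.

Section upper_measure.
Context mu (hmu : radon Omega mu).

Lemma upper_var_ub B E : measurable E -> compactly_in Omega E -> E `<=` B ->
  (mu E)%:E <= upper_var Omega mu B.
Proof. by move=> mE cE EB; apply: ereal_sup_ubound; exists E. Qed.

Lemma upper_var_ge0 B : 0 <= upper_var Omega mu B.
Proof.
have := @upper_var_ub B set0 measurable0 (compactly_in0 Omega).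
by rewrite hmu.1; apply.
Qed.

Lemma upper_var0 : upper_var Omega mu set0 = 0.
Proof.
apply/eqP; rewrite eq_le upper_var_ge0 andbT; apply: ge_ereal_sup => _ [E [_ _ E0] <-].
by move: E0; rewrite subset0 => ->; rewrite hmu.1.
Qed.

Lemma upper_varS B B' : B `<=` B' -> upper_var Omega mu B <= upper_var Omega mu B'.
Proof.
move=> BB'; apply: ge_ereal_sup => _ [E [mE cE EB] <-]; apply: upper_var_ub => //.
exact: subset_trans BB'.
Qed.

(** Competitors for [B] and [B'] unite into one for the union. If the right-hand side is finite, so
    are both terms on the left, and the two suprema can be taken one after the other. *)
Lemma upper_var_super2 B B' : B `&` B' = set0 ->
  upper_var Omega mu B + upper_var Omega mu B' <= upper_var Omega mu (B `|` B').
Proof.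
move=> BB'.
have [->|Uy] := eqVneq (upper_var Omega mu (B `|` B')) +oo; first exact: leey.
have fin C : C `<=` B `|` B' -> upper_var Omega mu C \is a fin_num.
  move=> CB; rewrite ge0_fin_numE ?upper_var_ge0//.
  by apply: le_lt_trans (upper_varS CB) _; rewrite ltey.
have fB' : upper_var Omega mu B' \is a fin_num by apply: fin; exact: subsetUr.
rewrite -leeBrDr//; apply: ge_ereal_sup => _ [E [mE cE EB] <-].
rewrite leeBrDr// -leeBrDl//; apply: ge_ereal_sup => _ [F [mF cF FB] <-].
rewrite leeBrDl// -EFinD -radonU//.
- by apply: upper_var_ub; [exact: measurableU|exact: compactly_inU|exact: setUSS].
- by apply/seteqP; split => // x [Ex Fx]; rewrite -BB'; split; [exact: EB|exact: FB].
Qed.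

(** A competitor for the union lies in a compact set, where [mu] is countably additive, so it splits
    into competitors for the [F i]; conversely, partial sums are bounded by superadditivity. The
    total mass may be infinite. *)
Lemma upper_var_semi_sigma_additive : semi_sigma_additive (radon_upper hmu).
Proof.
move=> F mF tF mU; rewrite /radon_upper.
have nd : nondecreasing_seq (fun k => \sum_(0 <= i < k) upper_var Omega mu (F i)).
  by apply: ereal_nondecreasing_series => i _ _; exact: upper_var_ge0.
have cv := ereal_nondecreasing_cvgn nd.
suff -> : upper_var Omega mu (\bigcup_i F i) =
  ereal_sup (range (fun k => \sum_(0 <= i < k) upper_var Omega mu (F i))) by [].
apply/eqP; rewrite eq_le; apply/andP; split.
- apply: ge_ereal_sup => _ [E [mE [K [cK KO EK]] EF] <-].
  have h : series (fun i => mu (E `&` F i)) @ \oo --> mu E.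
    rewrite -[X in _ --> mu X](setIidl EF) setI_bigcupr.
    apply: hmu.2 cK KO _ _ _ => //.
    + by move=> i; exact: measurableI.
    + by move=> i x [Ex _]; exact: EK.
    + exact: trivIset_setIl.
  have hE : (fun k => (series (fun i => mu (E `&` F i)) k)%:E) @ \oo --> (mu E)%:E.
    by apply: cvg_EFin; [exact: nearW|exact: h].
  apply: (lee_cvg_to hE cv); near=> k; rewrite /series/= -sumEFin.
  apply: lee_sum => i _; apply: upper_var_ub => //.
  + exact: measurableI.
  + by exists K; split => // x [Ex _]; exact: EK.
- apply: ge_ereal_sup => _ [k _ <-].
  apply: (@le_trans _ _ (upper_var Omega mu (\big[setU/set0]_(0 <= i < k) F i))).
    elim: k => [|k IH]; first by rewrite !big_geq// upper_var0.
    rewrite !big_nat_recr//=; apply: le_trans (upper_var_super2 _); first exact: leeD2r.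
    apply/seteqP; split => // x [].
    rewrite big_mkord -bigcup_mkord => -[i /= ik Fix] Fkx.
    by have := tF i k I I (ex_intro _ x (conj Fix Fkx)); move/eqP; rewrite ltn_eqF.
  by apply: upper_varS; rewrite big_mkord; exact: bigsetU_bigcup.
Unshelve. all: by end_near. Qed.

Lemma upper_var_bigcup (F : nat -> set 'rV[R]_n) :
  (forall i, measurable (F i)) -> trivIset setT F ->
  \sum_(0 <= i <oo) upper_var Omega mu (F i) = upper_var Omega mu (\bigcup_i F i).
Proof.
move=> mF tF; have mU : measurable (\bigcup_i F i) by exact: bigcupT_measurable.
have h := upper_var_semi_sigma_additive mF tF mU.
by apply: cvg_lim.
Qed.

HB.instance Definition _ := isMeasure.Build _ _ _ (radon_upper hmu)
  upper_var0 upper_var_ge0 upper_var_semi_sigma_additive.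

End upper_measure.
End jordan_parts.

Section radon_charge.
Context {R : realType} {n : nat} {Omega : set 'rV[R]_n}.
Context (mu : set 'rV[R]_n -> R) (hmu : radon Omega mu).
Context (K : set 'rV[R]_n) (cK : compact K) (KO : K `<=` Omega).

Definition radon_charge of radon Omega mu & compact K & K `<=` Omega :
  set 'rV[R]_n -> \bar R := fun E => (mu (E `&` K))%:E.

Let nu := radon_charge hmu cK KO.

Let nu0 : nu set0 = 0.
Proof. by rewrite /nu /radon_charge set0I hmu.1. Qed.

Let nu_fin E : measurable E -> nu E \is a fin_num.
Proof. by []. Qed.

Let nu_sigma : semi_sigma_additive nu.
Proof.
move=> F mF tF mU; rewrite /nu /radon_charge setI_bigcupl.
have mK : measurable K := compact_measurable_rV cK.
have h : series (fun i => mu (F i `&` K)) @ \oo --> mu (\bigcup_i (F i `&` K)).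
  apply: hmu.2 cK KO _ _ _.
  - by move=> i; exact: measurableI.
  - by move=> i; exact: subIsetr.
  - exact: trivIset_setIr.
under eq_fun do rewrite sumEFin.
by apply: cvg_EFin; [exact: nearW|exact: h].
Qed.

HB.instance Definition _ := isCharge.Build _ _ _ nu nu0 nu_fin nu_sigma.

(** The trace of [mu] on [K] is a finite charge. In a Hahn decomposition, dropping the negative part
    of [E] and completing its positive part to [P] within [K] can only increase [mu]. *)
Lemma radon_bounded : exists B : R, forall E, measurable E -> E `<=` K -> (mu E <= B)%R.
Proof.
have mK : measurable K := compact_measurable_rV cK.
have cyK E : E `<=` K -> compactly_in Omega E by exists K.
have [P [N [[mP posP] [mN negN] PN PN0]]] := Hahn_decomposition nu.
exists (mu (P `&` K)) => E mE EK.
have EPN : E = (E `&` P) `|` (E `&` N) by rewrite -setIUr PN setIT.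
have mEP : measurable (E `&` P) by exact: measurableI.
have mEN : measurable (E `&` N) by exact: measurableI.
have -> : mu E = (mu (E `&` P) + mu (E `&` N))%R.
  rewrite {1}EPN (radonU hmu)//.
  - by apply: cyK => x [Ex _]; exact: EK.
  - by apply: cyK => x [Ex _]; exact: EK.
  - by rewrite setIACA setIid PN0 setI0.
have : nu (E `&` N) <= 0 by apply: negN => // x [].
rewrite /nu /radon_charge lee_fin (_ : E `&` N `&` K = E `&` N); last first.
  by apply/setIidl => x [Ex _]; exact: EK.
have : 0 <= nu ((P `&` K) `\` (E `&` P)).
  apply: posP; last by move=> x [[]].
  by apply: measurableD => //; exact: measurableI.
rewrite /nu /radon_charge lee_fin (_ : _ `&` K = (P `&` K) `\` (E `&` P)); last first.
  by apply/setIidl => x [[]].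
rewrite (radonD hmu)//.
- lra.
- exact: measurableI.
- by apply: cyK => x [].
- by move=> x [Ex Px]; split => //; exact: EK.
Qed.

End radon_charge.

Section jordan.
Context {R : realType} {n : nat} {Omega : set 'rV[R]_n}.
Implicit Types (mu : set 'rV[R]_n -> R) (K B E F : set 'rV[R]_n).

Lemma upper_var_compact_lty mu K : radon Omega mu -> compact K -> K `<=` Omega ->
  upper_var Omega mu K < +oo.
Proof.
move=> hmu cK KO; have [B hB] := radon_bounded hmu cK KO.
apply: (@le_lt_trans _ _ B%:E); last exact: ltry.
by apply: ge_ereal_sup => _ [E [mE _ EK] <-]; rewrite lee_fin hB.
Qed.

Lemma upper_var_compactly_lty mu E : radon Omega mu -> compactly_in Omega E ->
  upper_var Omega mu E < +oo.
Proof.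
move=> hmu [K [cK KO EK]].
by apply: le_lt_trans (upper_varS mu EK) _; exact: upper_var_compact_lty.
Qed.

Lemma oppr_setfunK mu : (fun E => - - mu E)%R = mu.
Proof. by apply/funext => E; rewrite opprK. Qed.

Lemma upper_le_lower mu E : radon Omega mu -> measurable E -> compactly_in Omega E ->
  upper_var Omega mu E <= (mu E)%:E + lower_var Omega mu E.
Proof.
move=> hmu mE cE; apply: ge_ereal_sup => _ [F [mF cF FE] <-].
have -> : mu F = (mu E + - mu (E `\` F))%R by rewrite (radonD hmu)// opprB addrC subrK.
rewrite EFinD leeD2l//; apply: (@upper_var_ub _ _ _ (fun E => - mu E)%R).
- exact: measurableD.
- by apply: compactly_inS cE; exact: subDsetl.
- exact: subDsetl.
Qed.

(** Each inequality is [upper_le_lower], for [mu] and for its opposite; both parts are finite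
    because [E] is inside a compact set. *)
Lemma radon_jordan mu E : radon Omega mu -> measurable E -> compactly_in Omega E ->
  (mu E)%:E = upper_var Omega mu E - lower_var Omega mu E.
Proof.
move=> hmu mE cE.
have fl : lower_var Omega mu E \is a fin_num.
  rewrite ge0_fin_numE; first exact: upper_var_compactly_lty (radonN hmu) cE.
  exact: upper_var_ge0 (radonN hmu) _.
apply/eqP; rewrite eq_le; apply/andP; split; last first.
  by rewrite leeBlDr//; exact: upper_le_lower.
have fu : upper_var Omega mu E \is a fin_num.
  rewrite ge0_fin_numE; first exact: upper_var_compactly_lty hmu cE.
  exact: upper_var_ge0 hmu _.
have h : lower_var Omega mu E <= (- mu E)%:E + upper_var Omega mu E.
  by have := upper_le_lower (radonN hmu) mE cE; rewrite /lower_var/= oppr_setfunK.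
move: h; rewrite -(fineK fl) -(fineK fu) -EFinB -EFinD !lee_fin; lra.
Qed.

(** For competitors [E] and [F] of the two parts, the common piece cancels in mu(E) - mu(F), and the
    differences [E] minus [F] and [F] minus [E] are disjoint, hence admissible in the variation. *)
Lemma le_upper_radon_variation mu B : radon Omega mu ->
  upper_var Omega mu B + lower_var Omega mu B <= radon_variation Omega mu B.
Proof.
move=> hmu; have hmuN := radonN hmu.
have [->|Vy] := eqVneq (radon_variation Omega mu B) +oo; first exact: leey.
have key E F : measurable E -> measurable F -> compactly_in Omega E -> compactly_in Omega F ->
    E `<=` B -> F `<=` B -> (mu E)%:E + (- mu F)%:E <= radon_variation Omega mu B.
  move=> mE mF cE cF EB FB.
  have cEF : compactly_in Omega (E `\` F) by apply: compactly_inS cE; exact: subDsetl.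
  have cFE : compactly_in Omega (F `\` E) by apply: compactly_inS cF; exact: subDsetl.
  pose G := bigcup2 (E `\` F) (F `\` E).
  apply: (@le_trans _ _ (\sum_(0 <= i <oo) `|mu (G i)|%:E)); last first.
    apply: ereal_sup_ubound; exists G; split => //.
    - by move=> [|[|i]]; rewrite /G/bigcup2/=; [exact: measurableD|exact: measurableD|].
    - move=> [|[|i]]; rewrite /G/bigcup2//=; exact: compactly_in0.
    - rewrite /G -trivIset_bigcup2; apply/seteqP; split => // x [[Ex nFx] [Fx _]] //.
    - by rewrite /G bigcup2E => x [[Ex _]|[Fx _]]; [exact: EB|exact: FB].
  apply: (le_trans _ (nneseries_lim_ge 2 _)); last by move=> i _ _; rewrite lee_fin.
  rewrite !big_nat_recr//= big_geq// add0e /G/bigcup2/= -!EFinD lee_fin.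
  have mEF : measurable (E `&` F) by exact: measurableI.
  have dE : mu E = (mu (E `&` F) + mu (E `\` F))%R.
    rewrite -(radonU hmu)//; last by apply/seteqP; split => // x [[_ Fx] [_ nFx]].
    - by rewrite setUIDK.
    - exact: measurableD.
    - by apply: compactly_inS cE; exact: subIsetl.
  have dF : mu F = (mu (E `&` F) + mu (F `\` E))%R.
    rewrite -(radonU hmu)//.
    - by rewrite setIC setUIDK.
    - exact: measurableD.
    - by apply: compactly_inS cE; exact: subIsetl.
    - by apply/seteqP; split => // x [[Ex _] [_ nEx]].
  rewrite dE dF.
  have := ler_norm (mu (E `\` F)); have := ler_norm (- mu (F `\` E))%R.
  rewrite normrN; lra.
have fin : lower_var Omega mu B \is a fin_num.
  rewrite ge0_fin_numE; last exact: upper_var_ge0 hmuN _.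
  apply: (@le_lt_trans _ _ (radon_variation Omega mu B)); last by rewrite ltey.
  apply: ge_ereal_sup => _ [F [mF cF FB] <-].
  have := key set0 F measurable0 mF (compactly_in0 _) cF (sub0set _) FB.
  by rewrite hmu.1 add0e.
rewrite -leeBrDr//; apply: ge_ereal_sup => _ [E [mE cE EB] <-].
rewrite leeBrDr// -leeBrDl//; apply: ge_ereal_sup => _ [F [mF cF FB] <-].
by rewrite leeBrDl//; exact: key.
Qed.

Lemma abs_le_upper_lower mu E : radon Omega mu -> measurable E -> compactly_in Omega E ->
  `|mu E|%:E <= upper_var Omega mu E + lower_var Omega mu E.
Proof.
move=> hmu mE cE; have hmuN := radonN hmu.
have [m0|m0] := leP 0%R (mu E).
- rewrite ger0_norm// -[leLHS]adde0 leeD//; first exact: upper_var_ub.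
  exact: upper_var_ge0 hmuN _.
- rewrite ltr0_norm// -[leLHS]add0e leeD//; first exact: upper_var_ge0 hmu _.
  exact: (@upper_var_ub _ _ _ (fun E => - mu E)%R).
Qed.

Lemma radon_variationE mu B : radon Omega mu -> measurable B ->
  radon_variation Omega mu B = upper_var Omega mu B + lower_var Omega mu B.
Proof.
move=> hmu mB; have hmuN := radonN hmu.
apply/eqP; rewrite eq_le le_upper_radon_variation// andbT.
apply: ge_ereal_sup => _ [F [mF cF tF FB ->]].
have mU : measurable (\bigcup_i F i) by exact: bigcupT_measurable.
apply: (@le_trans _ _ (\sum_(0 <= i <oo) (upper_var Omega mu (F i) + lower_var Omega mu (F i)))).
  by apply: lee_nneseries => i _; rewrite ?lee_fin//; exact: abs_le_upper_lower.
rewrite nneseriesD; last 2 first.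
  by move=> *; exact: (upper_var_ge0 hmu).
  by move=> *; exact: (upper_var_ge0 hmuN).
by rewrite (upper_var_bigcup hmu)// (upper_var_bigcup hmuN)// leeD//; exact: upper_varS.
Qed.

Lemma radon_coord (m : nat) (A : set 'rV[R]_n -> 'rV[R]_m) i :
  radon Omega A -> radon Omega (radon_component A i).
Proof.
move=> [A0 AU]; split; first by rewrite /radon_component A0 mxE.
move=> K F cK KO mF FK tF.
have -> : series (fun k => radon_component A i (F k)) =
    (fun k => series (fun k => A (F k)) k ord0 i).
  by apply/funext => k; rewrite /series/= summxE.
have h := AU K F cK KO mF FK tF.
exact: (cvg_comp _ (fun M : 'rV[R]_m => M ord0 i) h (@coord_continuous _ _ _ ord0 i _)).
Qed.

Lemma coord_le_enorm (m : nat) (v : 'rV[R]_m) i : (`|v ord0 i| <= enorm v)%R.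
Proof.
rewrite /enorm -sqrtr_sqr ler_wsqrtr// (bigD1 i)//= lerDl.
by apply: sumr_ge0 => j _; exact: sqr_ge0.
Qed.

Lemma enorm0 (m : nat) : enorm (0 : 'rV[R]_m) = 0%R.
Proof. by rewrite /enorm big1 ?sqrtr0// => j _; rewrite mxE expr0n. Qed.

(** The variation of [A] enters the proof through such bounds, as a set function dominating the
    Jordan parts of the components. *)
Lemma component_le_vradon_variation (m : nat) (A : set 'rV[R]_n -> 'rV[R]_m) i B E :
  radon Omega A -> measurable E -> compactly_in Omega E -> E `<=` B ->
  `|A E ord0 i|%:E <= vradon_variation Omega A B.
Proof.
move=> [A0 AU] mE cE EB.
apply: (@le_trans _ _ (\sum_(0 <= j <oo) (enorm (A (bigcup2 E set0 j)))%:E)); last first.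
  apply: ereal_sup_ubound; exists (bigcup2 E set0); split => //.
  - by move=> [|[|j]]; rewrite /bigcup2//=; exact: measurable0.
  - by move=> [|[|j]]; rewrite /bigcup2//=; exact: compactly_in0.
  - by rewrite -trivIset_bigcup2 setI0.
  - by rewrite bigcup2E setU0.
apply: (le_trans _ (nneseries_lim_ge 1 _)).
  by rewrite big_nat1/= lee_fin coord_le_enorm.
by move=> j _ _; rewrite lee_fin /enorm sqrtr_ge0.
Qed.

Lemma vradon_variation0 (m : nat) (A : set 'rV[R]_n -> 'rV[R]_m) :
  radon Omega A -> vradon_variation Omega A set0 = 0.
Proof.
move=> [A0 AU].
have -> : vradon_variation Omega A set0 = ereal_sup [set 0]; last by rewrite ereal_sup1.
congr (ereal_sup _); apply/seteqP; split => s /=.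
  move=> [F [mF cF tF F0 ->]].
  rewrite eseries0// => i _ _.
  have -> : F i = set0 by apply/seteqP; split => // x Fx; apply: F0; exists i.
  by rewrite A0 enorm0.
move=> ->; exists (fun=> set0); split => //.
- by move=> i; exact: compactly_in0.
- by apply/trivIsetP => i j _ _ _; rewrite setI0.
- by move=> x [i].
- by rewrite eseries0// => i _ _; rewrite A0 enorm0.
Qed.

End jordan.

(** * Comparison of integrals against set functions *)

Section integral_of_set_functions.
Context d (T : measurableType d) (R : realType).
Import HBNNSimple.

(** Carries integrability from a variation, seen as a mere set function, to the Jordan parts below
    it. Integrals are suprema over simple functions, for which the comparison is term by term. *)
Lemma le_integral_setfun (m1 m2 : set T -> \bar R) (D : set T) (f : T -> \bar R) :
  m1 set0 = 0 -> m2 set0 = 0 -> (forall S, measurable S -> 0 <= m1 S <= m2 S) ->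
  (forall x, 0 <= f x) -> \int[m1]_(x in D) f x <= \int[m2]_(x in D) f x.
Proof.
move=> m10 m20 m12 f0.
have sE (m : set T -> \bar R) (h : {nnsfun T >-> R}) : m set0 = 0 ->
    sintegral m h = \sum_(x \in range h) x%:E * m (h @^-1` [set x]).
  move=> m0; rewrite /sintegral (fsbig_widen (range h) setT)//= => x [_ Nhx] /=.
  by rewrite preimage10// m0 mule0.
have g0 x : 0 <= (f \_ D) x by rewrite patchE; case: ifP.
have gm : (f \_ D)^\- = cst 0.
  by apply/funext => x; rewrite funenegE max_r// oppe_le0.
rewrite /integral gm.
(* The negative part of [f] is 0, but its integral is still a supremum; the only simple function
   below 0 is 0, and the values it omits have empty preimage, of mass 0. *)
have nn0 (m : set T -> \bar R) : m set0 = 0 ->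
   ereal_sup [set sintegral m h |
     h in [set h : {nnsfun T >-> R} | forall x, (h x)%:E <= cst 0 x]] = 0.
  move=> m0; have -> : [set sintegral m h |
     h in [set h : {nnsfun T >-> R} | forall x, (h x)%:E <= cst 0 x]] = [set 0].
    apply/seteqP; split => s /=.
      move=> [h h0 <-]; rewrite sE// fsbig1// => x [y _ <-].
      suff -> : h y = 0%R by rewrite mul0e.
      by apply/eqP; rewrite eq_le -lee_fin h0/=.
    move=> ->; exists nnsfun0 => //; rewrite sE// fsbig1// => x [y _ <-].
    by rewrite mul0e.
  by rewrite ereal_sup1.
rewrite !nn0// !sube0; apply: ge_ereal_sup => _ [h /= hg <-].
apply: (@le_trans _ _ (sintegral m2 h)); last by apply: ereal_sup_ubound; exists h.
rewrite !sE// lee_fsum// => r [x _ <-]; rewrite lee_wpmul2l ?lee_fin//.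
by have /andP[] := m12 (h @^-1` [set h x]) (measurable_sfunP h (measurable_set1 _)).
Qed.

End integral_of_set_functions.

(** * Layer cake formula and Fubini *)

Section integral_off_null_set.
Context d (T : measurableType d) (R : realType) (m : {measure set T -> \bar R}).
Import HBNNSimple.

(* f and g need not be measurable: it suffices to cut off the simple functions
   below them outside M. *)
Lemma eq_integral_off_null (D M : set T) (f g : T -> \bar R) :
  measurable M -> m M = 0 -> (forall x, D x -> ~ M x -> f x = g x) ->
  \int[m]_(x in D) f x = \int[m]_(x in D) g x.
Proof.
move=> mM M0 fg.
have le (p q : T -> \bar R) : (forall x, 0 <= q x) ->
    (forall x, ~ M x -> p x = q x) ->
    ereal_sup [set sintegral m h |
      h in [set h : {nnsfun T >-> R} | forall x, (h x)%:E <= p x]] <=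
    ereal_sup [set sintegral m h |
      h in [set h : {nnsfun T >-> R} | forall x, (h x)%:E <= q x]].
  move=> q0 pq; apply: ge_ereal_sup => _ [h /= hp <-].
  pose h' : {nnsfun T >-> R} := proj_nnsfun h (measurableC mM).
  have h'E x : h' x = (h x * \1_(~` M) x)%R by [].
  have h'q x : (h' x)%:E <= q x.
    rewrite h'E indicE.
    have [Mx|nMx] := pselect (M x); last by rewrite mem_set// mulr1 -pq.
    by rewrite memNset ?mulr0//= => /(_ Mx).
  apply: ereal_sup_ubound; exists h'; first exact: h'q.
  rewrite -!integralT_nnsfun; apply: ge0_ae_eq_integral => //.
  - by apply/measurable_EFinP.
  - by apply/measurable_EFinP.
  - by move=> x _; rewrite lee_fin.
  - by move=> x _; rewrite lee_fin.
  - exists M; split => // x /= nx; apply: contrapT => nMx; apply: nx => _.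
    have hh : h' x = h x by rewrite h'E indicE mem_set// mulr1.
    by have := congr1 EFin hh.
have eqn (p q : T -> \bar R) : (forall x, 0 <= p x) -> (forall x, 0 <= q x) ->
    (forall x, ~ M x -> p x = q x) ->
    ereal_sup [set sintegral m h |
      h in [set h : {nnsfun T >-> R} | forall x, (h x)%:E <= p x]] =
    ereal_sup [set sintegral m h |
      h in [set h : {nnsfun T >-> R} | forall x, (h x)%:E <= q x]].
  move=> p0 q0 pq; apply/eqP; rewrite eq_le !le// => x nMx.
  by rewrite pq.
have fgD x : ~ M x -> (f \_ D) x = (g \_ D) x.
  by move=> nMx; rewrite !patchE; case: ifPn => // /set_mem Dx; exact: fg.
rewrite /integral; congr (_ - _); apply: eqn => x; rewrite ?funepos_ge0 ?funeneg_ge0//.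
- by move=> nMx; rewrite !funeposE fgD.
- by move=> nMx; rewrite !funenegE fgD.
Qed.

End integral_off_null_set.

Section layer_cake_line.
Context {R : realType}.
Local Notation lebesgue := (@lebesgue_measure R).

(** Subtracting 1[t < 0] makes this integrable in t: it is the indicator of [0, a[, or minus that of
    [a, 0[. *)
Definition layer (a t : R) : R := ((t < a)%R%:R - (t < 0)%R%:R)%R.

Lemma layer_pos (a t : R) : (0 <= a)%R -> layer a t = \1_`[0%R, a[ t.
Proof.
move=> a0; rewrite /layer indicE mem_setE in_itv/=.
have [t0|t0] /= := ltP t 0%R; last by rewrite subr0.
by rewrite (lt_le_trans t0 a0) subrr.
Qed.

Lemma layer_neg (a t : R) : (a < 0)%R -> layer a t = (- \1_`[a, 0%R[ t)%R.
Proof.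
move=> a0; rewrite /layer indicE mem_setE in_itv/=.
have [ta|ta] /= := ltP t a; last by rewrite sub0r.
by rewrite (lt_trans ta a0) subrr oppr0.
Qed.

Lemma integrable_layer (a : R) : lebesgue.-integrable setT (EFin \o layer a).
Proof.
have [a0|a0] := leP 0%R a.
  have := @integrable_indic_itv R 0%R a true true.
  by apply: eq_integrable => // t _ /=; rewrite layer_pos.
have := integrableN (@integrable_indic_itv R a 0%R true true).
by apply: eq_integrable => // t _ /=; rewrite layer_neg.
Qed.

Lemma integral_layer (c a : R) : \int[lebesgue]_t (c * layer a t)%:E = (c * a)%:E.
Proof.
under eq_integral do rewrite EFinM.
rewrite (integralZl measurableT (integrable_layer a)) EFinM; congr (_ * _).
have [a0|a0] := leP 0%R a.
  under eq_integral do rewrite /= layer_pos//.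
  rewrite integral_indic// setIT/= lebesgue_measure_itv/= lte_fin.
  by move: a0; rewrite le_eqVlt => /predU1P[<-|->]; rewrite ?ltxx// sube0.
under eq_integral do rewrite /= layer_neg// -mulN1r EFinM.
rewrite (integralZl measurableT (@integrable_indic_itv R a 0%R true true)).
rewrite integral_indic// setIT/= lebesgue_measure_itv/= lte_fin a0 add0e.
by rewrite mulN1e EFinN oppeK.
Qed.

(** As a function of t, [layer a] has the constant sign of [a]. This gives the Tonelli bound: the
    double integral of |c layer(v)| is that of |c v|. *)
Lemma integral_abs_layer (c a : R) :
  \int[lebesgue]_t `|(c * layer a t)%:E| = (`|c| * `|a|)%:E.
Proof.
have e t : (`|c * layer a t| = (`|c| * Num.sg a) * layer a t)%R.
  rewrite normrM; have [a0|a0] := leP 0%R a.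
    rewrite layer_pos// indicE; move: a0; rewrite le_eqVlt => /predU1P[<-|a0].
      by rewrite mem_setE in_itv/= le_lt_asym normr0 !mulr0.
    by rewrite gtr0_sg// mulr1 normr_nat.
  by rewrite layer_neg// ltr0_sg// normrN mulrN1 mulrNN indicE normr_nat.
under eq_integral do rewrite abse_EFin e.
by rewrite integral_layer -mulrA -normrEsg.
Qed.

End layer_cake_line.

Section atoms.
Context d (T : measurableType d) (R : realType) (m : {finite_measure set T -> \bar R}).

(** Fibres of [v] are disjoint and [m] is finite, so only finitely many have mass at least
    1/(k+1). *)
Lemma countable_atoms (v : T -> R) : measurable_fun setT v ->
  countable [set t : R | m (v @^-1` [set t]) != 0].
Proof.
move=> mv; pose S t := v @^-1` [set t].
have mS t : measurable (S t) by rewrite -[S t]setTI; exact: mv.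
pose D k := [set t : R | (k.+1%:R^-1)%:E <= m (S t)].
have -> : [set t : R | m (v @^-1` [set t]) != 0] = \bigcup_k D k.
  apply/seteqP; split => t /=.
    move=> mt.
    have mtf : m (S t) \is a fin_num by exact: fin_num_measure.
    have : (0 < fine (m (S t)))%R by rewrite fine_gt0// lt0e mt measure_ge0/= ltey_eq mtf.
    move=> /ltr_add_invr[k]; rewrite add0r => hk; exists k => //.
    by rewrite /D/= -(fineK mtf) lee_fin ltW.
  by move=> [k _]; rewrite /D/=; apply: contraTneq => ->; rewrite -ltNge lte_fin invr_gt0.
apply: bigcup_countable => // k _; apply: finite_set_countable.
(* An injection of the integers into [D k] would give p disjoint fibres of total mass at least
   p/(k+1), for every p. *)
apply: contrapT => /infiniteP/pcard_leP[f].
have tS : trivIset setT (S \o f).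
  apply/trivIsetP => i j _ _ /eqP ij; apply/seteqP; split => // x [] vi vj.
  apply: ij; apply: (@inj _ _ _ f); rewrite ?inE//.
  exact: (etrans (esym vi) vj).
have mTf : m setT \is a fin_num by exact: fin_num_measure.
have bound (p : nat) : (p%:R * k.+1%:R^-1 <= fine (m setT))%R.
  rewrite -lee_fin fineK//.
  apply: (@le_trans _ _ (\sum_(i < p) m (S (f i)))).
    rewrite -[leLHS]/((p%:R * k.+1%:R^-1)%:E) mulrC mulr_natr.
    have -> : (k.+1%:R^-1 *+ p)%R = (\sum_(i < p) (k.+1%:R^-1 : R))%R.
      by rewrite sumr_const card_ord.
    rewrite -sumEFin; apply: lee_sum => i _.
    exact: (@funS _ _ _ _ f i I).
  rewrite -(@measure_semi_additive_ord _ _ _ m _ (fun i : 'I_p => S (f i)))//.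
  - apply: le_measure; rewrite ?inE//.
    by apply: bigsetU_measurable.
  - apply/trivIsetP => i j _ _ ij; move/trivIsetP : tS; apply => //.
  - by apply: bigsetU_measurable.
have [p hp] := @nat_ge R (k.+1%:R * (fine (m setT) + 1)).
have := bound p; rewrite ler_pdivrMr// mulrC.
have : (0 < k.+1%:R :> R)%R by [].
move: hp; rewrite mulrDr mulr1; lra.
Qed.

End atoms.

Section layer_cake.
Context d (T : measurableType d) (R : realType) (m : {finite_measure set T -> \bar R}).
Local Notation lebesgue := (@lebesgue_measure R).
Context (c v : T -> R) (C : R).
Hypotheses (mc : measurable_fun setT c) (mv : measurable_fun setT v).
Hypothesis (bc : forall x, (`|c x| <= C)%R).
Hypothesis (icv : m.-integrable setT (fun x => (c x * v x)%:E)).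

(** The integrand for Fubini. Integrability is assumed for the product [c * v] only: [c] will
    contain a weight lam or 1 - lam that compensates for [v]. *)
Let F (z : T * measurableTypeR R) : \bar R := (c z.1 * layer (v z.1) z.2)%:E.

Let mF : measurable_fun setT F.
Proof.
apply/measurable_EFinP; apply: measurable_funM.
  exact: measurableT_comp mc (@measurable_fst _ _ _ _).
have mlt (g : T * measurableTypeR R -> R) : measurable_fun setT g ->
    measurable_fun setT (fun z : T * measurableTypeR R => (z.2 < g z)%R%:R : R).
  move=> mg.
  have mS : measurable [set z : T * measurableTypeR R | (z.2 < g z)%R].
    have := @measurable_fun_ltr _ _ _ setT _ _ (@measurable_snd _ _ T (measurableTypeR R)) mg.
    by move=> /(_ measurableT [set true] I); rewrite setTI.
  rewrite [X in measurable_fun _ X](_ : _ = \1_[set z : T * measurableTypeR R | (z.2 < g z)%R]).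
    exact: measurable_indic.
  by apply/funext => z; rewrite indicE mem_setE.
apply: measurable_funB; first by apply: mlt; exact: measurableT_comp mv (@measurable_fst _ _ _ _).
by apply: mlt; exact: measurable_cst.
Qed.

Let iF : (m \x lebesgue).-integrable setT F.
Proof.
have e x : \int[lebesgue]_t `|F (x, t)| = (`|c x| * `|v x|)%:E.
  exact: (integral_abs_layer (c x) (v x)).
apply/(integrable12ltyP m lebesgue mF); under eq_integral do rewrite e.
move: icv => /integrableP[_ h].
rewrite (eq_integral (fun x => `|(c x * v x)%:E|))// => x _.
by rewrite abse_EFin normrM.
Qed.

(** True for every t, where Fubini would give almost every t: [c] is bounded, [layer] has values in
    {-1, 0, 1} and [m] is finite. *)
Lemma integrable_layered (t : R) : m.-integrable setT (fun x => (c x * layer (v x) t)%:E).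
Proof.
apply: (@measurable_bounded_integrable _ _ _ m (fun x => c x * layer (v x) t)%R) => //.
- by rewrite -ge0_fin_numE// fin_num_measure.
- have := measurableT_comp mF (@pair2_measurable _ _ T _ (t : measurableTypeR R)).
  by move=> /measurable_EFinP.
- exists C; split; first exact: num_real.
  move=> M CM x _ /=; rewrite normrM (le_trans _ (ltW CM))// (le_trans _ (bc x))//.
  rewrite ler_piMr//.
  by rewrite /layer; case: (_ < v x)%R; case: (_ < 0)%R;
    rewrite ?subrr ?subr0 ?sub0r ?normrN ?normr0 ?normr1.
Qed.

Lemma integrable_layer_cake :
  lebesgue.-integrable setT (fun t => \int[m]_x (c x * layer (v x) t)%:E).
Proof.
have mG := measurable_fubini_G iF.
apply/integrableP; split; first exact: mG.
have := (integrable21ltyP m lebesgue mF).1 iF; apply: le_lt_trans.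
apply: ge0_le_integral => //; first exact: measurableT_comp.
  have h := @measurable_fun_fubini_tonelli_G _ _ _ _ _ m (abse \o F).
  by apply: h => [|z]; [exact: (measurableT_comp (@abse_measurable R setT) mF)|exact: abse_ge0].
move=> t _; apply: le_abse_integral => //.
exact: measurable_int (integrable_layered t).
Qed.

Lemma integral_layer_cake :
  \int[lebesgue]_t \int[m]_x (c x * layer (v x) t)%:E = \int[m]_x (c x * v x)%:E.
Proof.
transitivity (\int[m \x lebesgue]_z F z).
  exact: (integral21_prod_meas1 iF).
rewrite -(integral12_prod_meas1 iF); apply: eq_integral => x _.
exact: (integral_layer (c x) (v x)).
Qed.

End layer_cake.

Lemma countable_setU (T : Type) (A B : set T) :
  countable A -> countable B -> countable (A `|` B).
Proof.
move=> cA cB; rewrite -bigcup2E; apply: bigcup_countable => // -[|[|i]] _ //=.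
Qed.

Section coarea_family.
Context {R : realType}.
Local Notation lebesgue := (@lebesgue_measure R).

(* In the coarea formula [J t], [c0] and [tot] are the integrals of the
   representatives of {u > t}, 1 and u against the same test function. Since
   a = \int (1[t < a] - 1[t < 0]) dt, only J t - 1[t < 0] c0 is integrable; c0
   disappears from the pairing by the divergence theorem. The countable set D
   contains the t for which {u^+ = t} or {u^- = t} is charged. *)
Definition coarea_for (c0 : \bar R) (J : R -> \bar R) (tot : \bar R) : Prop :=
  exists (g : R -> R) (c : R) (D : set R),
  [/\ lebesgue.-integrable setT (EFin \o g), countable D,
      forall t, ~ D t -> J t = (g t + (t < 0)%R%:R * c)%:E,
      c0 = c%:E & tot = \int[lebesgue]_t (g t)%:E].

Lemma coarea_forD c1 c2 J1 J2 tot1 tot2 : coarea_for c1 J1 tot1 ->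
  coarea_for c2 J2 tot2 -> coarea_for (c1 + c2) (J1 \+ J2) (tot1 + tot2).
Proof.
move=> [g1 [d1 [D1 [i1 cD1 J1E -> ->]]]] [g2 [d2 [D2 [i2 cD2 J2E -> ->]]]].
exists (fun t => g1 t + g2 t)%R, (d1 + d2)%R, (D1 `|` D2); split => //.
- by have := integrableD measurableT i1 i2; apply: eq_integrable.
- exact: countable_setU.
- move=> t /not_orP[nD1 nD2] /=; rewrite J1E// J2E// -EFinD; congr (_%:E); ring.
- by rewrite -integralD_EFin.
Qed.

Lemma coarea_forN c J tot : coarea_for c J tot ->
  coarea_for (- c) (fun t => - J t) (- tot).
Proof.
move=> [g [d [D [ig cD JE -> ->]]]].
exists (fun t => - g t)%R, (- d)%R, D; split => //.
- by have := integrableN ig; apply: eq_integrable.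
- by move=> t nD; rewrite JE// -EFinN; congr (_%:E); ring.
- rewrite -[LHS]mulN1e -integralZl//; apply: eq_integral => t _ /=.
  by rewrite -EFinM mulN1r.
Qed.

Lemma coarea_for0 : coarea_for 0 (cst 0) 0.
Proof.
exists (cst 0%R), 0%R, set0; split => //.
- exact: integrable0.
- by move=> t _; rewrite mulr0 addr0.
- by rewrite integral0_eq.
Qed.

Lemma coarea_for_sum (k : nat) c J tot : (forall i : 'I_k, coarea_for (c i) (J i) (tot i)) ->
  coarea_for (\sum_(i < k) c i) (fun t => \sum_(i < k) J i t) (\sum_(i < k) tot i).
Proof.
elim: k c J tot => [|k IH] c J tot h.
  by rewrite !big_ord0; under eq_fun do rewrite big_ord0; exact: coarea_for0.
rewrite !big_ord_recl.
rewrite (_ : (fun t => _) = J ord0 \+ (fun t => \sum_(i < k) J (lift ord0 i) t)); last first.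
  by apply/funext => t; rewrite big_ord_recl.
by apply: coarea_forD => //; exact: (IH (fun i => c (lift ord0 i)) (fun i => J (lift ord0 i))).
Qed.

(** Every subset of a countable set is Borel, so changing a Borel function on [D] keeps it Borel,
    not merely measurable for the completion. *)
Lemma measurable_off_countable (f g : measurableTypeR R -> \bar R) (D : set R) :
  countable D -> measurable_fun setT g -> (forall t, ~ D t -> f t = g t) ->
  measurable_fun setT f.
Proof.
move=> cD mg fg _ Y mY; rewrite setTI.
have m1 (E : set (measurableTypeR R)) : countable E -> measurable E.
  by move=> cE; apply: countable_measurable => // t; exact: measurable_set1.
rewrite (_ : f @^-1` Y = ((g @^-1` Y) `\` D) `|` ((f @^-1` Y) `&` D)).
  apply: measurableU; last by apply: m1; exact: sub_countable (subset_card_le _) cD.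
  by apply: measurableD; [rewrite -[X in measurable X]setTI; exact: mg|exact: m1].
apply/seteqP; split => t /=.
  have [Dt ft|nDt ft] := pselect (D t); first by right.
  by left; split => //; rewrite -fg.
by move=> [[gt nDt]|[]//]; rewrite fg.
Qed.

Lemma coarea_for_integral J tot : coarea_for 0 J tot ->
  lebesgue.-integrable setT J /\ tot = \int[lebesgue]_t J t.
Proof.
move=> [g [c [D [ig cD JE [c0] ->]]]].
have {}JE t : ~ D t -> J t = (g t)%:E by move=> nD; rewrite JE// -c0 mulr0 addr0.
have D0 : lebesgue D = 0 by exact: countable_lebesgue_measure0.
have mD : measurable (D : set (measurableTypeR R)).
  by apply: countable_measurable => // t; exact: measurable_set1.
split; last by apply: (eq_integral_off_null mD) => // t _ /JE.
move: ig => /integrableP[mg goo]; apply/integrableP; split.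
  exact: measurable_off_countable mg JE.
suff -> : \int[lebesgue]_t `|J t| = \int[lebesgue]_t `|(EFin \o g) t| by [].
by apply: (eq_integral_off_null mD) => // t _ /JE ->.
Qed.

End coarea_family.

Section finite_measure_coarea.
Context d (T : measurableType d) (R : realType) (m : {finite_measure set T -> \bar R}).

(** The argument on one Jordan part: [w1], [w2] stand for 1 - lam and lam, [v1], [v2] for real
    substitutes of u^- and u^+. [F] and [X] are prescribed only off [M], so they may be
    non-measurable. Writing 1[t < v] as [layer v t] + 1[t < 0], the second terms add up to 1[t < 0]
    f because the weights sum to 1 where [f] is nonzero. *)
Lemma finite_measure_coarea (w1 v1 w2 v2 f : T -> R) (C : R) (M : set T)
    (F : T -> \bar R) (X : R -> T -> \bar R) :
  measurable_fun setT w1 -> measurable_fun setT v1 ->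
  measurable_fun setT w2 -> measurable_fun setT v2 -> measurable_fun setT f ->
  (forall x, 0 <= w1 x <= 1)%R -> (forall x, 0 <= w2 x <= 1)%R ->
  (forall x, (w1 x + w2 x) * f x = f x)%R -> (forall x, `|f x| <= C)%R ->
  m.-integrable setT (fun x => (w1 x * v1 x)%:E) ->
  m.-integrable setT (fun x => (w2 x * v2 x)%:E) ->
  measurable M -> m M = 0 ->
  (forall x, ~ M x -> F x = ((w1 x * v1 x + w2 x * v2 x) * f x)%:E) ->
  (forall t x, ~ M x -> t != v1 x -> t != v2 x ->
     X t x = ((w1 x * (t < v1 x)%R%:R + w2 x * (t < v2 x)%R%:R) * f x)%:E) ->
  coarea_for (\int[m]_x (f x)%:E) (fun t => \int[m]_x X t x) (\int[m]_x F x).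
Proof.
move=> mw1 mv1 mw2 mv2 mf w01 w02 w12 fC i1 i2 mM M0 FE XE.
have mfin : m setT < +oo by rewrite -ge0_fin_numE// fin_num_measure.
have if_ : m.-integrable setT (EFin \o f).
  apply: measurable_bounded_integrable => //.
  exists C; split; first exact: num_real.
  by move=> K CK x _ /=; rewrite (le_trans (fC x))// ltW.
have C0 (x : T) : (0 <= C)%R by apply: le_trans (fC x).
have bw (w : T -> R) : (forall x, 0 <= w x <= 1)%R -> forall x, (`|w x * f x| <= C)%R.
  move=> w01' x; have /andP[w0 w1'] := w01' x.
  rewrite normrM (ger0_norm w0) (le_trans _ (fC x))// ler_piMl//.
have iw (w v : T -> R) : measurable_fun setT w -> measurable_fun setT v ->
    m.-integrable setT (fun x => (w x * v x)%:E) ->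
    m.-integrable setT (fun x => (w x * f x * v x)%:E).
  move=> mw mv iwv.
  apply: (@le_integrable _ _ _ m setT measurableT _ (fun x => C%:E * (w x * v x)%:E)).
  - apply/measurable_EFinP; apply: measurable_funM => //; exact: measurable_funM.
  - move=> x _; rewrite -EFinM !abse_EFin lee_fin mulrAC !normrM [leLHS]mulrC.
    by rewrite ler_wpM2r// (le_trans (fC x))// ler_norm.
  - exact: integrableZl.
have mc (w : T -> R) : measurable_fun setT w -> measurable_fun setT (fun x => w x * f x)%R.
  by move=> mw; exact: measurable_funM.
have IG1 := integrable_layer_cake (mc _ mw1) mv1 (bw _ w01) (iw _ _ mw1 mv1 i1).
have IG2 := integrable_layer_cake (mc _ mw2) mv2 (bw _ w02) (iw _ _ mw2 mv2 i2).
have L1 := integral_layer_cake (mc _ mw1) mv1 (iw _ _ mw1 mv1 i1).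
have L2 := integral_layer_cake (mc _ mw2) mv2 (iw _ _ mw2 mv2 i2).
have il1 t := integrable_layered m (mc _ mw1) mv1 (bw _ w01) t.
have il2 t := integrable_layered m (mc _ mw2) mv2 (bw _ w02) t.
set G1 := (fun t => _) in IG1 L1 *; set G2 := (fun t => _) in IG2 L2 *.
have fG1 t : G1 t \is a fin_num by exact: integrable_fin_num.
have fG2 t : G2 t \is a fin_num by exact: integrable_fin_num.
pose D := [set t | m (v1 @^-1` [set t]) != 0] `|` [set t | m (v2 @^-1` [set t]) != 0].
have IG12 := integrableD measurableT IG1 IG2.
exists (fun t => fine (G1 t) + fine (G2 t))%R, (fine (\int[m]_x (f x)%:E)), D.
split.
- apply: eq_integrable IG12 => // t _ /=; rewrite EFinD !fineK//.
- by apply: countable_setU; exact: countable_atoms.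
- move=> t /not_orP[/negP/negPn/eqP D1 /negP/negPn/eqP D2].
  (* For t outside [D] the level sets {v1 = t} and {v2 = t}, where [X t] is not prescribed, are
     null. *)
  pose N := M `|` (v1 @^-1` [set t] `|` v2 @^-1` [set t]).
  have mv1t : measurable (v1 @^-1` [set t]) by rewrite -[X in measurable X]setTI; exact: mv1.
  have mv2t : measurable (v2 @^-1` [set t]) by rewrite -[X in measurable X]setTI; exact: mv2.
  have mN : measurable N by apply: measurableU => //; exact: measurableU.
  have N0 : m N = 0 by rewrite !measureU0//; exact: measurableU.
  pose k1 x := (w1 x * f x * layer (v1 x) t)%R.
  pose k2 x := (w2 x * f x * layer (v2 x) t)%R.
  rewrite (eq_integral_off_null
    (g := fun x => (k1 x)%:E + ((k2 x)%:E + (t < 0)%R%:R%:E * (f x)%:E)) mN N0); last first.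
    move=> x _ /not_orP[nM /not_orP[n1 n2]].
    rewrite XE//; [|by apply/eqP => e; exact: n1|by apply/eqP => e; exact: n2].
    rewrite -EFinM -!EFinD /k1 /k2 /layer; congr (_%:E).
    by rewrite -[in X in (_ + (_ + X))%R](w12 x); ring.
  rewrite integralD//; [|exact: il1|by apply: integrableD => //; [exact: il2|exact: integrableZl]].
  rewrite integralD//; [|exact: il2|exact: integrableZl].
  rewrite integralZl// !EFinD EFinM !fineK ?addeA//.
  exact: integrable_fin_num.
- by rewrite fineK//; exact: integrable_fin_num.
- rewrite (eq_integral_off_null
    (g := fun x => (w1 x * f x * v1 x)%:E + (w2 x * f x * v2 x)%:E) mM M0); last first.
    move=> x _ nM; rewrite FE// -EFinD; congr (_%:E); ring.
  rewrite integralD//; [|exact: iw|exact: iw].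
  rewrite -L1 -L2 -integralD//; apply: eq_integral => t _.
  by rewrite EFinD !fineK.
Qed.

End finite_measure_coarea.

(** * Densities of superlevel sets *)

Section product_lebesgue.
Context {R : realType}.
Import HBNNSimple.

(** Both sides are suprema over simple functions, so arbitrary functions are allowed, such as the
    measures of the sections of an arbitrary set. *)
Lemma ge0_le_integral_any d (T : measurableType d) (m : {measure set T -> \bar R})
    (D : set T) (f g : T -> \bar R) :
  (forall x, 0 <= f x) -> (forall x, f x <= g x) ->
  \int[m]_(x in D) f x <= \int[m]_(x in D) g x.
Proof.
move=> f0 fg; have g0 x : 0 <= g x by apply: le_trans (fg x).
rewrite !ge0_integralE//; apply: ereal_sup_le => _ [h /= hf <-]; exists h => // x.
by rewrite (le_trans (hf x))// !patchE; case: ifP.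
Qed.

Lemma lebN_ge0_le n : (forall E : set 'rV[R]_n, 0 <= lebN E) /\
  forall E E' : set 'rV[R]_n, E `<=` E' -> lebN E <= lebN E'.
Proof.
elim: n => [|n [IH0 IH]]; split.
- by move=> E; rewrite /= diracE lee_fin.
- move=> E E' EE' /=; rewrite !diracE lee_fin ler_nat.
  have [E0|//] := boolP (_ \in E); rewrite mem_set//.
  by apply: EE'; rewrite inE in E0.
- by move=> E /=; apply: integral_ge0.
- move=> E E' EE' /=; apply: ge0_le_integral_any => // s; apply: IH => y /=.
  exact: EE'.
Qed.

Lemma lebN_ge0 n (E : set 'rV[R]_n) : 0 <= lebN E.
Proof. by have [] := lebN_ge0_le n. Qed.

Lemma lebN_le n (E E' : set 'rV[R]_n) : E `<=` E' -> lebN E <= lebN E'.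
Proof. by have [_] := lebN_ge0_le n; apply. Qed.

Lemma lebN0 n : lebN (set0 : set 'rV[R]_n) = 0.
Proof.
elim: n => [|n IH] /=; first by rewrite diracE in_set0.
by under eq_integral do rewrite IH; rewrite integral0.
Qed.

(** Sections of a cube are cubes or empty, which suits [lebN]; Euclidean balls are squeezed between
    two cubes. *)
Definition box n (x : 'rV[R]_n) (r : R) : set 'rV[R]_n :=
  [set y | forall i, (`|y ord0 i - x ord0 i| < r)%R].

Lemma lebN_box n (x : 'rV[R]_n) (r : R) : (0 < r)%R ->
  lebN (box x r) = ((r *+ 2) ^+ n)%:E.
Proof.
move=> r0; elim: n x => [|n IH] x.
  by rewrite /= diracE mem_set// => -[].
pose x' : 'rV[R]_n := \row_j x ord0 (lift ord0 j).
have sec (s : R) : lebN [set y : 'rV[R]_n | box x r (row_mx (const_mx s : 'rV[R]_1) y)] =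
    ((r *+ 2) ^+ n)%:E * (\1_(ball (x ord0 ord0) r) s)%:E.
  have e0 (y : 'rV[R]_n) : (row_mx (const_mx s : 'rV[R]_1) y) ord0 ord0 = s.
    have -> : (ord0 : 'I_n.+1) = lshift n (ord0 : 'I_1) by apply: val_inj.
    by rewrite row_mxEl mxE.
  have eS (y : 'rV[R]_n) j : (row_mx (const_mx s : 'rV[R]_1) y) ord0 (lift ord0 j) = y ord0 j.
    have -> : lift ord0 j = rshift 1 j by apply: val_inj.
    by rewrite row_mxEr.
  rewrite indicE; have [sx|sx] := pselect (ball (x ord0 ord0) r s).
    rewrite mem_set// mule1 -(IH x'); congr lebN; apply/seteqP; split => y /= hy.
      by move=> j; rewrite mxE -(eS y).
    move=> i; have [->|[j ->]] : i = ord0 \/ exists j, i = lift ord0 j.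
      by case: (unliftP ord0 i) => [j ->|->]; [right; exists j|left].
      by rewrite e0 distrC; exact: sx.
    by rewrite eS; have := hy j; rewrite mxE.
  rewrite memNset// mule0 -(lebN0 n); congr lebN; apply/seteqP; split => y //= hy.
  by apply: sx; rewrite /ball/= distrC -(e0 y).
rewrite /=; under eq_integral do rewrite sec.
rewrite integralZl//; last first.
  have := @integrable_indic_itv R (x ord0 ord0 - r) (x ord0 ord0 + r) false true.
  by rewrite ball_itv.
rewrite integral_indic ?setIT//; last exact: measurable_ball.
by rewrite /= lebesgue_measure_ball ?ltW// -EFinM exprSr.
Qed.

Lemma eball_sub_box n (x : 'rV[R]_n) r : eball x r `<=` box x r.
Proof.
move=> y; rewrite /eball/= => xy i; apply: le_lt_trans xy.
by have := coord_le_enorm (y - x) i; rewrite !mxE.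
Qed.

(** The squares sum to at most n r^2/(n+1)^2 < r^2; dividing by n+1 also covers n = 0. *)
Lemma box_sub_eball n (x : 'rV[R]_n) r : (0 < r)%R -> box x (r / n.+1%:R) `<=` eball x r.
Proof.
move=> r0 y hy; rewrite /eball/= /enorm.
rewrite -[ltRHS](gtr0_norm r0) -sqrtr_sqr ltr_sqrt ?exprn_gt0//.
apply: (@le_lt_trans _ _ (\sum_(i < n) (r / n.+1%:R) ^+ 2)%R).
  apply: ler_sum => i _; rewrite !mxE -[leLHS]real_normK ?num_real//.
  by rewrite lerXn2r// ?nnegrE ?divr_ge0 ?ltW//; exact: hy.
rewrite sumr_const card_ord; set q := (r / n.+1%:R)%R.
have q0 : (0 < q)%R by rewrite divr_gt0.
have -> : (r ^+ 2 = q ^+ 2 * n.+1%:R ^+ 2)%R by rewrite -exprMn divfK.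
rewrite -[ltLHS]mulr_natr ltr_pM2l ?exprn_gt0// -natrX ltr_nat.
by rewrite (leq_trans (ltnSn n))// -{1}[n.+1]expn1 leq_pexp2l.
Qed.

Lemma lebN_eball n (x : 'rV[R]_n) r : (0 < r)%R -> 0 < lebN (eball x r) < +oo.
Proof.
move=> r0; apply/andP; split.
  apply: lt_le_trans (lebN_le (box_sub_eball (x := x) r0)).
  by rewrite lebN_box ?divr_gt0// lte_fin exprn_gt0// mulrn_wgt0// divr_gt0.
apply: le_lt_trans (lebN_le (@eball_sub_box n x r)) _.
by rewrite lebN_box// ltry.
Qed.

End product_lebesgue.

Section densities.
Context {R : realType} {n : nat}.
Implicit Types (E Omega : set 'rV[R]_n) (x : 'rV[R]_n).

Lemma density0_sub E E' x : E `<=` E' -> has_density E' x 0%R -> has_density E x 0%R.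
Proof.
move=> EE' h; apply: (squeeze_cvgr _ (cvg_cst 0%R) h); near=> r.
have r0 : (0 < r)%R by near: r; exact: nbhs_right_gt.
have /andP[b0 boo] := lebN_eball x r0.
have fb F : lebN (F `&` eball x r) \is a fin_num.
  rewrite ge0_fin_numE ?lebN_ge0//; apply: le_lt_trans boo.
  by apply: lebN_le; exact: subIsetr.
rewrite divr_ge0 ?fine_ge0 ?lebN_ge0//= ler_wpM2r//.
  by rewrite invr_ge0 fine_ge0// lebN_ge0.
by apply: fine_le; rewrite ?fb//; apply: lebN_le; exact: setSI.
Unshelve. all: by end_near. Qed.

Lemma density0_set0 x : has_density set0 x 0%R.
Proof.
rewrite /has_density; under eq_fun do rewrite set0I lebN0 mul0r.
exact: cvg_cst.
Qed.

(** The ratio is 1 once the ball lies in [Omega]. This rules out thresholds for which the level set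
    of an indicator is all of [Omega]. *)
Lemma not_density0_nbhs Omega x : open Omega -> Omega x -> ~ has_density Omega x 0%R.
Proof.
move=> oO Ox h.
have h1 : (fine (lebN (Omega `&` eball x r)) / fine (lebN (eball x r)))%R
    @[r --> (0%R : R)^'+] --> (1%R : R).
  apply: (@cvg_near_cst _ _ _ _ (0%R : R)^'+).
  have /nbhs_ballP[e /= e0 xe] : nbhs x Omega by exact: open_nbhs_nbhs.
  near=> r.
  have r0 : (0 < r)%R by near: r; exact: nbhs_right_gt.
  have re : (r < e)%R by near: r; exact: nbhs_right_lt.
  have /andP[b0 boo] := lebN_eball x r0.
  rewrite setIidr ?divff//; first by rewrite gt_eqF// fine_gt0// b0.
  move=> y /eball_sub_box yx; apply: xe; rewrite -ball_normE/=.
  rewrite -opprB normrN; apply: le_lt_trans re; apply: rv_norm_le; first exact: ltW.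
  by move=> i; rewrite !mxE ltW.
have /eqP : (1 : R)%R = 0%R by apply: (cvg_unique _ h1 h); exact: norm_hausdorff.
by rewrite oner_eq0.
Unshelve. all: by end_near. Qed.

End densities.

Section superlevel_representative.
Context {R : realType} {n : nat} (Omega : set 'rV[R]_n) (oO : open Omega).
Context (u : 'rV[R]_n -> R) (x : 'rV[R]_n) (Ox : Omega x) (t : R).
Let E := superlevel Omega u t.
Let E' := [set y | Omega y /\ (u y <= t)%R].

Let chiE y : Omega y -> (\1_E y : R) = (t < u y)%R%:R.
Proof.
move=> Oy; rewrite indicE; have [tu|tu] := boolP (t < u y)%R.
  by rewrite mem_set.
by rewrite memNset// => -[_]; apply/negP.
Qed.

(** The set where the indicator exceeds s is [Omega] for s < 0, [E] for 0 <= s < 1 and empty for s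
    >= 1; only the middle range depends on the density of [E]. *)
Lemma approx_sup_superlevel :
  approx_sup Omega \1_E x = (~~ `[< has_density E x 0%R >])%:R%:E.
Proof.
rewrite /approx_sup; case: asboolP => hE /=.
- apply/eqP; rewrite eq_le; apply/andP; split.
    apply: ereal_inf_lbound => /=; apply: density0_sub hE => y /= [Oy].
    by rewrite chiE// lte_fin ltr0n lt0b.
  apply: le_ereal_inf_tmp => s /= hs; rewrite leNgt; apply/negP => s0.
  apply: (not_density0_nbhs oO Ox); apply: density0_sub hs => y Oy; split => //.
  by apply: lt_le_trans s0 _; rewrite lee_fin indicE.
- apply/eqP; rewrite eq_le; apply/andP; split.
    apply: ereal_inf_lbound => /=.
    rewrite [X in has_density X](_ : _ = set0); first exact: density0_set0.
    apply/seteqP; split => // y /= [_]; rewrite lte_fin indicE.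
    by case: (_ \in _); rewrite ?ltxx// ltr10.
  apply: le_ereal_inf_tmp => s /= hs; rewrite leNgt; apply/negP => s1.
  apply: hE; apply: density0_sub hs => y [Oy ty]; split => //.
  by rewrite chiE// ty.
Qed.

Lemma approx_inf_superlevel :
  approx_inf Omega \1_E x = `[< has_density E' x 0%R >]%:R%:E.
Proof.
rewrite /approx_inf; case: asboolP => hE /=.
- apply/eqP; rewrite eq_le; apply/andP; split.
    apply: ge_ereal_sup => s /= hs; rewrite leNgt; apply/negP => s1.
    apply: (not_density0_nbhs oO Ox); apply: density0_sub hs => y Oy; split => //.
    by apply: le_lt_trans s1; rewrite lee_fin indicE; case: (_ \in _).
  apply: ereal_sup_ubound => /=; apply: density0_sub hE => y /= [Oy].
  rewrite chiE// lte_fin => h; split => //; rewrite leNgt; apply/negP => tu.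
  by rewrite tu ltxx in h.
- apply/eqP; rewrite eq_le; apply/andP; split.
    apply: ge_ereal_sup => s /= hs; rewrite leNgt; apply/negP => s0.
    apply: hE; apply: density0_sub hs => y [Oy]; rewrite leNgt => /negbTE tu; split => //.
    by rewrite chiE// tu.
  apply: ereal_sup_ubound => /=.
  rewrite [X in has_density X](_ : _ = set0); first exact: density0_set0.
  apply/seteqP; split => // y /= [_]; rewrite lte_fin indicE.
  by rewrite ltNge ler0n.
Qed.

(** [a] says that {u <= t} has density 0, [b] that {u > t} does not. If t differs from u^- and u^+,
    monotonicity of density 0 compares t with a threshold s admissible for u^- or u^+; at equality
    either value of the boolean may occur. *)
Lemma lambda_repr_superlevel (lam : 'rV[R]_n -> R) : exists a b : bool,
  [/\ lambda_repr Omega \1_E lam x = ((1 - lam x) * a%:R + lam x * b%:R)%:E,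
      approx_inf Omega u x != t%:E -> a = (t%:E < approx_inf Omega u x) &
      approx_sup Omega u x != t%:E -> b = (t%:E < approx_sup Omega u x)].
Proof.
exists `[< has_density E' x 0%R >], (~~ `[< has_density E x 0%R >]); split.
- rewrite /lambda_repr approx_sup_superlevel approx_inf_superlevel.
  by rewrite (_ : (_ == +oo) = false)//= !EFinD !EFinM.
- move=> ut; have [lt|gt] := ltP t%:E (approx_inf Omega u x).
    apply/asboolP; have [s /= hs ts] := ereal_sup_gt lt.
    apply: density0_sub hs => y [Oy uy]; split => //.
    by apply: le_lt_trans ts; rewrite lee_fin.
  apply/asboolP => h; move/negP : ut; apply; rewrite eq_le gt/=.
  apply: ereal_sup_ubound => /=; apply: density0_sub h => y [Oy]; rewrite lte_fin => /ltW.
  by [].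
- move=> ut; have [lt|gt] := ltP t%:E (approx_sup Omega u x).
    apply/negP => /asboolP h; move: lt; rewrite ltNge => /negP; apply.
    by apply: ereal_inf_lbound => /=; apply: density0_sub h => y [Oy]; rewrite lte_fin.
  apply/negbTE; rewrite negbK; apply/asboolP.
  have lt : approx_sup Omega u x < t%:E by rewrite lt_neqAle ut gt.
  have [s /= hs st] := ereal_inf_lt lt.
  apply: density0_sub hs => y [Oy tu]; split => //.
  by apply: lt_trans st _; rewrite lte_fin.
Qed.

End superlevel_representative.

(** * Coarea formula *)

Section compact_restriction.
Context {R : realType} {n : nat} {Omega : set 'rV[R]_n}.
Context (nu : set 'rV[R]_n -> R) (hnu : radon Omega nu).
Context (K : set 'rV[R]_n) (cK : compact K) (KO : K `<=` Omega).

(** The Jordan part cut down to [K] is a finite measure on the whole space, as Fubini and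
    [countable_atoms] require. *)
Definition upper_restr :=
  @mfrestr _ _ R K (radon_upper hnu) (compact_measurable_rV cK)
    (upper_var_compact_lty hnu cK KO).

HB.instance Definition _ := Measure.on upper_restr.
HB.instance Definition _ := FiniteMeasure.on upper_restr.

Lemma integral_upper_restrK (F : 'rV[R]_n -> \bar R) :
  \int[upper_var Omega nu]_(x in K) F x = \int[upper_restr]_(x in K) F x.
Proof.
apply: (@eq_measure_integral _ _ _ K upper_restr (radon_upper hnu)) => B mB BK.
have e : radon_upper hnu (B `&` K) = radon_upper hnu B by rewrite setIidl.
exact: esym e.
Qed.

Lemma integral_upper_restr (F : 'rV[R]_n -> \bar R) : (forall x, ~ K x -> F x = 0) ->
  \int[upper_var Omega nu]_(x in Omega) F x = \int[upper_restr]_x F x.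
Proof.
move=> F0.
have e (D D' : set 'rV[R]_n) : K `<=` D -> K `<=` D' -> F \_ D = F \_ D'.
  move=> KD KD'; apply/funext => x; rewrite !patchE.
  have [Kx|nKx] := pselect (K x); first by rewrite !mem_set//; [exact: KD'|exact: KD].
  by rewrite (F0 x nKx) !if_same.
transitivity (\int[upper_var Omega nu]_(x in K) F x).
  by rewrite /integral (e _ K KO).
rewrite integral_upper_restrK /integral (e K setT)//.
Qed.

Lemma integrable_upper_restr (g : 'rV[R]_n -> \bar R) :
  (upper_var Omega nu).-integrable K g -> upper_restr.-integrable setT (g \_ K).
Proof.
have mK := compact_measurable_rV cK.
move=> /integrableP[mg goo]; apply/integrableP; split.
  by apply/(measurable_restrictT _ mK).
move: goo; rewrite integral_upper_restrK; apply: le_lt_trans.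
rewrite [leRHS]integral_mkcond; apply: ge0_le_integral_any => // x.
by rewrite !patchE; case: ifP; rewrite ?abse0.
Qed.

End compact_restriction.

Section upper_coarea.
Context {R : realType} {n : nat} (Omega : set 'rV[R]_n) (oO : open Omega).
Context (lam u : 'rV[R]_n -> R) (mlam : measurable_fun Omega lam).
Context (lam01 : forall x, Omega x -> (0 <= lam x <= 1)%R).
Context (K : set 'rV[R]_n) (cK : compact K) (KO : K `<=` Omega).
Context (f : 'rV[R]_n -> R) (cf : continuous f) (f0 : forall x, ~ K x -> f x = 0%R).

Let mK := compact_measurable_rV cK.

(* u^+ and u^- enter only through the integrable products g = w u^+ and
   g = w u^- with w = lam, 1 - lam, and may be replaced by g / w. This makes them
   measurable without any study of the measurability of densities. *)
Definition quotient_weight (w : 'rV[R]_n -> R) (g : 'rV[R]_n -> \bar R) x : R :=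
  (fine (g x) * w x `^ (-1))%R.

(** Where the weight vanishes so does [g], so the value given to the inverse of 0 is harmless. *)
Lemma quotient_weightK w (g : 'rV[R]_n -> \bar R) x : (0 <= w x)%R ->
  (w x = 0%R -> g x = 0) -> (w x * quotient_weight w g x = fine (g x))%R.
Proof.
move=> w0 g0; rewrite /quotient_weight powR_inv1//.
have [wx|wx] := eqVneq (w x) 0%R; first by rewrite g0// wx/= mul0r.
by rewrite mulrCA mulfV// mulr1.
Qed.

Lemma integrable_quotient_weight (m : {finite_measure set 'rV[R]_n -> \bar R})
    (w : 'rV[R]_n -> R) (g : 'rV[R]_n -> \bar R) :
  (forall x, 0 <= w x)%R -> (forall x, w x = 0%R -> g x = 0) ->
  m.-integrable setT g ->
  m.-integrable setT (fun x => (w x * quotient_weight w g x)%:E).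
Proof.
move=> w0 g0 ig; have mg : measurable_fun setT g by case/integrableP: ig.
apply: (@le_integrable _ _ _ m setT measurableT _ g) => //.
- apply/measurable_EFinP.
  rewrite (_ : (fun x => w x * quotient_weight w g x)%R = fine \o g).
    exact: (measurableT_comp (fine_measurable measurableT) mg).
  by apply/funext => x; rewrite (quotient_weightK (w0 x) (g0 x)).
- move=> x _; rewrite (quotient_weightK (w0 x) (g0 x)).
  by case: (g x) => [r| |] /=; rewrite ?normr0 ?leey ?lexx.
Qed.

Lemma measurable_quotient_weight (w : 'rV[R]_n -> R) (g : 'rV[R]_n -> \bar R) :
  measurable_fun setT w -> measurable_fun setT g ->
  measurable_fun setT (quotient_weight w g).
Proof.
move=> mw mg; apply: measurable_funM.
  exact: (measurableT_comp (fine_measurable measurableT) mg).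
exact: (measurableT_comp (@measurable_powR R (-1)) mw).
Qed.

(** Off the null sets [N1] and [N2] the weighted products are finite. There a nonzero weight forces
    u^- or u^+ to be real and equal to its quotient [v1] or [v2], while a zero weight removes the
    term. *)
Lemma upper_coarea (nu : set 'rV[R]_n -> R) : radon Omega nu ->
  (upper_var Omega nu).-integrable K (fun x => (lam x)%:E * approx_sup Omega u x) ->
  (upper_var Omega nu).-integrable K (fun x => (1 - lam x)%:E * approx_inf Omega u x) ->
  coarea_for (\int[upper_var Omega nu]_(x in Omega) (f x)%:E)
    (fun t => \int[upper_var Omega nu]_(x in Omega)
       (lambda_repr Omega \1_(superlevel Omega u t) lam x * (f x)%:E))
    (\int[upper_var Omega nu]_(x in Omega) (lambda_repr Omega u lam x * (f x)%:E)).
Proof.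
move=> hnu isup iinf.
pose m := upper_restr hnu cK KO.
rewrite (integral_upper_restr hnu cK KO); last by move=> x /f0 ->.
rewrite (integral_upper_restr hnu cK KO); last by move=> x /f0 ->; rewrite mule0.
rewrite (_ : (fun t => _) = fun t => \int[m]_x
    (lambda_repr Omega \1_(superlevel Omega u t) lam x * (f x)%:E)); last first.
  apply/funext => t; rewrite (integral_upper_restr hnu cK KO)//.
  by move=> x /f0 ->; rewrite mule0.
have ig2 := integrable_upper_restr hnu cK KO isup.
have ig1 := integrable_upper_restr hnu cK KO iinf.
set g2 := _ \_ _ in ig2; set g1 := _ \_ _ in ig1.
pose w2 := lam \_ K; pose w1 := (fun x => 1 - lam x)%R \_ K.
have w2E x : K x -> w2 x = lam x by move=> Kx; rewrite /w2 patchE mem_set.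
have w1E x : K x -> w1 x = (1 - lam x)%R by move=> Kx; rewrite /w1 patchE mem_set.
have w2N x : ~ K x -> w2 x = 0%R by move=> Kx; rewrite /w2 patchE memNset.
have w1N x : ~ K x -> w1 x = 0%R by move=> Kx; rewrite /w1 patchE memNset.
have g2E x : K x -> g2 x = (lam x)%:E * approx_sup Omega u x.
  by move=> Kx; rewrite /g2 patchE mem_set.
have g1E x : K x -> g1 x = (1 - lam x)%:E * approx_inf Omega u x.
  by move=> Kx; rewrite /g1 patchE mem_set.
have g2N x : ~ K x -> g2 x = 0 by move=> Kx; rewrite /g2 patchE memNset.
have g1N x : ~ K x -> g1 x = 0 by move=> Kx; rewrite /g1 patchE memNset.
have w01 x : (0 <= w1 x <= 1)%R.
  have [Kx|/w1N ->] := pselect (K x); last by rewrite lexx ler01.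
  by rewrite w1E//; have := lam01 (KO Kx); lra.
have w02 x : (0 <= w2 x <= 1)%R.
  have [Kx|/w2N ->] := pselect (K x); last by rewrite lexx ler01.
  by rewrite w2E//; exact: lam01 (KO Kx).
have wg2 x : w2 x = 0%R -> g2 x = 0.
  have [Kx|/g2N//] := pselect (K x).
  by rewrite w2E// g2E// => ->; rewrite mul0e.
have wg1 x : w1 x = 0%R -> g1 x = 0.
  have [Kx|/g1N//] := pselect (K x).
  by rewrite w1E// g1E// => ->; rewrite mul0e.
have mlamK : measurable_fun K lam by exact: measurable_funS (open_measurable_rV oO) KO mlam.
have mw2 : measurable_fun setT w2 by exact/(measurable_restrictT _ mK).
have mw1 : measurable_fun setT w1.
  by apply/(measurable_restrictT _ mK); apply: measurable_funB => //; exact: measurable_cst.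
have mg2 : measurable_fun setT g2 by case/integrableP: ig2.
have mg1 : measurable_fun setT g1 by case/integrableP: ig1.
have [N1 [mN1 N10 sN1]] := integrable_ae measurableT ig1.
have [N2 [mN2 N20 sN2]] := integrable_ae measurableT ig2.
have fing1 x : ~ N1 x -> g1 x \is a fin_num.
  by move=> nN; apply: contrapT => h; apply: nN; apply: sN1 => /= /(_ I).
have fing2 x : ~ N2 x -> g2 x \is a fin_num.
  by move=> nN; apply: contrapT => h; apply: nN; apply: sN2 => /= /(_ I).
have [C0 C00 hC0] : exists2 C : R, (0 <= C)%R & forall x, (`|f x| <= C)%R.
  have cfK : compact (f @` K).
    by apply: continuous_compact => //; exact: continuous_subspaceT.
  have /compact_bounded[B [_ hB]] := cfK.
  exists (`|B| + 1)%R; first by rewrite addr_ge0.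
  move=> x; have [Kx|/f0 ->] := pselect (K x); last by rewrite normr0 addr_ge0.
  by apply: hB; [rewrite (le_lt_trans (ler_norm B))// ltrDl|exists x].
have pos_fin (w : R) (e : \bar R) : (0 < w)%R -> w%:E * e \is a fin_num -> e \is a fin_num.
  move=> w0; case: e => [//||].
  - by rewrite gt0_muley.
  - by rewrite gt0_muleNy.
have qv (w : R) (r : R) : w != 0%R -> (w * r * w^-1)%R = r.
  by move=> w0; rewrite mulrAC mulfV// mul1r.
pose v1 := quotient_weight w1 g1; pose v2 := quotient_weight w2 g2.
have v2E x : K x -> ~ N2 x -> w2 x != 0%R -> approx_sup Omega u x = (v2 x)%:E.
  move=> Kx nN w2x; have /andP[w20 _] := w02 x.
  have w2p : (0 < w2 x)%R by rewrite lt_neqAle eq_sym w2x.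
  have := fing2 _ nN; rewrite /v2 /quotient_weight powR_inv1// g2E// -w2E// => /pos_fin.
  move=> /(_ w2p) sf; rewrite -(fineK sf) -EFinM/= qv//.
have v1E x : K x -> ~ N1 x -> w1 x != 0%R -> approx_inf Omega u x = (v1 x)%:E.
  move=> Kx nN w1x; have /andP[w10 _] := w01 x.
  have w1p : (0 < w1 x)%R by rewrite lt_neqAle eq_sym w1x.
  have := fing1 _ nN; rewrite /v1 /quotient_weight powR_inv1// g1E// -w1E// => /pos_fin.
  move=> /(_ w1p) sf; rewrite -(fineK sf) -EFinM/= qv//.
apply: (@finite_measure_coarea _ _ _ m w1 v1 w2 v2 f C0 (N1 `|` N2)) => //.
- exact: measurable_quotient_weight.
- exact: measurable_quotient_weight.
- exact: continuous_measurable_rV.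
- move=> x; have [Kx|/f0 ->] := pselect (K x); last by rewrite mulr0.
  by rewrite w1E// w2E// subrK mul1r.
- by apply: integrable_quotient_weight => // x; have /andP[] := w01 x.
- by apply: integrable_quotient_weight => // x; have /andP[] := w02 x.
- exact: measurableU.
- by rewrite measureU0.
- move=> x /not_orP[nN1 nN2].
  have [Kx|/f0 ->] := pselect (K x); last by rewrite mule0 mulr0.
  have /andP[w1x0 _] := w01 x; have /andP[w2x0 _] := w02 x.
  rewrite /v1 /v2 (quotient_weightK w1x0 (@wg1 x)) (quotient_weightK w2x0 (@wg2 x)).
  rewrite [RHS]EFinM EFinD !fineK ?fing1 ?fing2//; congr (_ * _).
  (* On Z_u both u^+ and u^- are infinite, and lam or 1 - lam is nonzero, so one of the two weighted
     products would be infinite: excluded off [N1] and [N2]. *)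
  rewrite /lambda_repr; case: ifPn => [/andP[/eqP sup /eqP inf]|_].
    have f1 := fing1 _ nN1; have f2 := fing2 _ nN2.
    exfalso; have [w20|w20] := eqVneq (w2 x) 0%R.
      have w1x : w1 x != 0%R by rewrite w1E// -w2E// w20 subr0 oner_neq0.
      by have := v1E _ Kx nN1 w1x; rewrite inf.
    by have := v2E _ Kx nN2 w20; rewrite sup.
  by rewrite g1E// g2E.
- move=> t x /not_orP[nN1 nN2] tv1 tv2.
  have [Kx|/f0 ->] := pselect (K x); last by rewrite mule0 mulr0.
  rewrite [RHS]EFinM; congr (_ * _).
  have [a [b [-> aE bE]]] := lambda_repr_superlevel oO u (KO Kx) t lam.
  rewrite -w1E// -w2E//; congr (_%:E); congr (_ + _)%R.
    have [->|w1x] := eqVneq (w1 x) 0%R; first by rewrite !mul0r.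
    have e := v1E _ Kx nN1 w1x.
    by rewrite aE e ?lte_fin// eqe eq_sym.
  have [->|w2x] := eqVneq (w2 x) 0%R; first by rewrite !mul0r.
  have e := v2E _ Kx nN2 w2x.
  by rewrite bE e ?lte_fin// eqe eq_sym.
Qed.

End upper_coarea.

Section variation_bounds.
Context {R : realType} {n : nat} {Omega : set 'rV[R]_n}.
Implicit Types (nu : set 'rV[R]_n -> R) (V : set 'rV[R]_n -> \bar R).

Lemma integrable_upper nu V K g : radon Omega nu -> V set0 = 0 ->
  (forall B, measurable B -> upper_var Omega nu B <= V B) ->
  V.-integrable K g -> (upper_var Omega nu).-integrable K g.
Proof.
move=> hnu V0 hV /integrableP[mg goo]; apply/integrableP; split => //.
apply: le_lt_trans goo; apply: le_integral_setfun => //.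
- exact: upper_var0.
- by move=> S mS; rewrite hV// andbT; exact: upper_var_ge0.
Qed.

Lemma radon_variation0 nu : radon Omega nu -> radon_variation Omega nu set0 = 0.
Proof.
move=> hnu; rewrite radon_variationE// /lower_var !upper_var0 ?adde0//.
exact: radonN.
Qed.

Lemma upper_le_variation nu B : radon Omega nu -> measurable B ->
  upper_var Omega nu B <= radon_variation Omega nu B.
Proof.
move=> hnu mB; rewrite radon_variationE// leeDl//.
exact: (upper_var_ge0 (radonN hnu)).
Qed.

Lemma lower_le_variation nu B : radon Omega nu -> measurable B ->
  lower_var Omega nu B <= radon_variation Omega nu B.
Proof. by move=> hnu mB; rewrite radon_variationE// leeDr// upper_var_ge0. Qed.

Lemma component_upper_le m (A : set 'rV[R]_n -> 'rV[R]_m) i B : radon Omega A ->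
  upper_var Omega (radon_component A i) B <= vradon_variation Omega A B.
Proof.
move=> hA; apply: ge_ereal_sup => _ [E [mE cE EB] <-].
apply: le_trans (component_le_vradon_variation i hA mE cE EB).
by rewrite lee_fin ler_norm.
Qed.

Lemma component_lower_le m (A : set 'rV[R]_n -> 'rV[R]_m) i B : radon Omega A ->
  lower_var Omega (radon_component A i) B <= vradon_variation Omega A B.
Proof.
move=> hA; apply: ge_ereal_sup => _ [E [mE cE EB] <-].
apply: le_trans (component_le_vradon_variation i hA mE cE EB).
by rewrite lee_fin -normrN ler_norm.
Qed.

End variation_bounds.

Section pairing_coarea.
Context {R : realType} {n : nat} (Omega : set 'rV[R]_n) (oO : open Omega).
Context (A : set 'rV[R]_n -> 'rV[R]_n) (divA : set 'rV[R]_n -> R).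
Context (hA : radon Omega A) (hdivA : radon Omega divA).
Context (lam u : 'rV[R]_n -> R) (mlam : measurable_fun Omega lam).
Context (lam01 : forall x, Omega x -> (0 <= lam x <= 1)%R).
Context (hsup : L1loc2 Omega A divA (fun x => (lam x)%:E * approx_sup Omega u x)).
Context (hinf : L1loc2 Omega A divA (fun x => (1 - lam x)%:E * approx_inf Omega u x)).

(** [V] will be |div A| for [nu] = div A, and |A| for a component of [A]. *)
Lemma sintegral_coarea (nu : set 'rV[R]_n -> R) V K f :
  compact K -> K `<=` Omega -> continuous f -> (forall x, ~ K x -> f x = 0%R) ->
  radon Omega nu -> V set0 = 0 ->
  (forall B, measurable B -> upper_var Omega nu B <= V B) ->
  (forall B, measurable B -> lower_var Omega nu B <= V B) ->
  V.-integrable K (fun x => (lam x)%:E * approx_sup Omega u x) ->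
  V.-integrable K (fun x => (1 - lam x)%:E * approx_inf Omega u x) ->
  coarea_for (sintegral_radon Omega nu (fun x => (f x)%:E))
    (fun t => sintegral_radon Omega nu
       (fun x => lambda_repr Omega \1_(superlevel Omega u t) lam x * (f x)%:E))
    (sintegral_radon Omega nu (fun x => lambda_repr Omega u lam x * (f x)%:E)).
Proof.
move=> cK KO cf f0 hnu V0 uV lV isup iinf; have hnuN := radonN hnu.
apply: coarea_forD.
  by apply: (upper_coarea oO mlam lam01 cK KO cf f0 hnu); exact: integrable_upper uV _.
apply: coarea_forN.
by apply: (upper_coarea oO mlam lam01 cK KO cf f0 hnuN); exact: integrable_upper lV _.
Qed.

Lemma pairing_coarea phi K : compact K -> K `<=` Omega -> Ck 1 phi ->
  (forall x, ~ K x -> phi x = 0%R /\ forall i, partial_deriv i phi x = 0%R) ->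
  coarea_for
    (- sintegral_radon Omega divA (fun x => (phi x)%:E)
     - vintegral_radon Omega A (fun i x => (partial_deriv i phi x)%:E))
    (fun t => pairing Omega A divA lam \1_(superlevel Omega u t) phi)
    (pairing Omega A divA lam u phi).
Proof.
move=> cK KO kphi phi0.
have [hs1 hs2] := hsup; have [hi1 hi2] := hinf.
apply: coarea_forD; first apply: coarea_forN.
  apply: (@sintegral_coarea divA (radon_variation Omega divA) K) => //.
  - exact: Ck_continuous kphi.
  - by move=> x /phi0[].
  - exact: radon_variation0.
  - by move=> B mB; exact: upper_le_variation.
  - by move=> B mB; exact: lower_le_variation.
  - exact: hs2.
  - exact: hi2.
apply: coarea_forN; apply: coarea_for_sum => i.
apply: (@sintegral_coarea (radon_component A i) (vradon_variation Omega A) K) => //.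
- by case: kphi => _ /(_ i)[].
- by move=> x /phi0[].
- exact: radon_coord.
- exact: vradon_variation0.
- by move=> B mB; exact: component_upper_le.
- by move=> B mB; exact: component_lower_le.
- exact: hs1.
- exact: hi1.
Qed.

End pairing_coarea.

(** * Functionals Lipschitz for the C^1 norm *)

Section C1_bounded_functionals.
Context {R : realType} {n : nat} (Omega : set 'rV[R]_n).
Implicit Types (L : ('rV[R]_n -> R) -> \bar R) (K : set 'rV[R]_n).

Definition C1_within K (phi : 'rV[R]_n -> R) : Prop :=
  Ck 1 phi /\ forall x, ~ K x -> phi x = 0%R /\ forall i, partial_deriv i phi x = 0%R.

(** Finiteness of the values is part of the notion, since differences of extended reals are
    controlled only then. *)
Definition C1_lipschitz K L : Prop := exists C : R, forall phi psi (e : R),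
  C1_within K phi -> C1_within K psi -> (forall x, `|phi x - psi x| <= e)%R ->
  (forall i x, `|partial_deriv i phi x - partial_deriv i psi x| <= e)%R ->
  [/\ L phi \is a fin_num, L psi \is a fin_num & (`|fine (L phi) - fine (L psi)| <= C * e)%R].

Lemma C1_lipschitzN K L : C1_lipschitz K L -> C1_lipschitz K (fun phi => - L phi).
Proof.
move=> [C hC]; exists C => phi psi e h1 h2 h3 h4.
have [f1 f2 h] := hC phi psi e h1 h2 h3 h4.
by split; rewrite ?fin_numN// !fineN -opprD normrN.
Qed.

Lemma C1_lipschitzD K L1 L2 : C1_lipschitz K L1 -> C1_lipschitz K L2 ->
  C1_lipschitz K (fun phi => L1 phi + L2 phi).
Proof.
move=> [C1 hC1] [C2 hC2]; exists (C1 + C2)%R => phi psi e h1 h2 h3 h4.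
have [f1 f2 h] := hC1 phi psi e h1 h2 h3 h4.
have [f1' f2' h'] := hC2 phi psi e h1 h2 h3 h4.
split; rewrite ?fin_numD ?f1 ?f2// !fineD//.
rewrite [X in `|X|%R](_ : _ = (fine (L1 phi) - fine (L1 psi)) + (fine (L2 phi) - fine (L2 psi)))%R.
  by rewrite mulrDl (le_trans (ler_normD _ _))// lerD.
by ring.
Qed.

Lemma C1_lipschitz0 K : C1_lipschitz K (fun=> 0).
Proof. by exists 0%R => *; split => //=; rewrite subrr normr0 mul0r. Qed.

Lemma C1_lipschitz_sum K k (L : 'I_k -> _) : (forall i, C1_lipschitz K (L i)) ->
  C1_lipschitz K (fun phi => \sum_(i < k) L i phi).
Proof.
elim: k L => [|k IH] L h.
  by under eq_fun do rewrite big_ord0; exact: C1_lipschitz0.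
under eq_fun do rewrite big_ord_recl.
by apply: C1_lipschitzD => //; exact: (IH (fun i => L (lift ord0 i))).
Qed.

(* Each test function is a uniform C^1 limit of smooth ones within a fixed compact set. *)
Lemma C1_lipschitz_eq0 L : open Omega ->
  (forall K, compact K -> K `<=` Omega -> C1_lipschitz K L) ->
  (forall phi, Cinftyc Omega phi -> L phi = 0) ->
  forall phi, Ckc Omega 1 phi -> L phi = 0.
Proof.
move=> oO hL L0 phi cphi.
have [K [cK KO phi0 app]] := smooth_C1_approx oO cphi.
have [C hC] := hL K cK KO.
have w1 : C1_within K phi by split => //; case: cphi.
have key e : (0 < e)%R -> L phi \is a fin_num /\ (`|fine (L phi)| <= C * e)%R.
  move=> e0; have [psi [spsi psi0 d0 d1]] := app e e0.
  have w2 : C1_within K psi by split => //; case: (spsi 1%N).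
  have [] := hC phi psi e w1 w2.
  - by move=> x; rewrite distrC.
  - by move=> i x; rewrite distrC.
  - by move=> f1 _; rewrite (L0 _ spsi)/= subr0.
have [f1 _] := key 1%R ltr01.
rewrite -(fineK f1); congr (_%:E); apply/eqP; rewrite -normr_le0; apply/ler_addgt0Pl => e e0.
rewrite addr0; have C1 : (0 < `|C| + 1)%R by rewrite ltr_wpDl.
have [_ h] := key (e / (`|C| + 1))%R (divr_gt0 e0 C1).
apply: le_trans h _; rewrite mulrCA -[leRHS]mulr1 ler_wpM2l ?ltW//.
by rewrite ltr_pdivrMr// mul1r (le_lt_trans (ler_norm C))// ltrDl.
Qed.

(** [D] is the identity or a partial derivative. The Lipschitz constant is the integral of |w| over
    [K], after [w] has been made real-valued off a null set. *)
Lemma upper_C1_lipschitz nu K (w : 'rV[R]_n -> \bar R)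
    (D : ('rV[R]_n -> R) -> 'rV[R]_n -> R) :
  radon Omega nu -> compact K -> K `<=` Omega ->
  (upper_var Omega nu).-integrable K w ->
  (forall phi, C1_within K phi -> continuous (D phi) /\ forall x, ~ K x -> D phi x = 0%R) ->
  (forall phi psi e, (forall x, `|phi x - psi x| <= e)%R ->
     (forall i x, `|partial_deriv i phi x - partial_deriv i psi x| <= e)%R ->
     forall x, (`|D phi x - D psi x| <= e)%R) ->
  C1_lipschitz K (fun phi => \int[upper_var Omega nu]_(x in Omega) (w x * (D phi x)%:E)).
Proof.
move=> hnu cK KO iw hD hDe; pose m := upper_restr hnu cK KO.
have iwK := integrable_upper_restr hnu cK KO iw.
set v := _ \_ _ in iwK.
have vE x : K x -> v x = w x by move=> Kx; rewrite /v patchE mem_set.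
have mv : measurable_fun setT v by case/integrableP: iwK.
have [N [mN N0 sN]] := integrable_ae measurableT iwK.
pose r x := fine (v x).
have mr : measurable_fun setT r by exact: (measurableT_comp (fine_measurable measurableT) mv).
have ir : m.-integrable setT (EFin \o r).
  apply: (@le_integrable _ _ _ m setT measurableT _ v) => //.
  - exact/measurable_EFinP.
  - by move=> x _; rewrite /r/=; case: (v x) => [s| |] /=; rewrite ?normr0 ?leey ?lexx.
have restrE phi : C1_within K phi ->
  \int[upper_var Omega nu]_(x in Omega) (w x * (D phi x)%:E) = \int[m]_x (r x * D phi x)%:E.
  move=> w1; have [_ D0] := hD _ w1.
  rewrite (integral_upper_restr hnu cK KO) => [|x /D0 ->]; last by rewrite mule0.
  apply: (eq_integral_off_null mN N0) => x _ nNx.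
  have [Kx|/D0 ->] := pselect (K x); last by rewrite mule0 mulr0.
  have vf : v x \is a fin_num by apply: contrapT => h; apply: nNx; apply: sN => /= /(_ I).
  by rewrite -vE// EFinM /r fineK.
have iD phi : C1_within K phi -> m.-integrable setT (fun x => (r x * D phi x)%:E).
  move=> w1; have [cD D0] := hD _ w1.
  have cfK : compact (D phi @` K).
    by apply: continuous_compact => //; exact: continuous_subspaceT.
  have [B [_ hB]] := compact_bounded cfK.
  apply: (@le_integrable _ _ _ m setT measurableT _ (fun x => (`|B| + 1)%:E * (r x)%:E)).
  - apply/measurable_EFinP; apply: measurable_funM => //.
    exact: continuous_measurable_rV.
  - move=> x _; rewrite -EFinM !abse_EFin lee_fin mulrC !normrM ler_wpM2r//.
    have [Kx|/D0 ->] := pselect (K x); last by rewrite normr0.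
    rewrite [leRHS]ger0_norm ?addr_ge0//.
    by apply: hB; [rewrite (le_lt_trans (ler_norm B))// ltrDl|exists x].
  - exact: integrableZl.
exists (fine (\int[m]_x `|(r x)%:E|)) => phi psi e w1 w2 he hde.
rewrite !restrE//.
have f1 : \int[m]_x (r x * D phi x)%:E \is a fin_num by exact: integrable_fin_num (iD _ w1).
have f2 : \int[m]_x (r x * D psi x)%:E \is a fin_num by exact: integrable_fin_num (iD _ w2).
split => //; rewrite -fineB//.
have fr : \int[m]_x `|(r x)%:E| \is a fin_num.
  by apply: integrable_fin_num => //; exact: integrable_abse.
rewrite -lee_fin -[X in X <= _]/(`|(fine _)%:E|) fineK; last by rewrite fin_numB f1 f2.
rewrite EFinM fineK// -integralB_EFin//; [|exact: iD|exact: iD].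
apply: le_trans (le_abse_integral _ _ _) _ => //.
  by apply: emeasurable_funB; [case/integrableP: (iD _ w1)|case/integrableP: (iD _ w2)].
have e0 : (0 <= e)%R by apply: le_trans (he 0%R).
rewrite muleC -ge0_integralZl//; last first.
  by apply: measurableT_comp => //; exact/measurable_EFinP.
apply: ge0_le_integral_any => // x.
have hDx := hDe _ _ _ he hde x.
by rewrite -EFinB !abse_EFin -EFinM lee_fin -mulrBr normrM mulrC ler_wpM2r.
Qed.

End C1_bounded_functionals.

Section coarea_formula.
Context {R : realType} {n : nat} (Omega : set 'rV[R]_n) (oO : open Omega).

Lemma sintegral_C1_lipschitz (nu : set 'rV[R]_n -> R) V K (w : 'rV[R]_n -> \bar R)
    (D : ('rV[R]_n -> R) -> 'rV[R]_n -> R) :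
  radon Omega nu -> compact K -> K `<=` Omega -> V set0 = 0 ->
  (forall B, measurable B -> upper_var Omega nu B <= V B) ->
  (forall B, measurable B -> lower_var Omega nu B <= V B) ->
  V.-integrable K w ->
  (forall phi, C1_within K phi -> continuous (D phi) /\ forall x, ~ K x -> D phi x = 0%R) ->
  (forall phi psi (e : R), (forall x, `|phi x - psi x| <= e)%R ->
     (forall i x, `|partial_deriv i phi x - partial_deriv i psi x| <= e)%R ->
     forall x, (`|D phi x - D psi x| <= e)%R) ->
  C1_lipschitz K (fun phi => sintegral_radon Omega nu (fun x => w x * (D phi x)%:E)).
Proof.
move=> hnu cK KO V0 uV lV iw hD hDe; have hnuN := radonN hnu.
apply: C1_lipschitzD; last apply: C1_lipschitzN.
  by apply: upper_C1_lipschitz => //; exact: integrable_upper uV iw.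
by apply: (upper_C1_lipschitz hnuN) => //; exact: (integrable_upper hnuN V0 lV iw).
Qed.

Lemma integrable_upper_cst (nu : set 'rV[R]_n -> R) K :
  radon Omega nu -> compact K -> K `<=` Omega ->
  (upper_var Omega nu).-integrable K (cst 1).
Proof.
move=> hnu cK KO; have mK := compact_measurable_rV cK.
have /integrableP[_ h] := finite_measure_integrable_cst (upper_restr hnu cK KO) 1%R mK.
apply/integrableP; split; first exact: measurable_cst.
by rewrite (integral_upper_restrK hnu cK KO).
Qed.

Lemma test_C1_lipschitz (mu : set 'rV[R]_n -> R) K :
  radon Omega mu -> compact K -> K `<=` Omega ->
  C1_lipschitz K (fun phi => sintegral_radon Omega mu (fun x => (phi x)%:E)).
Proof.
move=> hmu cK KO; have hmuN := radonN hmu.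
have H nu : radon Omega nu ->
    C1_lipschitz K (fun phi => \int[upper_var Omega nu]_(x in Omega) (phi x)%:E).
  move=> hnu.
  rewrite (_ : (fun phi => _) = (fun phi : 'rV[R]_n -> R =>
    \int[upper_var Omega nu]_(x in Omega) (cst 1 x * (phi x)%:E))); last first.
    by apply/funext => phi; congr (integral _ _ _); apply/funext => x; rewrite mul1e.
  apply: (@upper_C1_lipschitz _ _ _ nu K (cst 1) id) => //.
  - exact: integrable_upper_cst.
  - by move=> phi [kphi phi0]; split; [exact: Ck_continuous kphi|move=> x /phi0[]].
by apply: C1_lipschitzD; [exact: H|apply: C1_lipschitzN; exact: H].
Qed.

Context (A : set 'rV[R]_n -> 'rV[R]_n) (divA : set 'rV[R]_n -> R).
Context (hA : radon Omega A) (hdivA : radon Omega divA).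

(** The left-hand side is Lipschitz for the C^1 norm and vanishes on smooth functions. It is the
    constant [c0] of the coarea family of [pairing_coarea]. *)
Lemma divergence_theorem :
  (forall phi, Cinftyc Omega phi ->
    vintegral_radon Omega A (fun i x => (partial_deriv i phi x)%:E) =
    - sintegral_radon Omega divA (fun x => (phi x)%:E)) ->
  forall phi, Ckc Omega 1 phi ->
    - sintegral_radon Omega divA (fun x => (phi x)%:E)
    - vintegral_radon Omega A (fun i x => (partial_deriv i phi x)%:E) = 0.
Proof.
move=> hdiv.
have lipV K : compact K -> K `<=` Omega ->
    C1_lipschitz K (fun phi => vintegral_radon Omega A (fun i x => (partial_deriv i phi x)%:E)).
  move=> cK KO; apply: C1_lipschitz_sum => i.
  have hi := radon_coord i hA; have hiN := radonN hi.
  have H nu : radon Omega nu ->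
      C1_lipschitz K (fun phi => \int[upper_var Omega nu]_(x in Omega) (partial_deriv i phi x)%:E).
    move=> hnu.
    rewrite (_ : (fun phi => _) = (fun phi : 'rV[R]_n -> R =>
      \int[upper_var Omega nu]_(x in Omega) (cst 1 x * (partial_deriv i phi x)%:E))); last first.
      by apply/funext => phi; congr (integral _ _ _); apply/funext => x; rewrite mul1e.
    apply: (@upper_C1_lipschitz _ _ _ nu K (cst 1) (partial_deriv i)) => //.
    - exact: integrable_upper_cst.
    - by move=> phi [[_ kphi] phi0]; split; [case: (kphi i)|move=> x /phi0[]].
  by apply: C1_lipschitzD; [exact: H|apply: C1_lipschitzN; exact: H].
apply: (C1_lipschitz_eq0 (L := fun phi => - sintegral_radon Omega divA (fun x => (phi x)%:E)
    - vintegral_radon Omega A (fun i x => (partial_deriv i phi x)%:E)) oO).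
  move=> K cK KO; apply: C1_lipschitzD; apply: C1_lipschitzN; last exact: lipV.
  exact: test_C1_lipschitz.
move=> phi sphi; rewrite hdiv// oppeK addeC subee//.
have [K [cK KO phi0 _]] := smooth_C1_approx oO (sphi 1%N).
have w1 : C1_within K phi by split => //; case: (sphi 1%N).
have [C hC] := test_C1_lipschitz hdivA cK KO.
by have [] := hC phi phi 0%R w1 w1 => //; move=> *; rewrite subrr normr0.
Qed.

Context (lam u : 'rV[R]_n -> R).

Lemma pairing_C1_lipschitz K : compact K -> K `<=` Omega ->
  L1loc2 Omega A divA (lambda_repr Omega u lam) ->
  C1_lipschitz K (pairing Omega A divA lam u).
Proof.
move=> cK KO [hu1 hu2]; apply: C1_lipschitzD; apply: C1_lipschitzN; last first.
  apply: C1_lipschitz_sum => i.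
  apply: (@sintegral_C1_lipschitz (radon_component A i) (vradon_variation Omega A) K
    _ (partial_deriv i)) => //.
  - exact: radon_coord.
  - exact: vradon_variation0.
  - by move=> B mB; exact: component_upper_le.
  - by move=> B mB; exact: component_lower_le.
  - exact: hu1.
  - by move=> phi [[_ kphi] phi0]; split; [case: (kphi i)|move=> x /phi0[]].
apply: (@sintegral_C1_lipschitz divA (radon_variation Omega divA) K _ id) => //.
- exact: radon_variation0.
- by move=> B mB; exact: upper_le_variation.
- by move=> B mB; exact: lower_le_variation.
- exact: hu2.
- by move=> phi [kphi phi0]; split; [exact: Ck_continuous kphi|move=> x /phi0[]].
Qed.

(** [mu] represents the pairing on smooth functions by definition; the difference of the two sides
    is Lipschitz for the C^1 norm. *)
Lemma pairing_measure_C1 mu : L1loc2 Omega A divA (lambda_repr Omega u lam) ->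
  pairing_measure Omega A divA lam u mu -> forall phi, Ckc Omega 1 phi ->
  sintegral_radon Omega mu (fun x => (phi x)%:E) = pairing Omega A divA lam u phi.
Proof.
move=> hu [hmu muE] phi cphi.
pose L phi := sintegral_radon Omega mu (fun x => (phi x)%:E) - pairing Omega A divA lam u phi.
have fin psi : Ckc Omega 1 psi -> pairing Omega A divA lam u psi \is a fin_num /\
    sintegral_radon Omega mu (fun x => (psi x)%:E) \is a fin_num.
  move=> cpsi; have [K [cK KO psi0 _]] := smooth_C1_approx oO cpsi.
  have w1 : C1_within K psi by split => //; case: cpsi.
  have [C hC] := pairing_C1_lipschitz cK KO hu.
  have [C' hC'] := test_C1_lipschitz hmu cK KO.
  have z (x : R) : (`|x - x| <= 0)%R by rewrite subrr normr0.
  by have [] := hC psi psi 0%R w1 w1; have [] := hC' psi psi 0%R w1 w1.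
have : L phi = 0.
  apply: C1_lipschitz_eq0 oO _ _ _ cphi.
    move=> K cK KO; apply: C1_lipschitzD; last apply: C1_lipschitzN.
      exact: test_C1_lipschitz.
    exact: pairing_C1_lipschitz.
  by move=> psi spsi; have [f1 _] := fin _ (spsi 1%N); rewrite /L muE// subee.
have [f1 f2] := fin _ cphi.
by move=> /eqP; rewrite /L sube_eq ?add0e// => /eqP.
Qed.

End coarea_formula.

(** * Inequality between total variations *)

Section shrinking_neighbourhoods.
Context {R : realType} {n : nat}.
Implicit Types (C : set 'rV[R]_n).

Lemma closed_near C x : closed C ->
  (forall k : nat, exists2 c, C c & (`|x - c| <= k.+1%:R^-1)%R) -> C x.
Proof.
move=> cC h; apply: contrapT => nCx.
have /nbhs_ballP[e /= e0 xe] : nbhs x (~` C).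
  by apply: open_nbhs_nbhs; split => //; exact: closed_openC.
have [k ke] : exists k : nat, (k.+1%:R^-1 < e)%R.
  by have [k] := ltr_add_invr e0; rewrite add0r => ke; exists k.
have [c Cc xc] := h k; apply: (xe c) => //.
by rewrite -ball_normE/= (le_lt_trans xc).
Qed.

Lemma bigcap_thick C (d : R) : closed C -> (0 < d)%R ->
  \bigcap_k thick C (d / k.+1%:R) = C.
Proof.
move=> cC d0; apply/seteqP; split => x /=; last first.
  by move=> Cx k _; apply: sub_thick Cx; rewrite divr_ge0// ltW.
move=> h; apply: closed_near => // k.
have [p hp] := @nat_ge R (d * k.+1%:R).
have [c Cc xc] := h p I; exists c => //; apply: le_trans xc _.
rewrite ler_pdivrMr// -ler_pdivrMl ?invr_gt0// invrK mulrC (le_trans hp)//.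
by rewrite ler_nat.
Qed.

Lemma thick_nonincreasing C (d : R) : (0 <= d)%R ->
  nonincreasing_seq (fun k => thick C (d / k.+1%:R)).
Proof.
move=> d0 j k jk; apply/subsetPset; apply: thickS.
by rewrite ler_wpM2l// lef_pV2 ?posrE// ler_nat.
Qed.

End shrinking_neighbourhoods.

(** * Inner regularity of finite Borel measures *)

Section inner_regularity.
Context {R : realType} {n : nat}.
Local Notation T := ('rV[R]_n).
Context (m : {finite_measure set 'rV[R]_n -> \bar R}).

(** Approximating from inside and outside at once makes the property symmetric under complements, so
    the sets having it form a sigma-algebra. *)
Let approx (E : set 'rV[R]_n) : Prop := forall e : R, (0 < e)%R ->
  exists C U, [/\ closed C, open U, C `<=` E, E `<=` U & m (U `\` C) < e%:E].

Let mfin (E : set 'rV[R]_n) : measurable E -> m E < +oo.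
Proof. by move=> mE; rewrite -ge0_fin_numE// fin_num_measure. Qed.

Let approx_closed C : closed C -> approx C.
Proof.
move=> cC e e0; pose U (k : nat) := \bigcup_(c in C) ball c (k.+1%:R^-1 : R).
have oU k : open (U k) by apply: bigcup_open => c _; exact: ball_open.
have CU k : C `<=` U k by move=> c Cc; exists c => //; exact: ballxx.
have mU k : measurable (U k `\` C).
  by apply: measurableD; [exact: open_measurable_rV|exact: closed_measurable_rV].
have UC0 : \bigcap_k (U k `\` C) = set0.
  apply/seteqP; split => // x h.
  have [_ nCx] := h 0%N I; apply: nCx; apply: closed_near => // k.
  have [[c Cc]] := h k I; rewrite -ball_normE/= => xc _; exists c => //.
  by rewrite distrC ltW.
have := @nonincreasing_cvg_mu _ _ _ m (fun k => U k `\` C).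
rewrite UC0 measure0 => /(_ (mfin (mU 0%N)) mU measurable0) h.
have /h{h} : nonincreasing_seq (fun k => U k `\` C).
  move=> j k jk; apply/subsetPset => x [[c Cc xc] nCx]; split => //; exists c => //.
  by apply: le_ball xc; rewrite lef_pV2 ?posrE// ler_nat.
move=> /fine_cvgP[_ /cvgrPdist_lt/(_ e e0)[k _ /(_ k (leqnn k))]].
rewrite sub0r normrN /= ger0_norm ?fine_ge0// => hk.
exists C, (U k); split; [exact: cC|exact: oU|exact: subset_refl|exact: CU|].
by rewrite -(fineK (fin_num_measure m _ (mU k))) lte_fin.
Qed.

Let approxC E : approx E -> approx (~` E).
Proof.
move=> hE e e0; have [C [U [cC oU CE EU h]]] := hE e e0.
exists (~` U), (~` C); split.
- exact: open_closedC.
- exact: closed_openC.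
- exact: subsetC.
- exact: subsetC.
- by rewrite setDE setCK setIC -setDE.
Qed.

(** A countable union of closed sets may fail to be closed, so it is cut after k terms. Half of [e]
    is spread over the [U i] minus [C i], the other half pays for the truncation, by continuity from
    above. *)
Let approxU (E : nat -> set 'rV[R]_n) : (forall i, approx (E i)) -> approx (\bigcup_i E i).
Proof.
move=> hE e e0.
have /choice[C /choice[U CU]] : forall i, exists C, exists U, [/\ closed C, open U,
    C `<=` E i, E i `<=` U & m (U `\` C) < (e / 2 / (2 ^ i.+1)%:R)%:E].
  by move=> i; apply: hE; rewrite !divr_gt0// ltr0n expn_gt0.
pose V := \bigcup_i U i.
have oV : open V by apply: bigcup_open => i _; have [] := CU i.
have mC i : measurable (C i) by apply: closed_measurable_rV; have [] := CU i.
have mUi i : measurable (U i) by apply: open_measurable_rV; have [] := CU i.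
pose W k := V `\` \big[setU/set0]_(i < k) C i.
have mW k : measurable (W k).
  apply: measurableD; first exact: open_measurable_rV.
  by apply: bigsetU_measurable.
have mD i : measurable (U i `\` C i) by exact: measurableD.
have mBD : measurable (\bigcup_i (U i `\` C i)) by exact: bigcupT_measurable.
have mBW : measurable (\bigcap_k W k) by exact: bigcapT_measurable.
have sW : \bigcap_k W k `<=` \bigcup_i (U i `\` C i).
  move=> x h; have [[i _ Uix] _] := h 0%N I; exists i => //; split => // Cix.
  have [_] := h i.+1 I; apply; rewrite -bigcup_mkord; exists i => //=.
have W0 : m (\bigcap_k W k) <= (e / 2)%:E.
  apply: le_trans (le_measure m _ _ sW) _; rewrite ?inE//.
  apply: le_trans (generalized_Boole_inequality m mD mBD) _.
  apply: le_trans (epsilon_trick0 xpredT _); last by rewrite divr_ge0// ltW.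
  by apply: lee_nneseries => // i _; apply: ltW; have [] := CU i.
have := @nonincreasing_cvg_mu _ _ _ m W (mfin (mW 0%N)) mW mBW.
have niW : nonincreasing_seq W.
  move=> j k jk; apply/subsetPset; apply: setDS.
  by rewrite -!bigcup_mkord => x [i /= ij Cx]; exists i => //=; exact: leq_trans jk.
move=> /(_ niW) hW.
have fW k : m (W k) \is a fin_num by exact: fin_num_measure.
have fBW : m (\bigcap_k W k) \is a fin_num by exact: fin_num_measure.
have {}hW : m \o W @ \oo --> (fine (m (\bigcap_k W k)))%:E by rewrite fineK.
move: hW => /fine_cvgP[_ /cvgrPdist_lt/(_ (e / 2)%R)].
rewrite divr_gt0// => /(_ isT)[k _ /(_ k (leqnn k))] /= hk.
have {}W0 : (fine (m (\bigcap_k W k)) <= e / 2)%R by rewrite -lee_fin fineK.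
exists (\big[setU/set0]_(i < k) C i), V; split => //.
- by apply: closed_bigsetU => i _; have [] := CU i.
- rewrite -bigcup_mkord => x [i _ Cix]; exists i => //; have [_ _ CE _ _] := CU i; exact: CE.
- by move=> x [i _ Eix]; exists i => //; have [_ _ _ EU _] := CU i; exact: EU.
- rewrite -[X in X < _]/(m (W k)) -(fineK (fW k)) lte_fin.
  move: hk; rewrite ltr_norml => /andP[+ _]; lra.
Qed.

Lemma inner_regular (E : set 'rV[R]_n) (e : R) : measurable E -> (0 < e)%R ->
  exists C, [/\ closed C, C `<=` E & m (E `\` C) < e%:E].
Proof.
move=> mE e0.
have aE : approx E.
  apply: (@smallest_sub _ (sigma_algebra setT) (@open T) approx _ _ E mE).
    split.
    - exact/approx_closed/closed0.
    - by move=> F aF; rewrite setTD; exact: approxC.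
    - exact: approxU.
  by move=> U oU; rewrite -[U]setCK; apply: approxC; apply: approx_closed; exact: open_closedC.
have [C [U [cC oU CE EU h]]] := aE e e0; exists C; split => //.
apply: le_lt_trans h; apply: le_measure; rewrite ?inE.
- by apply: measurableD => //; exact: closed_measurable_rV.
- by apply: measurableD; [exact: open_measurable_rV|exact: closed_measurable_rV].
- exact: setSD.
Qed.

End inner_regularity.

Section variation_inequality.
Context {R : realType} {n : nat} (Omega : set 'rV[R]_n) (oO : open Omega).
Local Notation lebesgue := (@lebesgue_measure R).

#[local] Instance lebesgue_ae_filter : Filter (nbhs (almost_everywhere lebesgue)) :=
  ae_filter_ringOfSetsType lebesgue.

Lemma radon_variation_ge0 (nu : set 'rV[R]_n -> R) B : 0 <= radon_variation Omega nu B.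
Proof.
apply: (@le_trans _ _ (\sum_(0 <= i <oo) `|nu set0|%:E)).
  by apply: nneseries_ge0 => i _ _; rewrite lee_fin.
apply: ereal_sup_ubound; exists (fun=> set0); split => //.
- by move=> i; exact: compactly_in0.
- by apply/trivIsetP => i j _ _ _; rewrite setI0.
- by move=> x [i].
Qed.

(** Convergence theorems are applied to [h]; the maximum with 0 makes it nonnegative everywhere, not
    just almost everywhere. *)
Lemma ae_measurable_rep (g : R -> \bar R) : ae_measurable g -> (forall t, 0 <= g t) ->
  exists h : measurableTypeR R -> \bar R, [/\ measurable_fun setT h, forall t, 0 <= h t,
    {ae lebesgue, forall t, g t = h t} & \int[lebesgue]_t g t = \int[lebesgue]_t h t].
Proof.
move=> [h mh [N [mN N0 sN]]] g0; exists (fun t => maxe (h t) 0).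
have gh t : ~ N t -> g t = maxe (h t) 0.
  move=> nN; have e : g t = h t by apply: contrapT => ne; apply: nN; exact: sN.
  by rewrite -e max_l.
split.
- by apply: measurable_maxe => //; exact: measurable_cst.
- by move=> t; rewrite le_max lexx orbT.
- by exists N; split => // t; apply: contra_notP => /gh.
- by apply: (eq_integral_off_null mN) => // t _; exact: gh.
Qed.

Lemma upper_test_bounds nu C C' (psi : 'rV[R]_n -> R) : radon Omega nu ->
  compact C -> compact C' -> C `<=` Omega -> C' `<=` Omega ->
  (forall x, 0 <= psi x <= 1)%R -> (forall x, C x -> psi x = 1%R) ->
  (forall x, ~ C' x -> psi x = 0%R) ->
  upper_var Omega nu C <= \int[upper_var Omega nu]_(x in Omega) (psi x)%:E <=
    upper_var Omega nu C'.
Proof.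
move=> hnu cC cC' CO C'O psi01 psi1 psi0.
pose m := radon_upper hnu.
have mO : measurable Omega := open_measurable_rV oO.
have iE B : compact B -> B `<=` Omega -> \int[m]_(x in Omega) (\1_B x)%:E = upper_var Omega nu B.
  by move=> cB BO; rewrite integral_indic ?setIidl//; exact: compact_measurable_rV.
rewrite -(iE C)// -(iE C')//; apply/andP; split; apply: (ge0_le_integral_any m) => x;
  rewrite ?lee_fin//.
- rewrite indicE; have [Cx|nCx] := pselect (C x).
    by rewrite psi1// mem_set.
  by rewrite memNset//; have /andP[] := psi01 x.
- by have /andP[] := psi01 x.
- rewrite indicE; have [Cx|nCx] := pselect (C' x).
    by rewrite mem_set//; have /andP[] := psi01 x.
  by rewrite memNset// psi0.
Qed.

Lemma test_le_variation nu C (psi : 'rV[R]_n -> R) : radon Omega nu ->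
  compact C -> C `<=` Omega ->
  (forall x, 0 <= psi x <= 1)%R -> (forall x, ~ C x -> psi x = 0%R) ->
  `|sintegral_radon Omega nu (fun x => (psi x)%:E)| <= radon_variation Omega nu C.
Proof.
move=> hnu cC CO psi01 psi0; have hnuN := radonN hnu.
have c0 : compact (set0 : set 'rV[R]_n) by exact: compact0.
(* The lower bound 0 comes from taking the empty set as inner compact set, on which psi = 1 holds
   vacuously. *)
have /andP[a0 aC] : 0 <= \int[upper_var Omega nu]_(x in Omega) (psi x)%:E <= upper_var Omega nu C.
  by rewrite -[X in X <= _ <= _](upper_var0 hnu); apply: upper_test_bounds.
have /andP[b0 bC] : 0 <= \int[lower_var Omega nu]_(x in Omega) (psi x)%:E <= lower_var Omega nu C.
  by rewrite -[X in X <= _ <= _](upper_var0 hnuN); apply: upper_test_bounds.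
rewrite radon_variationE//; last exact: compact_measurable_rV.
apply: le_trans (lee_abs_sub _ _) _; rewrite !gee0_abs//; exact: leeD.
Qed.

Context (mu : set 'rV[R]_n -> R) (hmu : radon Omega mu).
Context (nu : R -> set 'rV[R]_n -> R) (P : R -> ('rV[R]_n -> R) -> \bar R).
Hypothesis hnu : {ae lebesgue, forall t, radon Omega (nu t) /\
  forall phi, Cinftyc Omega phi -> sintegral_radon Omega (nu t) (fun x => (phi x)%:E) = P t phi}.
Hypothesis mV : forall B : set 'rV[R]_n, measurable B -> B `<=` Omega ->
  ae_measurable (fun t => radon_variation Omega (nu t) B).
Hypothesis Vfin : forall K : set 'rV[R]_n, compact K -> K `<=` Omega ->
  \int[lebesgue]_t radon_variation Omega (nu t) K < +oo.
Hypothesis hP : forall phi, Cinftyc Omega phi ->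
  lebesgue.-integrable setT (P ^~ phi) /\
  sintegral_radon Omega mu (fun x => (phi x)%:E) = \int[lebesgue]_t P t phi.

Let V t B := radon_variation Omega (nu t) B.

Lemma integral_variation_le B B' : B `<=` B' ->
  \int[lebesgue]_t V t B <= \int[lebesgue]_t V t B'.
Proof.
move=> BB'; apply: ge0_le_integral_any => t; first exact: radon_variation_ge0.
apply: ereal_sup_le => _ [F [mF cF tF FB ->]]; exists F; split => //.
exact: subset_trans BB'.
Qed.

Lemma test_le_integral_variation C psi : compact C -> C `<=` Omega ->
  Cinftyc Omega psi ->
  (forall x, 0 <= psi x <= 1)%R -> (forall x, ~ C x -> psi x = 0%R) ->
  `|sintegral_radon Omega mu (fun x => (psi x)%:E)| <= \int[lebesgue]_t V t C.
Proof.
move=> cC CO spsi psi01 psi0; have [iP ->] := hP spsi.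
have mC := compact_measurable_rV cC.
have [h [mh h0 Vh ->]] := ae_measurable_rep (mV mC CO) (fun t => radon_variation_ge0 (nu t) C).
have mP : measurable_fun setT (P ^~ psi) by case/integrableP: iP.
apply: (le_trans (le_abse_integral lebesgue measurableT mP)).
apply: ae_ge0_le_integral => //; first exact: measurableT_comp.
apply: filterS2 hnu Vh => t [rt Pt] Vt _.
by rewrite -Vt -Pt//; exact: test_le_variation.
Qed.

Lemma upper_thick_cvg ka C (d : R) : radon Omega ka -> compact C -> (0 < d)%R ->
  thick C d `<=` Omega ->
  upper_var Omega ka (thick C (d / k.+1%:R)) @[k --> \oo] --> upper_var Omega ka C.
Proof.
move=> hka cC d0 CO.
have cT k : compact (thick C (d / k.+1%:R)) by apply: thick_compact => //; rewrite divr_gt0.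
have TO k : thick C (d / k.+1%:R) `<=` Omega.
  apply: subset_trans CO; apply: thickS; rewrite ler_pdivrMr//.
  by apply: ler_peMr; [exact: ltW|rewrite ler1n].
have clC := compact_closed_rV cC.
rewrite -{2}(bigcap_thick clC d0).
apply: (@nonincreasing_cvg_mu _ _ _ (radon_upper hka)).
- exact: upper_var_compact_lty.
- by move=> k; exact: compact_measurable_rV.
- by rewrite bigcap_thick//; exact: compact_measurable_rV.
- by apply: thick_nonincreasing; exact: ltW.
Qed.

(** A smooth Urysohn function between [C] and a thickening gives the bound on the thickening up to
    an error; then the thickenings shrink to [C]. *)
Lemma compact_le_integral_variation C : compact C -> C `<=` Omega ->
  `|mu C|%:E <= \int[lebesgue]_t V t C.
Proof.
move=> cC CO; have [d d0 TO] := compact_thick_sub cC oO CO.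
have hmuN := radonN hmu; have mC := compact_measurable_rV cC.
pose T k := thick C (d / k.+1%:R).
have dk0 (k : nat) : (0 < d / k.+1%:R)%R by rewrite divr_gt0.
have cT k : compact (T k) by apply: thick_compact.
have TkO k : T k `<=` Omega.
  apply: subset_trans TO; apply: thickS; rewrite ler_pdivrMr//.
  by apply: ler_peMr; [exact: ltW|rewrite ler1n].
have mT k : measurable (T k) := compact_measurable_rV (cT k).
have cyC : compactly_in Omega C by exists C; split.
have fu E ka : radon Omega ka -> compact E -> E `<=` Omega -> upper_var Omega ka E \is a fin_num.
  move=> hka cE EO; rewrite ge0_fin_numE; first exact: upper_var_compact_lty.
  exact: upper_var_ge0.
pose up k := upper_var Omega mu (T k); pose lo k := lower_var Omega mu (T k).
(* Each Jordan part of [mu] integrates the Urysohn function to a value between its masses on [C] and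
   on [T k], so [err k] bounds the distance from mu(C) to the integral. *)
pose err k := (up k - upper_var Omega mu C) + (lo k - lower_var Omega mu C).
have step k : `|mu C|%:E <= \int[lebesgue]_t V t (T k) + err k.
  have [psi [kpsi psi01 psi1 psi0]] := smooth_urysohn cC (dk0 k).
  have spsi : Cinftyc Omega psi.
    move=> j; split => //; exists (T k); split => // x /eqP; apply: contra_notP.
    exact: psi0.
  have h := test_le_integral_variation (cT k) (TkO k) spsi psi01 psi0.
  have /andP[u1 u2] := upper_test_bounds hmu cC (cT k) CO (TkO k) psi01 psi1 psi0.
  have /andP[l1 l2] := upper_test_bounds hmuN cC (cT k) CO (TkO k) psi01 psi1 psi0.
  have fuC := fu C _ hmu cC CO; have flC := fu C _ hmuN cC CO.
  have fuT := fu _ _ hmu (cT k) (TkO k); have flT := fu _ _ hmuN (cT k) (TkO k).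
  set a := \int[upper_var Omega mu]_(x in Omega) _ in u1 u2.
  set b := \int[upper_var Omega (fun E => - mu E)%R]_(x in Omega) _ in l1 l2.
  have fa : a \is a fin_num.
    rewrite ge0_fin_numE; last by apply: le_trans u1; exact: upper_var_ge0 hmu _.
    by apply: le_lt_trans u2 _; rewrite -ge0_fin_numE//; exact: upper_var_ge0 hmu _.
  have fb : b \is a fin_num.
    rewrite ge0_fin_numE; last by apply: le_trans l1; exact: upper_var_ge0 hmuN _.
    by apply: le_lt_trans l2 _; rewrite -ge0_fin_numE//; exact: upper_var_ge0 hmuN _.
  apply: le_trans (leeD2r _ h).
  rewrite /sintegral_radon -/a -[lower_var Omega mu]/(upper_var Omega (fun E => - mu E)%R) -/b.
  have := radon_jordan hmu mC cyC.
  rewrite /err /up /lo /lower_var.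
  move: u1 u2 l1 l2; rewrite -(fineK fa) -(fineK fb) -(fineK fuC) -(fineK flC).
  rewrite -(fineK fuT) -(fineK flT).
  rewrite -!EFinB -!EFinD. rewrite !lee_fin => u1 u2 l1 l2 [->].
  have := ler_norm (fine a - fine b)%R; have := ler_norm (fine b - fine a)%R.
  rewrite distrC => n1 n2.
  by rewrite ler_norml; apply/andP; split; lra.
have cerr : err k @[k --> \oo] --> 0.
  have cu := upper_thick_cvg hmu cC d0 TO; have cl := upper_thick_cvg hmuN cC d0 TO.
  have fuC := fu C _ hmu cC CO; have flC := fu C _ hmuN cC CO.
  rewrite -[X in _ --> X]adde0 -{1}(subee fuC) -(subee flC).
  apply: cvgeD; first by rewrite !subee.
    by apply: cvgeB => //; [rewrite fin_num_adde_defl// fin_numN|exact: cvg_cst].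
  by apply: cvgeB => //; [rewrite fin_num_adde_defl// fin_numN|exact: cvg_cst].
have /choice[h hE] : forall k, exists h : measurableTypeR R -> \bar R,
    [/\ measurable_fun setT h, forall t, 0 <= h t,
    {ae lebesgue, forall t, V t (T k) = h t} & \int[lebesgue]_t V t (T k) = \int[lebesgue]_t h t].
  by move=> k; apply: ae_measurable_rep (mV (mT k) (TkO k)) _ => t; exact: radon_variation_ge0.
have [h0 [mh0 h00 Vh0 ->]] := ae_measurable_rep (mV mC CO) (fun t => radon_variation_ge0 (nu t) C).
have Tni : nonincreasing_seq T by apply: thick_nonincreasing; exact: ltW.
(* For almost every t, the variation of [nu t] on [T k] tends to that on [C], its Jordan parts being
   finite on compact sets; the value on [T 0] dominates and has finite integral. *)
have [_ _ cvI] : [/\ lebesgue.-integrable setT h0,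
   [sequence \int[lebesgue]_t `|h k t - h0 t|]_k @ \oo --> 0 &
   [sequence \int[lebesgue]_t h k t]_k @ \oo --> \int[lebesgue]_t h0 t].
  apply: (@dominated_convergence _ _ _ lebesgue setT measurableT h h0 (h 0%N)).
  - by move=> k; have [] := hE k.
  - exact: mh0.
  - have : {ae lebesgue, forall t, forall k, V t (T k) = h k t}.
      by apply/ae_foralln => k; have [] := hE k.
    apply: filterS3 hnu Vh0 => t [rt _] V0 Vk _.
    have rtN := radonN rt.
    rewrite -V0 (_ : h ^~ t = fun k => V t (T k)); last by apply/funext => k.
    have VE B : measurable B -> V t B = upper_var Omega (nu t) B + lower_var Omega (nu t) B.
      exact: radon_variationE.
    rewrite radon_variationE// (_ : (fun k => V t (T k)) =
      fun k => upper_var Omega (nu t) (T k) + lower_var Omega (nu t) (T k)); last first.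
      by apply/funext => k; exact: VE.
    apply: cvgeD.
    + by rewrite fin_num_adde_defl// (fu C _ rtN).
    + exact: upper_thick_cvg.
    + exact: upper_thick_cvg.
  - have [mh hk0 _ e] := hE 0%N; apply/integrableP; split => //.
    rewrite (eq_integral (h 0%N)); last by move=> t _; rewrite gee0_abs.
    by rewrite -e; exact: Vfin.
  - have : {ae lebesgue, forall t, forall k, V t (T k) = h k t}.
      by apply/ae_foralln => k; have [] := hE k.
    apply: filterS => t Vk k _; have [_ hk0 _ _] := hE k.
    rewrite gee0_abs// -!Vk; apply: ereal_sup_le => _ [F [mF cF tF FB ->]].
    exists F; split => //; apply: subset_trans FB _.
    by move: (Tni _ _ (leq0n k)) => /subsetPset.
have := @cvgeD _ _ _ _ _ _ _ _ _ cvI cerr.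
rewrite adde0 => /(_ _)cv.
apply: cvge_ge (cv _).
- near=> k; apply: le_trans (step k) _; rewrite leeD2r//.
  by have [_ _ _ e] := hE k; rewrite -[leRHS]/(\int[lebesgue]_t h k t) -e.
- by rewrite fin_num_adde_defl.
Unshelve. all: by end_near. Qed.

(** Inner regularity is applied to each Jordan part of [mu]; the union of the two closed sets serves
    both, leaving at most e/2 for each. *)
Lemma set_le_integral_variation E : measurable E -> compactly_in Omega E ->
  `|mu E|%:E <= \int[lebesgue]_t V t E.
Proof.
move=> mE [K [cK KO EK]]; have hmuN := radonN hmu.
apply/lee_addgt0Pr => e e0.
have e20 : (0 < e / 2)%R by rewrite divr_gt0.
have [C1 [cC1 C1E h1]] := inner_regular (upper_restr hmu cK KO) mE e20.
have [C2 [cC2 C2E h2]] := inner_regular (upper_restr hmuN cK KO) mE e20.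
pose C := C1 `|` C2.
have CE : C `<=` E by rewrite subUset.
have cC : compact C.
  apply: (subclosed_compact _ cK); first exact: closedU.
  exact: subset_trans EK.
have mC := compact_measurable_rV cC.
have mD : measurable (E `\` C) by exact: measurableD.
have DK : E `\` C `<=` K by move=> x [Ex _]; exact: EK.
have cyD : compactly_in Omega (E `\` C) by exists K.
have cyC : compactly_in Omega C by exists K; split => //; exact: subset_trans EK.
have muE : mu E = (mu C + mu (E `\` C))%R.
  by rewrite -(radonU hmu)// ?setDUK// setDIK.
have small ka (hka : radon Omega ka) C' : measurable C' -> C' `<=` C ->
    upper_restr hka cK KO (E `\` C') < (e / 2)%:E -> upper_var Omega ka (E `\` C) <= (e / 2)%:E.
  move=> mC' C'C; move/ltW; apply: le_trans.
  have -> : upper_restr hka cK KO (E `\` C') = upper_var Omega ka ((E `\` C') `&` K) by [].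
  apply: upper_varS => x [Ex nCx]; split; last exact: EK.
  by split => // /C'C.
have s1 : upper_var Omega mu (E `\` C) <= (e / 2)%:E.
  by apply: small h1 => //; [exact: closed_measurable_rV|exact: subsetUl].
have s2 : lower_var Omega mu (E `\` C) <= (e / 2)%:E.
  by apply: small h2 => //; [exact: closed_measurable_rV|exact: subsetUr].
have sD : `|mu (E `\` C)|%:E <= e%:E.
  apply: le_trans (abs_le_upper_lower hmu mD cyD) _.
  by rewrite [in leRHS](splitr e) EFinD leeD.
apply: (@le_trans _ _ (`|mu C|%:E + e%:E)).
  rewrite muE -EFinD lee_fin (le_trans (ler_normD _ _))// lerD2l.
  by rewrite -lee_fin.
rewrite leeD2r//; apply: le_trans (integral_variation_le CE).
by apply: compact_le_integral_variation => // x Cx; exact/KO/EK/CE.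
Qed.

(** For an admissible family [F], sum and integral are exchanged, and for almost every t the
    variation of [nu t] is countably additive through its Jordan parts. *)
Lemma variation_le_integral B : measurable B -> B `<=` Omega ->
  radon_variation Omega mu B <= \int[lebesgue]_t V t B.
Proof.
move=> mB BO; apply: ge_ereal_sup => _ [F [mF cF tF FB ->]].
have FO i : F i `<=` Omega by apply: subset_trans BO => x Fx; apply: FB; exists i.
apply: (@le_trans _ _ (\sum_(0 <= i <oo) \int[lebesgue]_t V t (F i))).
  by apply: lee_nneseries => i _; rewrite ?lee_fin//; exact: set_le_integral_variation.
have /choice[h hE] : forall k, exists h : measurableTypeR R -> \bar R,
    [/\ measurable_fun setT h, forall t, 0 <= h t,
    {ae lebesgue, forall t, V t (F k) = h t} & \int[lebesgue]_t V t (F k) = \int[lebesgue]_t h t].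
  by move=> k; apply: ae_measurable_rep (mV (mF k) (FO k)) _ => t; exact: radon_variation_ge0.
have [h0 [mh0 h00 Vh0 ->]] := ae_measurable_rep (mV mB BO) (fun t => radon_variation_ge0 (nu t) B).
have -> : \sum_(0 <= i <oo) \int[lebesgue]_t V t (F i) = \sum_(0 <= i <oo) \int[lebesgue]_t h i t.
  by apply: eq_eseriesr => i _; have [] := hE i.
have mh k : measurable_fun setT (h k) by have [] := hE k.
have hk0 k t : 0 <= h k t by have [_ + _ _] := hE k; apply.
rewrite -integral_nneseries//.
apply: ae_ge0_le_integral => //.
- by move=> t _; apply: nneseries_ge0.
- exact: ge0_emeasurable_sum.
have Vk : {ae lebesgue, forall t, forall k, V t (F k) = h k t}.
  by apply/ae_foralln => k; have [] := hE k.
apply: filterS3 hnu Vh0 Vk => t [rt _] V0 Vk _.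
rewrite -V0.
have mU : measurable (\bigcup_i F i) by exact: bigcupT_measurable.
apply: (@le_trans _ _ (V t (\bigcup_i F i))); last first.
  apply: ereal_sup_le => _ [G [mG cG tG GB ->]]; exists G; split => //.
  exact: subset_trans FB.
have rtN := radonN rt.
rewrite (eq_eseriesr
  (g := fun k => upper_var Omega (nu t) (F k) + lower_var Omega (nu t) (F k))); last first.
  by move=> k _; rewrite -Vk; exact: radon_variationE.
rewrite nneseriesD; last 2 first.
  by move=> *; exact: (upper_var_ge0 rt).
  by move=> *; exact: (upper_var_ge0 rtN).
rewrite [leRHS]radon_variationE//.
by rewrite (upper_var_bigcup rt)// (upper_var_bigcup rtN).
Qed.

End variation_inequality.

Theorem theorem6p1 (R : realType) (N : nat) (hN : (0 < N)%N)
  (Omega : set 'rV[R]_N) (openO : open Omega) (nonemptyO : Omega !=set0)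
  (A : set 'rV[R]_N -> 'rV[R]_N) (divA : set 'rV[R]_N -> R)
  (hA : DMloc Omega A divA)
  (lam : 'rV[R]_N -> R) (mlam : measurable_fun Omega lam)
  (lam01 : forall x, Omega x -> (0 <= lam x <= 1)%R)
  (u : 'rV[R]_N -> R) (mu : set 'rV[R]_N -> R)
  (hu : BVloc Omega A divA lam u mu)
  (hsup : L1loc2 Omega A divA (fun x => (lam x)%:E * approx_sup Omega u x))
  (hinf : L1loc2 Omega A divA
            (fun x => (1 - lam x)%:E * approx_inf Omega u x))
  (hN_t : {ae @lebesgue_measure R, forall t,
     vradon_variation Omega A (exceptional_set Omega u t) +
     radon_variation Omega divA (exceptional_set Omega u t) = 0}) :
  (forall phi : 'rV[R]_N -> R, Ckc Omega 1 phi ->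
     (@lebesgue_measure R).-integrable setT
       (fun t => pairing Omega A divA lam \1_(superlevel Omega u t) phi) /\
     sintegral_radon Omega mu (fun x => (phi x)%:E) =
     \int[@lebesgue_measure R]_t
       pairing Omega A divA lam \1_(superlevel Omega u t) phi) /\
  (forall nu : R -> set 'rV[R]_N -> R,
     coarea_well_posed Omega A divA lam u nu ->
     forall B : set 'rV[R]_N, measurable B -> B `<=` Omega ->
       radon_variation Omega mu B <=
       \int[@lebesgue_measure R]_t radon_variation Omega (nu t) B).
Proof.
have [rA rdivA hdiv] := hA; have [[_ hL] hmu] := hu.
have coarea phi : Ckc Omega 1 phi ->
    (@lebesgue_measure R).-integrable setT
      (fun t => pairing Omega A divA lam \1_(superlevel Omega u t) phi) /\
    sintegral_radon Omega mu (fun x => (phi x)%:E) =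
    \int[@lebesgue_measure R]_t
      pairing Omega A divA lam \1_(superlevel Omega u t) phi.
  move=> cphi; have [K [cK KO phi0 _]] := smooth_C1_approx openO cphi.
  rewrite (pairing_measure_C1 openO rA rdivA hL hmu cphi).
  apply: coarea_for_integral.
  (* The constant 0 of [coarea_for] is expanded into the divergence expression for [phi], the form
     produced by [pairing_coarea]. *)
  rewrite -(divergence_theorem openO rA rdivA hdiv cphi).
  by apply: (pairing_coarea openO rA rdivA mlam lam01 hsup hinf cK KO) => //; case: cphi.
split => // nu [hnu mV Vfin] B mB BO.
pose P t phi := pairing Omega A divA lam \1_(superlevel Omega u t) phi.
apply: (@variation_le_integral _ _ _ openO mu hmu.1 nu P) => // phi cphi.
exact: coarea (cphi 1%N).
Qed.
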